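(* Let $\Phi$ be a root system of type $E_6$, $E_7$ or $E_8$, and let $K$ be the field with $|K|=2$. Let $\lambda,\mu,\nu,\xi\in\Phi_1$ be fixed pairwise orthogonal roots with $\lambda+\mu+\nu+\xi=2\delta$. Then the following is a complete list, without repetition, of the orbits of $G_0$ on $V_1$: 1. The zero orbit $\{0\}$. 2. One orbit consisting of the singular vectors; it is the orbit of $e_\lambda$. 3. One orbit consisting of the brilliant vectors; it is the orbit of $e_\lambda+e_\mu$. 4. Two orbits consisting of luminous vectors; they are the orbits of $e_\lambda+e_\mu+e_\nu$ and of $e_\lambda+e_{\delta-\lambda}$. 5. One orbit consisting of the dark vectors; it is the orbit of $e_\lambda+e_{\delta-\lambda}+e_\mu+e_\nu+e_\xi$.
   Context: Let $V$ be the Chevalley Lie algebra of type $\Phi$ over $K$, with Chevalley basis $\{e_\alpha\ (\alpha\in\Phi),\ h_\alpha\ (\alpha\in\Pi)\}$, where $\Pi$ is a system of simple roots. Let $G=G_{\mathrm{sc}}(\Phi,K)$ be the simply connected Chevalley group, acting on $V$ by the adjoint action, with elementary root elements $x_\alpha(a)$, $\alpha\in\Phi$, $a\in K$. For $y\in V$ write $y=\sum_{\alpha\in\Phi}y^\alpha e_\alpha+y^h$ with $y^h$ in the Cartan subalgebra spanned by the $h_\alpha$. Let $\delta$ be the maximal root of $\Phi$. All roots have the same length. Put $\Phi_0=\{\alpha\in\Phi:\alpha\perp\delta\}$ and $\Phi_1=\{\alpha\in\Phi:\angle(\alpha,\delta)=\pi/3\}$. Note that $\delta-\alpha\in\Phi_1$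 for $\alpha\in\Phi_1$. Let $V_1=\langle e_\alpha:\alpha\in\Phi_1\rangle\subset V$. Let $G_0=G_{\mathrm{sc}}(\Phi_0,K)$, which acts on $V_1$ as the subgroup of $G$ generated by the $x_\alpha(a)$, $\alpha\in\Phi_0$, $a\in K$. A root element of $V$ is an element of the $G$-orbit of $e_\delta$. The angle between two root elements $y,z$ is $\angle(\alpha,\beta)$, where $\alpha,\beta\in\Phi$ are roots such that the pair of lines $(Ky,Kz)$ is simultaneously conjugate under $G$ to $(Ke_\alpha,Ke_\beta)$. For $x=\sum_{\alpha\in\Phi_1}x^\alpha e_\alpha\in V_1$ let $Y(x)$ be the set of root elements $y$ with $y^\delta=1$ and $y^\alpha=x^\alpha$ for all $\alpha\in\Phi_1$; for $|K|=2$ this set has exactly two elements. If exactly one $y\in Y(x)$ satisfies $y^{-\delta}=0$, let $\theta(x)$ be the angle between this $y$ and $e_\delta$. Otherwise both elements of $Y(x)$ form the same angle with $e_\delta$, and $\theta(x)$ denotes this common angle. The vector $x$ is called singular, brilliant, luminous or dark if $\theta(x)$ is $\pi/3$, $\pi/2$, $2\pi/3$ or $\pi$, respectively. *)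

(* Defs.v *)
From mathcomp Require Import all_boot all_order all_algebra all_fingroup finmap.
From mathcomp Require Import reals trigo.

Set Implicit Arguments.
Unset Strict Implicit.
Unset Printing Implicit Defensive.

Import Order.TTheory GRing.Theory Num.Theory.
Local Open Scope ring_scope.

Section RootSystem.
Variables (R : realType) (n : nat).
Implicit Types (u v a b : 'rV[R]_n) (Phi : {fset 'rV[R]_n}) (Pi : n.-tuple 'rV[R]_n).

Definition dot u v : R := (u *m v^T) ord0 ord0.

Definition angle u v : R := acos (dot u v / (Num.sqrt (dot u u) * Num.sqrt (dot v v))).

Definition coroot a : 'rV[R]_n := (2 / dot a a) *: a.

(* Reduced, crystallographic, and spanning the ambient space. *)
Definition root_system Phi : Prop :=
  [/\ <<enum_fset Phi>>%VS = fullv,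
      0 \notin Phi,
      forall a (t : R), a \in Phi -> t *: a \in Phi -> t = 1 \/ t = -1,
      forall a b, a \in Phi -> b \in Phi -> b - dot b (coroot a) *: a \in Phi
    & forall a b, a \in Phi -> b \in Phi -> dot b (coroot a) \is a Num.int].

Definition nonneg_comb Pi v : Prop :=
  exists c : 'I_n -> nat, v = \sum_(i < n) (c i)%:R *: tnth Pi i.

Definition simple_system Phi Pi : Prop :=
  [/\ basis_of fullv Pi,
      forall i, tnth Pi i \in Phi
    & forall a, a \in Phi -> nonneg_comb Pi a \/ nonneg_comb Pi (- a)].

(* Cartan matrix of E_n, n = 6, 7, 8, in Bourbaki's labelling of the simple
   roots shifted to start from 0: node 1 hangs off node 3 of the chain
   0, 2, 3, 4, ..., n - 1. *)
Definition E_edges : seq (nat * nat) :=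
  [:: (0, 2); (2, 3); (1, 3); (3, 4); (4, 5); (5, 6); (6, 7)]%N.

Definition E_cartan (i j : nat) : R :=
  if i == j then 2
  else if ((i, j) \in E_edges) || ((j, i) \in E_edges) then -1 else 0.

Definition type_E Pi : Prop :=
  n \in [:: 6; 7; 8]%N /\
  forall i j : 'I_n, dot (tnth Pi i) (coroot (tnth Pi j)) = E_cartan i j.

Definition maximal_root Phi Pi (delta : Phi) : Prop :=
  forall a : Phi, nonneg_comb Pi (val delta - val a).

Definition Phi_0 Phi (delta : Phi) : {set Phi} :=
  [set a : Phi | dot (val a) (val delta) == 0].

Definition Phi_1 Phi (delta : Phi) : {set Phi} :=
  [set a : Phi | angle (val a) (val delta) == pi / 3].

(* <b, a^vee>; the floor only serves to move an integral real to int. *)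
Definition cartan_int b a : int := Num.floor (dot b (coroot a)).

(* The integers m_i with a^vee = \sum_i m_i (alpha_i)^vee, i.e. with
   h_a = \sum_i m_i h_(alpha_i). *)
Definition coroot_coef Pi a (i : 'I_n) : int :=
  Num.floor (coord (map_tuple coroot Pi) i (coroot a)).

End RootSystem.

(* Index set of a Chevalley basis: inl a stands for e_a (a a root), inr i for
   h_(alpha_i) (alpha_i a simple root).  An element of the Chevalley algebra
   over A is the family of its coordinates. *)
Definition chev_index (R : realType) (n : nat) (Phi : {fset 'rV[R]_n}) : finType :=
  (Phi + 'I_n)%type.

Definition chev_alg (R : realType) (n : nat) (Phi : {fset 'rV[R]_n}) (A : Type) :=
  {ffun chev_index Phi -> A}.

Section ChevalleyAlgebra.
Variables (R : realType) (n : nat) (Phi : {fset 'rV[R]_n}) (Pi : n.-tuple 'rV[R]_n).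
(* Structure constants [e_a, e_b] = N a b e_(a + b); only the values at roots
   a, b such that a + b is a root matter. *)
Variable (N : 'rV[R]_n -> 'rV[R]_n -> int).
Notation B := (chev_index Phi).

Definition basis_vec (A : nzRingType) (b : B) : {ffun B -> A} :=
  [ffun c => (c == b)%:R].

(* e_v for a root v; by convention 0 if v is not a root. *)
Definition root_vec (A : nzRingType) (v : 'rV[R]_n) : {ffun B -> A} :=
  [ffun c => if c is inl a then (val a == v)%:R else 0].

(* The coordinate y^v of y at e_v, for a root v; 0 if v is not a root. *)
Definition root_coord (A : nzRingType) (y : {ffun B -> A}) (v : 'rV[R]_n) : A :=
  if insub v is Some a then y (inl a) else 0.

(* h_v for a root v. *)
Definition coroot_vec (v : 'rV[R]_n) : {ffun B -> int} :=
  [ffun c => if c is inr i then coroot_coef Pi v i else 0].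

Definition basis_bracket (b c : B) : {ffun B -> int} :=
  match b, c return {ffun B -> int} with
  | inl a, inl a' =>
      if val a + val a' == 0
      then coroot_vec (val a)
      else root_vec int (val a + val a') *~ N (val a) (val a')
  | inr i, inl a => root_vec int (val a) *~ cartan_int (val a) (tnth Pi i)
  | inl a, inr i => - root_vec int (val a) *~ cartan_int (val a) (tnth Pi i)
  | inr _, inr _ => 0
  end.

Definition bracket (A : comNzRingType) (x y : {ffun B -> A}) : {ffun B -> A} :=
  [ffun d => \sum_b \sum_c x b * y c * (basis_bracket b c d)%:~R].

(* (e_a, h_(alpha_i)) is a Chevalley basis: the bracket makes the Z-span a Lie
   ring, and N a b = +- (p + 1), where b - p a, ..., b, b + a, ... is the
   a-string through b. *)
Definition chevalley_constants : Prop :=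
  [/\ forall x : {ffun B -> int}, bracket x x = 0,
      forall x y z : {ffun B -> int},
        bracket x (bracket y z) + bracket y (bracket z x)
          + bracket z (bracket x y) = 0
    & forall (a b : 'rV[R]_n) (p : nat),
        a \in Phi -> b \in Phi -> a + b \in Phi ->
        (forall k : nat, (k <= p)%N -> b - k%:R *: a \in Phi) ->
        b - p.+1%:R *: a \notin Phi ->
        N a b = p.+1%:Z \/ N a b = - p.+1%:Z].

(* The coordinates of (ad e_a)^k / k! (c), c a basis element; the division is
   exact. *)
Definition ad_divpow (a : Phi) (k : nat) (c : B) : {ffun B -> int} :=
  [ffun d => (iter k (bracket (root_vec int (val a))) (basis_vec int c) d
              %/ (k`!)%:Z)%Z].

Variable K : finFieldType.
Notation V := (chev_alg Phi K).

(* x_a(t) = exp (t ad e_a) = \sum_k t^k (ad e_a)^k / k!, reduced from Z to K;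
   (ad e_a)^4 = 0 in any Chevalley algebra. *)
Definition x_root (a : Phi) (t : K) (v : V) : V :=
  [ffun d => \sum_c v c * \sum_(k < 4) t ^+ k * (ad_divpow a k c d)%:~R].

(* The group of transformations of V generated by the x_a(t), a in S, t in K.
   Each x_a(t) is bijective, hence given by exactly one permutation of V. *)
Definition elementary_group (S : {set Phi}) : {group {perm V}} :=
  <<[set g : {perm V} |
      [exists a in S, exists t : K, forall v : V, g v == x_root a t v]]>>%G.

(* Over a field the simply connected group is generated by its elementary root
   elements; this is its image in GL(V). *)
Definition chev_group : {group {perm V}} := elementary_group [set: Phi].

Definition line (y : V) : {set V} :=
  [set z : V | [exists t : K, [forall b, z b == t * y b]]].

Definition has_angle (y z : V) (phi : R) : Prop :=
  exists (a b : Phi) (g : {perm V}),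
    [/\ g \in chev_group,
        g @: line y = line (root_vec K (val a)),
        g @: line z = line (root_vec K (val b))
      & angle (val a) (val b) = phi].

Variable delta : Phi.

Definition root_elements : {set V} :=
  orbit 'P chev_group (root_vec K (val delta) : V).

Definition V_1 : {set V} :=
  [set x : V | [forall b : B,
     (x b != 0) ==> (if b is inl a then a \in Phi_1 delta else false)]].

Definition G_0 : {group {perm V}} := elementary_group (Phi_0 delta).

Definition Y_set (x : V) : {set V} :=
  [set y in root_elements | (root_coord y (val delta) == 1) &&
     [forall a in Phi_1 delta, y (inl a) == x (inl a)]].

(* theta(x) = phi *)
Definition has_theta (x : V) (phi : R) : Prop :=
  let Y0 := [set y in Y_set x | root_coord y (- val delta) == 0] in
  if #|Y0| == 1%N
  then exists2 y, y \in Y0 & has_angle y (root_vec K (val delta)) phi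
  else Y_set x != set0 /\
       forall y, y \in Y_set x -> has_angle y (root_vec K (val delta)) phi.

Definition singular (x : V) : Prop := x \in V_1 /\ has_theta x (pi / 3).
Definition brilliant (x : V) : Prop := x \in V_1 /\ has_theta x (pi / 2).
Definition luminous (x : V) : Prop := x \in V_1 /\ has_theta x (2 * pi / 3).
Definition dark (x : V) : Prop := x \in V_1 /\ has_theta x pi.

End ChevalleyAlgebra.

(* Main.v *)
(** Over [F_2] all signs vanish, and [x_a(1)] is [1 + ad e_a + P_a] with
    [P_a y = y^(-a) e_a].  Half of the Leibniz rule for [(ad e_a)^2 = -2 P_a]
    over the integers shows that it is an automorphism, and that root elements
    are extremal, i.e. satisfy Premet's identities.  An extremal [y] with
    [y^d = 1] can be freed of its components in degree 1 by elements [x_(a-d)(1)],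
    and is then [e_d] or [x_(-d)(1) e_d]; hence [Y(x) = {y, x_(-d)(1) y}].

    Any [x] in [V_1] is brought to normal form by choosing pairwise orthogonal
    pivots [f] with [x^f = 1] and clearing the coordinates adjacent to them; only
    the coordinate at [d - f1], for the first pivot [f1], survives.  This leaves
    [e_f1 + ... + e_fk] and [e_f1 + ... + e_fk + e_(d - f1)] with [k <= 4], which
    reduce to the representatives of the list because [G_0] is transitive on
    orthogonal frames.  The few facts needed about the roots of [E_6], [E_7] and
    [E_8] are checked by enumerating them in integral coordinates.

    The angle of two roots is determined by brackets of root vectors, so that
    [theta] is constant on the orbits and can be computed on the representatives;
    the two luminous orbits are told apart by the number of [y] in [Y(x)] with
    [y^(-d) = 0]. *)

Require Import Defs.
From Stdlib Require Import ZArith.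
From mathcomp Require Import all_boot all_order all_algebra all_fingroup finmap.
From mathcomp Require Import reals trigo.
From mathcomp Require Import zify ssrZ ring lra.

Set Implicit Arguments.
Unset Strict Implicit.
Unset Printing Implicit Defensive.

Import Order.TTheory GRing.Theory Num.Theory.
Local Open Scope ring_scope.
Local Arguments basis_bracket : simpl never.

(** The automorphism property of [x_a(1)] is out of reach over the field alone: its quadratic part
    is half of [(ad e_a)^2], and both sides of the Leibniz rule for the square vanish modulo 2. So
    the rule is halved over the integers and reduced only afterwards. The root system is given by
    axioms, so enumerating roots proves nothing until the list is known to be complete; a descent on
    the height supplies this. Clearing stops at [d - f1] because this root is adjacent to every
    pivot but [f1]. The element [x_(d-f1-f2)(1)], which uses the pivot [f2] to change the coordinate
    at [d - f1], also uses [f1] to change the one at [d - f2]. The two are toggled together, so one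
    of them has to be exempted. The number of [y] in [Y(x)] with [y^(-d) = 0] depends on one bit:
    [x_(-d)(1)] changes [y^(-d)] by 1 plus the value of [-d] on the Cartan part of [y]. This bit is
    0 above [e_l + e_m + e_v] and 1 above [e_l + e_(d-l)]. *)

Section DotProduct.
Variables (R : realType) (n : nat).
Implicit Types (u v w : 'rV[R]_n).

Lemma dotE u v : dot u v = \sum_i u 0 i * v 0 i.
Proof. by rewrite /dot mxE; apply: eq_bigr => i _; rewrite !mxE. Qed.

Lemma dotC u v : dot u v = dot v u.
Proof. by rewrite !dotE; apply: eq_bigr => i _; rewrite mulrC. Qed.

Lemma dotDl u v w : dot (u + v) w = dot u w + dot v w.
Proof. by rewrite /dot mulmxDl mxE. Qed.

Lemma dotZl t u v : dot (t *: u) v = t * dot u v.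
Proof. by rewrite /dot -scalemxAl mxE. Qed.

Lemma dotZr t u v : dot u (t *: v) = t * dot u v.
Proof. by rewrite dotC dotZl dotC. Qed.

Lemma dot0l u : dot 0 u = 0.
Proof. by rewrite /dot mul0mx mxE. Qed.

Lemma dot_suml (I : Type) (r : seq I) (F : I -> 'rV[R]_n) v :
  dot (\sum_(i <- r) F i) v = \sum_(i <- r) dot (F i) v.
Proof.
elim: r => [|i r IHr]; first by rewrite !big_nil dot0l.
by rewrite !big_cons dotDl IHr.
Qed.

Lemma dot_gt0 u : u != 0 -> 0 < dot u u.
Proof.
move=> u0; have dE : dot u u = \sum_i u 0 i ^+ 2.
  by rewrite dotE; apply: eq_bigr => i _; rewrite expr2.
rewrite lt_neqAle eq_sym dE; apply/andP; split; last first.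
  by apply: sumr_ge0 => i _; rewrite sqr_ge0.
apply: contra u0 => /eqP s0; apply/eqP/rowP => i; rewrite mxE.
have /(_ i isT)/eqP := psumr_eq0P (fun j _ => sqr_ge0 (u 0 j)) s0.
by rewrite sqrf_eq0 => /eqP.
Qed.

End DotProduct.

(** * The roots of E_n in integral coordinates *)

Section ZCoordinates.
Local Open Scope Z_scope.

(* A root is encoded by the list [c] of its coordinates on the simple roots;
   [weightsZ n c] lists its products with the simple roots, and [dataZ] pairs
   the two. *)
Definition cartanZ (i j : nat) : Z :=
  if eqn i j then 2
  else if ((i, j) \in E_edges) || ((j, i) \in E_edges) then -1 else 0.

Definition weightsZ n (c : seq Z) : seq Z :=
  [seq foldr (fun j t => Z.add (Z.mul (nth Z0 c j) (cartanZ i j)) t) Z0 (iota 0 n)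
  | i <- iota 0 n].

Definition reflectZ n i (c : seq Z) : seq Z :=
  set_nth Z0 c i (Z.sub (nth Z0 c i) (nth Z0 (weightsZ n c) i)).

Definition simpleZ n i : seq Z := set_nth Z0 (nseq n Z0) i 1.

(** A layer holds positive roots of one height: reflecting in a simple root whose product with [c]
    is -1 adds that simple root, so each step raises the height by one. *)
Fixpoint raise_layers n k (layer : seq (seq Z)) : seq (seq Z) :=
  if k is k'.+1 then
    layer ++ raise_layers n k'
      (undup (flatten [seq [seq reflectZ n i c | i <- iota 0 n
                           & Z.eqb (nth Z0 (weightsZ n c) i) (-1)] | c <- layer]))
  else [::].

(* The highest root of E_8 has height 29. *)
Definition posZ n := raise_layers n 29 [seq simpleZ n i | i <- iota 0 n].

Definition rootsZ n := posZ n ++ [seq map Z.opp c | c <- posZ n].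

(** This is what the completeness proof consumes: simple reflections of listed positive roots stay
    in the list, and the signs of the coordinates tell its two halves apart. *)
Definition closedZ n :=
  (let L := rootsZ n in
   all (fun c => all (fun i => reflectZ n i c \in L) (iota 0 n)) (posZ n)) &&
  all (fun c => all (fun z => Z.leb 0 z) c && (size c == n)%N) (posZ n).

Definition dataZ n := [seq (c, weightsZ n c) | c <- rootsZ n].

Fixpoint dotZ (c w : seq Z) : Z :=
  match c, w with
  | x :: c', y :: w' => Z.add (Z.mul x y) (dotZ c' w')
  | _, _ => Z0
  end.

Definition ipZ (a b : seq Z * seq Z) := dotZ a.1 b.2.

(* [has] is evaluated eagerly by the virtual machine; this one is not. *)
Fixpoint has_lazy (T : Type) (p : T -> bool) (s : seq T) : bool :=
  if s is x :: s' then if p x then true else has_lazy p s' else false.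

Lemma has_lazyP (T : eqType) (p : T -> bool) (s : seq T) :
  has_lazy p s -> exists2 x, x \in s & p x.
Proof.
elim: s => //= x s IHs; case: ifP => [px _|_ /IHs[y ys py]].
  by exists x; rewrite ?mem_head.
by exists y; rewrite // inE ys orbT.
Qed.

Definition at_ip (m : Z) a := filter (fun g => Z.eqb (ipZ g a) m).

(** The two roots found for an orthogonal pair have different uses: the one with products -1, -1
    tells orthogonal roots from adjacent ones by brackets, the one with products 1, 0 kills
    coordinates in degree 0 of extremal elements. *)
Definition pairsZ n :=
  let D := dataZ n in
  all (fun a =>
    let Gm := at_ip (-1) a D in let Gp := at_ip 1 a D in
    (Gp != [::]) &&
    all (fun b => has_lazy (fun g => Z.eqb (ipZ g b) (-1)) Gm &&
                  has_lazy (fun g => Z.eqb (ipZ g b) 0) Gp) (at_ip 0 a D)) D.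

Definition leZ (c d : seq Z) := all2 Z.leb c d.

(** The guard singles out the highest root. The last clause provides a root [e] of [Phi_1]
    orthogonal to [l] and adjacent to both [m] and [v]: the intermediate station on the way from [m]
    to [v] while [l] stays fixed. *)
Definition framesZ n :=
  let D := dataZ n in
  all (fun d => if all (fun a => leZ a.1 d.1) D then
    let D1 := at_ip 1 d D in
    all (fun l => let O := at_ip 0 l D1 in
      (O != [::]) && all (fun m => let O2 := at_ip 0 m O in
        (O2 != [::]) && all (fun v =>
          has_lazy (fun e => if Z.eqb (ipZ e m) 1 then Z.eqb (ipZ e v) 1 else false) O)
        O2) O) D1
    else true) D.

Definition normsZ n := all (fun g => Z.eqb (ipZ g g) 2) (dataZ n).

Lemma normsZ_E n : n \in [:: 6; 7; 8]%N -> normsZ n.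
Proof. by rewrite !inE => /or3P[] /eqP ->; vm_cast_no_check (erefl true). Qed.

Lemma closedZ_E n : n \in [:: 6; 7; 8]%N -> closedZ n.
Proof. by rewrite !inE => /or3P[] /eqP ->; vm_cast_no_check (erefl true). Qed.

Lemma pairsZ_E n : n \in [:: 6; 7; 8]%N -> pairsZ n.
Proof. by rewrite !inE => /or3P[] /eqP ->; vm_cast_no_check (erefl true). Qed.

Lemma framesZ_E n : n \in [:: 6; 7; 8]%N -> framesZ n.
Proof. by rewrite !inE => /or3P[] /eqP ->; vm_cast_no_check (erefl true). Qed.

End ZCoordinates.

(* Dividing by [half_norm] gives all roots the norm 2, so that [ip] takes the
   values of the Cartan integers. *)
Definition half_norm (R : realType) n (Pi : n.-tuple 'rV[R]_n) : R :=
  dot (nth 0 Pi 0%N) (nth 0 Pi 0%N) / 2.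

Definition ip (R : realType) n (Pi : n.-tuple 'rV[R]_n) (u v : 'rV[R]_n) : R :=
  dot u v / half_norm Pi.

(** * The normalised inner product and the embedding of integers *)

Section InnerProduct.
Variables (R : realType) (n : nat) (Pi : n.-tuple 'rV[R]_n).
Local Notation ip := (ip Pi).

Lemma ipC u v : ip u v = ip v u.
Proof. by rewrite /ip dotC. Qed.

Lemma ipDl u v w : ip (u + v) w = ip u w + ip v w.
Proof. by rewrite /ip dotDl mulrDl. Qed.

Lemma ipZl t u v : ip (t *: u) v = t * ip u v.
Proof. by rewrite /ip dotZl mulrA. Qed.

Lemma ipNl u v : ip (- u) v = - ip u v.
Proof. by rewrite -scaleN1r ipZl mulN1r. Qed.

Lemma ip0l v : ip 0 v = 0.
Proof. by rewrite /ip dot0l mul0r. Qed.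

Lemma ipDr u v w : ip u (v + w) = ip u v + ip u w.
Proof. by rewrite ipC ipDl !(ipC _ u). Qed.

Lemma ipZr t u v : ip u (t *: v) = t * ip u v.
Proof. by rewrite ipC ipZl ipC. Qed.

Lemma ipNr u v : ip u (- v) = - ip u v.
Proof. by rewrite ipC ipNl ipC. Qed.

Lemma ip_suml (I : Type) (r : seq I) (F : I -> 'rV[R]_n) v :
  ip (\sum_(i <- r) F i) v = \sum_(i <- r) ip (F i) v.
Proof. by rewrite /ip dot_suml mulr_suml. Qed.

Definition ip_lin := (ipDl, ipDr, ipNl, ipNr, ipZl, ipZr).

End InnerProduct.

Definition zr (R : realType) (z : Z) : R := (int_of_Z z)%:~R.

Section ZToReal.
Variable R : realType.
Local Notation zr := (@zr R).

Lemma zrD x y : zr (Z.add x y) = zr x + zr y.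
Proof. by rewrite /zr -intrD; congr (_%:~R); lia. Qed.

Lemma zrN x : zr (Z.opp x) = - zr x.
Proof. by rewrite /zr -mulrNz; congr (_%:~R); lia. Qed.

Lemma zrB x y : zr (Z.sub x y) = zr x - zr y.
Proof. by rewrite -zrN -zrD. Qed.

Lemma zrM x y : zr (Z.mul x y) = zr x * zr y.
Proof. by rewrite /zr -intrM; congr (_%:~R); lia. Qed.

Lemma zr_inj : injective zr.
Proof. by move=> x y /intr_inj; lia. Qed.

Lemma zr_le x y : zr x <= zr y -> Z.leb x y.
Proof. by rewrite ler_int; lia. Qed.

Lemma zr_nat (k : nat) : zr (Z.of_nat k) = k%:R.
Proof. by rewrite /zr pmulrn; congr (_%:~R); lia. Qed.

Lemma zr_int x : zr x \is a Num.int.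
Proof. exact: intr_int. Qed.

End ZToReal.

Section ChevalleyAlgebra.
Variables (R : realType) (n : nat).
Variables (Phi : {fset 'rV[R]_n}) (Pi : n.-tuple 'rV[R]_n).
Hypotheses (rootsP : root_system Phi) (simpleP : simple_system Phi Pi).
Hypothesis typeP : type_E Pi.
Local Notation ip := (ip Pi).
Local Notation B := (chev_index Phi).

(** * Identification of the root system with the enumerated list *)

Section Coordinates.
Local Notation zr := (@zr R).
Local Notation s := (half_norm Pi).

Lemma zero_notin : 0 \notin Phi.
Proof. by case: rootsP. Qed.

Lemma root_neq0 a : a \in Phi -> a != 0.
Proof. by move=> aP; apply: contraNneq zero_notin => <-. Qed.

Lemma E_cartan_sym i j : E_cartan R i j = E_cartan R j i.
Proof. by rewrite /E_cartan eq_sym orbC. Qed.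

Lemma dot_simple_pair (i j : 'I_n) :
  2 * dot (tnth Pi i) (tnth Pi j) =
  E_cartan R i j * dot (tnth Pi j) (tnth Pi j).
Proof.
case: typeP => _ <-; rewrite /coroot dotZr.
have := dot_gt0 (root_neq0 (let: And3 _ h _ := simpleP in h j)).
by move=> h; field; lra.
Qed.

(** The Cartan matrix is symmetric with entry -1 along an edge, so joined nodes have equal norms;
    the diagram is connected, and the equality is carried from node 0 to each of the others. *)
Lemma simple_norm (i : 'I_n) : dot (tnth Pi i) (tnth Pi i) = 2 * s.
Proof.
pose N k := dot (nth 0 Pi k) (nth 0 Pi k).
have edge k l : (k, l) \in E_edges -> (l < n)%N -> (k < n)%N -> N l = N k.
  move=> kl ln kn.
  have := dot_simple_pair (Ordinal kn) (Ordinal ln).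
  have := dot_simple_pair (Ordinal ln) (Ordinal kn).
  rewrite E_cartan_sym {1}dotC => ->; rewrite !(tnth_nth 0) /= -!/(N _).
  rewrite /E_cartan kl; case: eqP => [klE|_ /=]; last by lra.
  by rewrite klE.
have -> : dot (tnth Pi i) (tnth Pi i) = N i by rewrite (tnth_nth 0).
suff -> : N i = N 0%N by rewrite /half_norm -/(N 0%N); lra.
have [nE _] := typeP.
have n6 : (5 < n)%N by move: nE; rewrite !inE; lia.
have n9 : (n < 9)%N by move: nE; rewrite !inE; lia.
have N2 : N 2%N = N 0%N by apply: edge => //; lia.
have N3 : N 3%N = N 0%N by rewrite -N2; apply: edge => //; lia.
have N1 : N 1%N = N 0%N by rewrite -N3; symmetry; apply: edge => //; lia.
have N4 : N 4%N = N 0%N by rewrite -N3; apply: edge => //; lia.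
have N5 : N 5%N = N 0%N by rewrite -N4; apply: edge => //; lia.
have N6 : (6 < n)%N -> N 6%N = N 0%N by move=> h; rewrite -N5; apply: edge => //; lia.
have N7 : (7 < n)%N -> N 7%N = N 0%N.
  by move=> h; rewrite -N6; first apply: edge => //; lia.
case: i => i /= lin; have : (i < 8)%N by lia.
by move: lin; do 8?[case: i => [|i]] => //= h _; auto.
Qed.

Lemma half_norm_gt0 : 0 < s.
Proof.
have [nE _] := typeP.
have n0 : (0 < n)%N by move: nE; rewrite !inE; lia.
have := simple_norm (Ordinal n0).
have := dot_gt0 (root_neq0 (let: And3 _ h _ := simpleP in h (Ordinal n0))).
lra.
Qed.

Lemma ip_simple (i j : 'I_n) : ip (tnth Pi i) (tnth Pi j) = E_cartan R i j.
Proof.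
have := dot_simple_pair i j; rewrite simple_norm /ip.
have s0 := half_norm_gt0 => h; apply: (mulIf (negbT (gt_eqF s0))).
by rewrite divfK ?gt_eqF //; lra.
Qed.

Lemma zr_cartan i j : zr (cartanZ i j) = E_cartan R i j.
Proof.
by rewrite /cartanZ /E_cartan -[eqn i j]/(i == j); case: ifP => // _; case: ifP.
Qed.

Definition vec (c : seq Z) : 'rV[R]_n :=
  \sum_(i < n) zr (nth Z0 c i) *: tnth Pi i.

Lemma zr_foldr (f : nat -> Z) (r : seq nat) :
  zr (foldr (fun j t => Z.add (f j) t) Z0 r) = \sum_(j <- r) zr (f j).
Proof.
elim: r => [|j r IHr] /=; first by rewrite big_nil.
by rewrite big_cons zrD IHr.
Qed.

Lemma ip_vec_simple c (i : 'I_n) :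
  ip (vec c) (tnth Pi i) = zr (nth Z0 (weightsZ n c) i).
Proof.
rewrite /weightsZ (nth_map 0%N) ?size_iota // nth_iota // add0n.
rewrite (zr_foldr (fun j => Z.mul (nth Z0 c j) (cartanZ i j))).
have -> : iota 0 n = index_iota 0 n by rewrite /index_iota subn0.
rewrite big_mkord ip_suml.
apply: eq_bigr => j _; rewrite ipZl ip_simple zrM.
by rewrite zr_cartan E_cartan_sym.
Qed.

Lemma size_weightsZ c : size (weightsZ n c) = n.
Proof. by rewrite size_map size_iota. Qed.

Lemma zr_dotZ c w : size c = size w ->
  zr (dotZ c w) = \sum_(i < size c) zr (nth Z0 c i) * zr (nth Z0 w i).
Proof.
elim: c w => [|x c IHc] [|y w] //=; first by rewrite big_ord0.
by case=> cw; rewrite zrD zrM IHc // big_ord_recl.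
Qed.

Lemma ip_vec c d : size c = n ->
  ip (vec c) (vec d) = zr (dotZ c (weightsZ n d)).
Proof.
move=> sc; rewrite zr_dotZ ?size_weightsZ // sc {1}/vec ip_suml.
by apply: eq_bigr => i _; rewrite ipZl ipC ip_vec_simple.
Qed.

Lemma vec_opp c : vec (map Z.opp c) = - vec c.
Proof.
rewrite /vec -sumrN; apply: eq_bigr => i _.
case: (ltnP i (size c)) => ic; first by rewrite (nth_map Z0) // zrN scaleNr.
by rewrite !nth_default ?size_map // scale0r oppr0.
Qed.

Lemma simple_free : free Pi.
Proof. by case: simpleP => /basis_free. Qed.

Lemma coord_comb (F : 'I_n -> R) i :
  coord Pi i (\sum_(j < n) F j *: tnth Pi j) = F i.
Proof.
rewrite (eq_bigr (fun j : 'I_n => F j *: Pi`_j)) ?coord_sum_free ?simple_free //.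
by move=> j _; rewrite (tnth_nth 0).
Qed.

Lemma coord_simple i j : coord Pi i (tnth Pi j) = (j == i)%:R.
Proof. by rewrite (tnth_nth 0) coord_free ?simple_free. Qed.

Lemma vec_free c d (i : 'I_n) : vec c = vec d -> nth Z0 c i = nth Z0 d i.
Proof. by move=> /(congr1 (coord Pi i)); rewrite /vec !coord_comb => /zr_inj. Qed.

Lemma vec_set c (i : 'I_n) z :
  vec (set_nth Z0 c i z) = vec c + (zr z - zr (nth Z0 c i)) *: tnth Pi i.
Proof.
rewrite /vec (bigD1 i) //= [in RHS](bigD1 i) //= nth_set_nth /= eqxx.
rewrite (eq_bigr (fun j : 'I_n => zr (nth Z0 c j) *: tnth Pi j)).
  by rewrite [RHS]addrAC -scalerDl; congr (_ *: _ + _); ring.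
by move=> j ji; rewrite nth_set_nth /= -val_eqE in ji *; rewrite (negPf ji).
Qed.

Lemma vec_reflect c (i : 'I_n) :
  vec (reflectZ n i c) = vec c - ip (vec c) (tnth Pi i) *: tnth Pi i.
Proof.
rewrite /reflectZ vec_set zrB ip_vec_simple; congr (_ + _).
by rewrite -scaleNr addrAC subrr add0r.
Qed.

Lemma vec_simple (i : 'I_n) : vec (simpleZ n i) = tnth Pi i.
Proof.
rewrite /simpleZ vec_set nth_nseq ltn_ord /vec big1 ?add0r.
  by rewrite /zr /= subr0 scale1r.
by move=> j _; rewrite nth_nseq ltn_ord /zr scale0r.
Qed.

Lemma simple_root (i : 'I_n) : tnth Pi i \in Phi.
Proof. by case: simpleP. Qed.

Lemma coroot_simple v (i : 'I_n) : dot v (coroot (tnth Pi i)) = ip v (tnth Pi i).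
Proof.
rewrite /coroot dotZr simple_norm /ip; have := half_norm_gt0.
by move=> h; field; lra.
Qed.

Lemma reflect_root v (i : 'I_n) : v \in Phi ->
  v - ip v (tnth Pi i) *: tnth Pi i \in Phi.
Proof.
by case: rootsP => _ _ _ h _ vP; rewrite -coroot_simple; apply: h => //; apply: simple_root.
Qed.

Lemma opp_root a : a \in Phi -> - a \in Phi.
Proof.
case: rootsP => _ _ _ h _ aP; have := h a a aP aP.
rewrite /coroot dotZr divfK ?gt_eqF ?dot_gt0 ?root_neq0 //.
by rewrite scaler_nat mulr2n opprD addrA subrr add0r.
Qed.

Lemma mem_raise_layers k layer : {subset layer <= raise_layers n k.+1 layer}.
Proof. by move=> c cl; rewrite /= mem_cat cl. Qed.

Lemma raise_layers_root k layer :
  (forall c, c \in layer -> vec c \in Phi) ->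
  forall c, c \in raise_layers n k layer -> vec c \in Phi.
Proof.
elim: k layer => [|k IHk] layer //= lP c; rewrite mem_cat => /orP[/lP //|].
apply: IHk => d; rewrite mem_undup => /flattenP[l /mapP[e el ->]] /mapP[i].
rewrite mem_filter mem_iota /= add0n => /andP[_ lin] ->.
by rewrite (vec_reflect _ (Ordinal lin)); apply: reflect_root; apply: lP.
Qed.

Lemma posZ_root c : c \in posZ n -> vec c \in Phi.
Proof.
apply: raise_layers_root => d /mapP[i]; rewrite mem_iota /= add0n => lin ->.
by rewrite (vec_simple (Ordinal lin)) simple_root.
Qed.

Lemma rootsZ_root c : c \in rootsZ n -> vec c \in Phi.
Proof.
rewrite mem_cat => /orP[/posZ_root //|/mapP[d /posZ_root dP ->]].
by rewrite vec_opp opp_root.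
Qed.

Lemma nE : n \in [:: 6; 7; 8]%N.
Proof. by case: typeP. Qed.

Lemma size_rootsZ c : c \in rootsZ n -> size c = n.
Proof.
have /andP[_ /allP h] := closedZ_E nE.
rewrite mem_cat => /orP[/h|/mapP[d /h]] /andP[_ /eqP] //.
by move=> <- ->; rewrite size_map.
Qed.

Lemma reflect_rootsZ c (i : 'I_n) : c \in posZ n -> reflectZ n i c \in rootsZ n.
Proof.
have /andP[/allP h _] := closedZ_E nE.
by move=> /h/allP; apply; rewrite mem_iota /= add0n.
Qed.

(* Descent on the height: a positive root that is not simple is lowered by some
   simple reflection. *)
Lemma positive_root_vec (m : nat) (a : 'rV[R]_n) (c : 'I_n -> nat) :
  a \in Phi -> a = \sum_(i < n) (c i)%:R *: tnth Pi i ->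
  (\sum_i c i <= m)%N -> exists2 d, d \in posZ n & a = vec d.
Proof.
elim: m a c => [|m IHm] a c aP aE cm.
  have c0 i : c i = 0%N.
    by apply/eqP; rewrite -leqn0 (leq_trans _ cm) // (bigD1 i) //= leq_addr.
  have := root_neq0 aP; rewrite aE big1 ?eqxx // => i _.
  by rewrite c0 scale0r.
have s0 := half_norm_gt0.
(* The positive norm of [a] is the sum of the numbers [c i * dot (tnth Pi i) a], so one of them is
   positive. *)
have [i ip_gt0] : exists i, (0 < c i)%N && (0 < ip a (tnth Pi i)).
  apply/existsP; apply: contraPT (dot_gt0 (root_neq0 aP)).
  rewrite negb_exists => /forallP h.
  apply/negP; rewrite -leNgt {1}aE dot_suml; apply: sumr_le0 => i _.
  have := h i; rewrite dotZl negb_and -eqn0Ngt -leNgt => /orP[/eqP ->|].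
    by rewrite mul0r.
  rewrite /ip dotC ler_pdivrMr // mul0r dotC => h'.
  by apply: mulr_ge0_le0; rewrite ?ler0n.
have {ip_gt0}[ci ip_gt0] := andP ip_gt0.
pose k := ip a (tnth Pi i).
have [kz kE] : exists kz : nat, k = kz.+1%:R.
  have : k \is a Num.int.
    by rewrite /k -coroot_simple; case: rootsP => _ _ _ _; apply=> //; apply: simple_root.
  move=> /intrP[[z|z] zE]; first case: z zE => [|z] zE.
  - by move: ip_gt0; rewrite -/k zE ltxx.
  - by exists z; rewrite zE.
  - by move: ip_gt0; rewrite -/k zE ltNge; case/negP; rewrite lerz0.
pose b := a - k *: tnth Pi i.
have bP : b \in Phi by apply: reflect_root.
(* Once the lowered root [b] is listed, so is its reflection [a], up to the sign of the half it
   falls into. *)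
have ai d : d \in posZ n -> b = vec d -> exists2 d, d \in posZ n & a = vec d.
  move=> dpos bE.
  have aR : a = vec (reflectZ n i d).
    rewrite vec_reflect -bE /b ipDl ipNl ipZl -/k ip_simple /E_cartan eqxx.
    by rewrite -addrA -opprD -scalerDl (_ : k + (k - k * 2) = 0) ?scale0r ?subr0 //; ring.
  have := reflect_rootsZ i dpos; rewrite mem_cat => /orP[rd|]; first by exists (reflectZ n i d).
  move=> /mapP[e epos eE].
  have aN : a = - vec e by rewrite aR eE vec_opp.
  have /andP[_ /allP/(_ e epos)/andP[/allP e0 _]] := closedZ_E nE.
  (* The negative half is impossible: the coefficient [c i] is positive, while the entries of [e]
     are nonnegative. *)
  have : vec [seq Z.of_nat (c j) | j <- enum 'I_n] = vec (map Z.opp e).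
    rewrite vec_opp -aN aE /vec; apply: eq_bigr => j _.
    by rewrite (nth_map j) ?size_enum_ord // zr_nat nth_ord_enum.
  move=> /(vec_free i).
  rewrite (nth_map i) ?size_enum_ord // nth_ord_enum.
  case: (ltnP i (size e)) => ie; last first.
    by rewrite nth_default ?size_map // => h; exfalso; lia.
  rewrite (nth_map Z0) //; have /= h1 := e0 _ (mem_nth Z0 ie).
  move=> h2; exfalso; lia.
have [_ _ /(_ b bP)[[d dE]|[d dE]]] := simpleP.
  have eqd j : (d j)%:R = (c j)%:R - (if j == i then k else 0) :> R.
    rewrite -(coord_comb (fun j => (d j)%:R)) -dE /b linearB linearZ /=.
    rewrite aE coord_comb; congr (_ - _).
    by rewrite coord_simple eq_sym; case: eqP; rewrite ?mulr1 ?mulr0.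
  have [e epos eE] : exists2 e, e \in posZ n & b = vec e.
    apply: (IHm b d) => //; rewrite -ltnS (leq_trans _ cm) //.
    rewrite (bigD1 i) //= [X in (_ < X)%N](bigD1 i) //=.
    have -> : (\sum_(j < n | j != i) d j = \sum_(j < n | j != i) c j)%N.
      apply: eq_bigr => j ji; have := eqd j; rewrite (negPf ji) subr0 => /eqP.
      by rewrite eqr_nat => /eqP.
    rewrite ltn_add2r; have := eqd i; rewrite eqxx kE => h.
    by rewrite -(ltr_nat R) h -natr1; have := ler0n R kz; lra.
  exact: ai epos eE.
(* the lowered root is negative, so that a is a multiple of a simple root *)
have cd j : j != i -> c j = 0%N.
  move=> ji.
  have : (d j)%:R = - (c j)%:R :> R.
    rewrite -(coord_comb (fun j => (d j)%:R)) -dE /b linearN linearB linearZ /= aE coord_comb.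
    by rewrite coord_simple eq_sym (negPf ji) mulr0 subr0.
  by have := ler0n R (d j); have := ler0n R (c j) => h1 h2 h3; apply/eqP;
     rewrite -(eqr_nat R); apply/eqP; clear -h1 h2 h3; lra.
have aci : a = (c i)%:R *: tnth Pi i.
  by rewrite aE (bigD1 i) //= big1 ?addr0 // => j /cd ->; rewrite scale0r.
exists (simpleZ n i); last first.
  rewrite vec_simple aci; case: rootsP => _ _ red _ _.
  have [|->|h] := red _ (c i)%:R (simple_root i); rewrite ?scale1r -?aci //.
  by exfalso; have := ler0n R (c i); rewrite h; lra.
by apply: mem_raise_layers; rewrite map_f // mem_iota /= add0n.
Qed.

(** Soundness and completeness of the list; through it the evaluated checks become statements about
    all of [Phi]. *)
Lemma mem_rootP a : reflect (exists2 c, c \in rootsZ n & a = vec c) (a \in Phi).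
Proof.
apply: (iffP idP) => [aP|[c cP ->]]; last exact: rootsZ_root.
have [_ _ /(_ a aP)[[c aE]|[c aE]]] := simpleP.
  have [d dP ->] := positive_root_vec aP aE (leqnn _).
  by exists d => //; rewrite mem_cat dP.
have [d dP dE] := positive_root_vec (opp_root aP) aE (leqnn _).
exists (map Z.opp d); first by rewrite mem_cat map_f ?orbT.
by rewrite vec_opp -dE opprK.
Qed.

Lemma data_root a : a \in Phi ->
  exists2 g, g \in dataZ n & a = vec g.1 /\ size g.1 = n.
Proof.
move=> /mem_rootP[c cP ->]; exists (c, weightsZ n c); first exact: map_f.
by rewrite (size_rootsZ cP).
Qed.

Lemma ip_data g h : g \in dataZ n -> h \in dataZ n ->
  ip (vec g.1) (vec h.1) = zr (ipZ g h).
Proof.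
by move=> /mapP[c cP ->] /mapP[d dP ->] /=; rewrite ip_vec // size_rootsZ.
Qed.

Lemma vec_data g : g \in dataZ n -> vec g.1 \in Phi.
Proof. by move=> /mapP[c cP ->]; apply: rootsZ_root. Qed.

Lemma mem_at_ip m g h (r : seq (seq Z * seq Z)) : {subset r <= dataZ n} ->
  h \in dataZ n ->
  (g \in at_ip m h r) = (g \in r) && (ip (vec g.1) (vec h.1) == zr m).
Proof.
move=> rP hP; rewrite mem_filter andbC; case gr: (g \in r) => //=.
rewrite ip_data ?(rP _ gr) //.
by apply/idP/idP => [/Z.eqb_eq ->|/eqP/zr_inj ->]; rewrite ?eqxx ?Z.eqb_refl.
Qed.

Lemma at_ip_sub m h (r r' : seq (seq Z * seq Z)) :
  {subset r <= r'} -> {subset at_ip m h r <= r'}.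
Proof. by move=> rr g; rewrite mem_filter => /andP[_ /rr]. Qed.

Lemma ip_root a : a \in Phi -> ip a a = 2.
Proof.
move=> /data_root[g gD [-> _]]; rewrite ip_data //.
by have /allP/(_ g gD)/Z.eqb_eq -> := normsZ_E nE.
Qed.

Lemma dot_coroot a v : a \in Phi -> dot v (coroot a) = ip v a.
Proof.
move=> aP; have := ip_root aP; have := dot_gt0 (root_neq0 aP).
have := half_norm_gt0; rewrite /coroot dotZr /ip => h1 h2 h3.
have -> : dot a a = 2 * s by rewrite -h3 divfK //; lra.
by field; lra.
Qed.

Lemma ip_int a b : a \in Phi -> b \in Phi -> ip a b \is a Num.int.
Proof.
by move=> aP bP; rewrite -dot_coroot //; case: rootsP => _ _ _ _; apply.
Qed.

Lemma ip_gt0 v : v != 0 -> 0 < ip v v.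
Proof. by move=> v0; rewrite divr_gt0 ?dot_gt0 ?half_norm_gt0. Qed.

Lemma ip_ge0 v : 0 <= ip v v.
Proof. by have [->|/ip_gt0/ltW //] := eqVneq v 0; rewrite ip0l. Qed.

Lemma ip_eq0 v : ip v v = 0 -> v = 0.
Proof. by have [//|/ip_gt0 h h0] := eqVneq v 0; rewrite h0 ltxx in h. Qed.

Variant ip_spec (a b : 'rV[R]_n) : R -> Prop :=
  | Ip2 of a = b : ip_spec a b 2
  | Ip1 : ip_spec a b 1
  | Ip0 : ip_spec a b 0
  | IpN1 : ip_spec a b (-1)
  | IpN2 of b = - a : ip_spec a b (-2).

(** The norms [4 + 2 * ip a b] and [4 - 2 * ip a b] of the sum and the difference are nonnegative,
    which bounds the integer [ip a b] by 2 in absolute value, and they vanish only when [a = - b] or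
    [a = b]. *)
Lemma ipP a b : a \in Phi -> b \in Phi -> ip_spec a b (ip a b).
Proof.
move=> aP bP.
have := ip_ge0 (a + b); have := ip_ge0 (a - b).
have := @ip_eq0 (a + b); have := @ip_eq0 (a - b).
rewrite !ip_lin !ip_root // (ipC Pi b a) => e1 e2 g1 g2.
have zE : [|| ip a b == 2, ip a b == 1, ip a b == 0, ip a b == -1 | ip a b == -2].
  have /intrP[z zE] := ip_int aP bP; rewrite zE in g1 g2 *.
  have z1 : (z <= 2)%R by rewrite -(ler_int R); lra.
  have z2 : (-2 <= z)%R by rewrite -(ler_int R); lra.
  have : [|| z == 2, z == 1, z == 0, z == -1 | z == -2] by lia.
  by rewrite -!(eqr_int R).
case/or4P: zE e1 e2 => [|||/orP[]] /eqP -> e1 e2.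
- by apply: Ip2; apply/eqP; rewrite -subr_eq0; apply/eqP; apply: e1; lra.
- exact: Ip1.
- exact: Ip0.
- exact: IpN1.
- by apply: IpN2; apply/eqP; rewrite -addr_eq0 addrC; apply/eqP; apply: e2; lra.
Qed.

Lemma root_add a b : a \in Phi -> b \in Phi -> ip a b = -1 -> a + b \in Phi.
Proof.
move=> aP bP ab; have [_ _ _ h _] := rootsP.
by have := h a b aP bP; rewrite dot_coroot // ipC ab scaleN1r opprK addrC.
Qed.

Lemma root_sub a b : a \in Phi -> b \in Phi -> ip a b = 1 -> a - b \in Phi.
Proof. by move=> aP bP ab; apply: root_add; rewrite ?opp_root // ipNr ab. Qed.

Lemma root_add_ip a b : a \in Phi -> b \in Phi -> a + b \in Phi -> ip a b = -1.
Proof. by move=> aP bP /ip_root; rewrite !ip_lin !ip_root // (ipC Pi b a); lra. Qed.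

Lemma ex_ip1 a : a \in Phi -> exists2 g, g \in Phi & ip g a = 1.
Proof.
move=> /data_root[d dD [-> _]].
have /allP/(_ d dD)/andP[] := pairsZ_E nE.
case E: (at_ip 1 d (dataZ n)) => [//|g l] _ _.
have : g \in at_ip 1 d (dataZ n) by rewrite E mem_head.
rewrite mem_at_ip // => /andP[gD /eqP gd].
by exists (vec g.1) => //; apply: vec_data.
Qed.

Lemma ex_orth_pair a b : a \in Phi -> b \in Phi -> ip a b = 0 ->
  (exists2 g, g \in Phi & ip g a = -1 /\ ip g b = -1) /\
  (exists2 g, g \in Phi & ip g a = 1 /\ ip g b = 0).
Proof.
move=> /data_root[d dD [-> _]] /data_root[e eD [-> _]] de.
have /allP/(_ d dD)/andP[_ /allP/(_ e)] := pairsZ_E nE.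
rewrite mem_at_ip // eD ipC de eqxx => /(_ isT)/andP[].
move=> /has_lazyP[g]; rewrite mem_at_ip // => /andP[gD /eqP gd] /Z.eqb_eq ge.
move=> /has_lazyP[h]; rewrite mem_at_ip // => /andP[hD /eqP hd] /Z.eqb_eq he.
split; first by exists (vec g.1); rewrite ?vec_data // gd ip_data // ge.
by exists (vec h.1); rewrite ?vec_data // hd ip_data // he.
Qed.

Section MaximalRoot.
Variable d : 'rV[R]_n.
Hypotheses (dP : d \in Phi) (dmax : forall a, a \in Phi -> nonneg_comb Pi (d - a)).

Lemma ex_orth_frame l : l \in Phi -> ip l d = 1 ->
  (exists2 m, m \in Phi & ip m d = 1 /\ ip m l = 0) /\
  forall m, m \in Phi -> ip m d = 1 -> ip m l = 0 ->
  (exists2 v, v \in Phi & [/\ ip v d = 1, ip v l = 0 & ip v m = 0]) /\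
  forall v, v \in Phi -> ip v d = 1 -> ip v l = 0 -> ip v m = 0 ->
  exists2 e, e \in Phi & [/\ ip e d = 1, ip e l = 0, ip e m = 1 & ip e v = 1].
Proof.
have [dd ddD [dE sd]] := data_root dP; move=> /data_root[l' l'D [-> _]].
rewrite dE => ld.
have /allP/(_ dd ddD) := framesZ_E nE; rewrite ifT; last first.
  (* Maximality enters here: [d - a] has nonnegative coordinates for every root [a], so [d] passes
     the guard of [framesZ]. *)
  apply/allP => a aD; have [c cE] := dmax (vec_data aD).
  have sa : size a.1 = n by case/mapP: aD => x /size_rootsZ xs ->.
  rewrite /leZ all2E sa sd eqxx /=; apply/(all_nthP (Z0, Z0)) => i.
  rewrite size_zip sa sd minnn => lin; rewrite nth_zip ?sa //=; apply: (@zr_le R).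
  move: cE => /(congr1 (coord Pi (Ordinal lin))).
  rewrite dE linearB /= /vec !coord_comb /= => h; rewrite -subr_ge0 h.
  exact: ler0n.
set D1 := at_ip 1 dd _.
have D1P : {subset D1 <= dataZ n} by apply: at_ip_sub.
move=> /allP/(_ l'); rewrite mem_at_ip // l'D ld eqxx => /(_ isT)/andP[].
set O := at_ip 0 l' D1.
have OP : {subset O <= dataZ n} by apply: at_ip_sub.
have memO g : (g \in O) = [&& g \in dataZ n, ip (vec g.1) (vec dd.1) == 1
                                & ip (vec g.1) (vec l'.1) == 0].
  by rewrite mem_at_ip // mem_at_ip // -andbA.
have ex0 r : r != [::] -> exists g : seq Z * seq Z, g \in r.
  by case: r => // g r _; exists g; rewrite mem_head.
move=> /ex0[m0]; rewrite memO => /and3P[m0D /eqP m0d /eqP m0l] /allP hO.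
split; first by exists (vec m0.1) => //; apply: vec_data.
move=> m /data_root[m' m'D [-> _]] md ml.
have m'O : m' \in O by rewrite memO m'D md ml !eqxx.
have := hO m' m'O => /andP[/ex0[v0]]; rewrite mem_at_ip // memO.
move=> /andP[/and3P[v0D /eqP v0d /eqP v0l] /eqP v0m] /allP hO2.
split; first by exists (vec v0.1) => //; apply: vec_data.
move=> v /data_root[v' v'D [-> _]] vd vl vm.
have /hO2/has_lazyP[e] : v' \in at_ip 0 m' O.
  by rewrite mem_at_ip // memO v'D vd vl vm !eqxx.
rewrite memO => /and3P[eD /eqP ed /eqP el].
case: ifP => // /Z.eqb_eq em /Z.eqb_eq ev.
by exists (vec e.1); rewrite ?vec_data // ed el !ip_data // em ev.
Qed.

End MaximalRoot.

End Coordinates.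

(** * The Chevalley algebra *)

Section CorootCoordinates.
Local Notation s := (half_norm Pi).

Lemma cartan_intE a i : a \in Phi ->
  (cartan_int a (tnth Pi i))%:~R = ip a (tnth Pi i).
Proof.
move=> aP; have iP := simple_root i.
rewrite /cartan_int dot_coroot //.
by rewrite Num.Theory.floorK // ip_int.
Qed.

Lemma coroot_scale a : a \in Phi -> coroot a = s^-1 *: a.
Proof.
move=> aP; rewrite /coroot; congr (_ *: _).
have := ip_root aP; rewrite /ip => /(canRL (divfK _)) ->.
  by have := half_norm_gt0 => h; field; lra.
by have := half_norm_gt0 => h; lra.
Qed.

(** All roots have the same length, so passing to coroots is one common scaling and leaves
    coordinates unchanged. They are integers by the enumeration, hence the floor loses nothing. *)
Lemma coroot_coefE a i : a \in Phi -> (coroot_coef Pi a i)%:~R = coord Pi i a.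
Proof.
move=> aP; rewrite /coroot_coef.
have s0 : s != 0 by rewrite gt_eqF ?half_norm_gt0.
have cE j : (map_tuple (@coroot R n) Pi)`_j = s^-1 *: Pi`_j.
  case: (ltnP j n) => jn; last first.
    by rewrite !nth_default ?size_tuple ?scaler0.
  rewrite (nth_map 0) ?size_tuple // coroot_scale //.
  by rewrite -[Pi`_j](tnth_nth 0 Pi (Ordinal jn)) simple_root.
have bP : basis_of fullv Pi by case: simpleP.
have frP : free (map_tuple (@coroot R n) Pi).
  apply/freeP => c c0 j; move/freeP: (basis_free bP) => fP.
  apply: fP; transitivity (s *: \sum_(k < n) c k *: (map_tuple (@coroot R n) Pi)`_k).
    rewrite scaler_sumr; apply: eq_bigr => k _.
    by rewrite cE !scalerA; congr (_ *: _); field.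
  by rewrite c0 scaler0.
have -> : coord (map_tuple (@coroot R n) Pi) i (coroot a) = coord Pi i a.
  have aE := coord_basis bP (memvf a).
  rewrite coroot_scale // {1}aE scaler_sumr.
  rewrite (eq_bigr (fun j : 'I_n => coord Pi j a *: (map_tuple (@coroot R n) Pi)`_j)).
    by rewrite coord_sum_free.
  by move=> j _; rewrite cE !scalerA mulrC.
apply: Num.Theory.floorK.
have [c _ ->] := elimT (mem_rootP a) aP.
by rewrite /vec coord_comb zr_int.
Qed.

Lemma coroot_coefN a i : a \in Phi -> coroot_coef Pi (- a) i = - coroot_coef Pi a i.
Proof.
move=> aP; apply: (@intr_inj R); rewrite mulrNz !coroot_coefE ?linearN //.
exact: opp_root.
Qed.

(** The left-hand sum is the eigenvalue of [h_a] on [e_b], computed from the simple coroots. *)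
Lemma sum_coroot_coef a b : a \in Phi -> b \in Phi ->
  (\sum_i coroot_coef Pi a i * cartan_int b (tnth Pi i))%:~R = ip b a.
Proof.
move=> aP bP; rewrite rmorph_sum /=.
have bs : basis_of fullv Pi by case: simpleP.
rewrite [in RHS](coord_basis bs (memvf a)) ipC ip_suml; apply: eq_bigr => i _.
by rewrite intrM coroot_coefE // cartan_intE // ipZl ipC (tnth_nth 0).
Qed.

End CorootCoordinates.

Variable (N : 'rV[R]_n -> 'rV[R]_n -> int).
Variable (K : finFieldType).
Hypothesis (chevP : chevalley_constants Phi Pi N).
Hypothesis (cardK : #|K| = 2%N).
Local Notation brZ := (@bracket R n Phi Pi N int).
Local Notation eZ := (root_vec Phi int).

Lemma ffun_addE (T : finType) (A : nmodType) (x y : {ffun T -> A}) b :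
  (x + y) b = x b + y b.
Proof. by rewrite ffunE. Qed.

Lemma ffun_oppE (T : finType) (A : zmodType) (x : {ffun T -> A}) b :
  (- x) b = - x b.
Proof. by rewrite ffunE. Qed.

(** * The bracket in coordinates *)

Section BracketOverRing.
Variable (A : comNzRingType).
Local Notation br := (@bracket R n Phi Pi N A).
Implicit Types (x y z : {ffun B -> A}).

Lemma brDl x y z : br (x + y) z = br x z + br y z.
Proof.
apply/ffunP => d; rewrite !ffunE -big_split; apply: eq_bigr => b _.
by rewrite -big_split; apply: eq_bigr => c _; rewrite /= !ffunE !mulrDl.
Qed.

Lemma brDr x y z : br x (y + z) = br x y + br x z.
Proof.
apply/ffunP => d; rewrite !ffunE -big_split; apply: eq_bigr => b _.
by rewrite -big_split; apply: eq_bigr => c _; rewrite /= !ffunE mulrDr mulrDl.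
Qed.

Definition cscale (t : A) x : {ffun B -> A} := [ffun b => t * x b].

Lemma cscaleE t x b : cscale t x b = t * x b.
Proof. by rewrite ffunE. Qed.

Lemma cscale0 x : cscale 0 x = 0.
Proof. by apply/ffunP => b; rewrite !ffunE mul0r. Qed.

Lemma cscaler0 t : cscale t 0 = 0.
Proof. by apply/ffunP => b; rewrite !ffunE mulr0. Qed.

Lemma cscale1 x : cscale 1 x = x.
Proof. by apply/ffunP => b; rewrite !ffunE mul1r. Qed.

Lemma brZl t x y : br (cscale t x) y = cscale t (br x y).
Proof.
apply/ffunP => d; rewrite !ffunE mulr_sumr; apply: eq_bigr => b _.
by rewrite mulr_sumr; apply: eq_bigr => c _; rewrite !ffunE /= !mulrA.
Qed.

Lemma brZr t x y : br x (cscale t y) = cscale t (br x y).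
Proof.
apply/ffunP => d; rewrite !ffunE mulr_sumr; apply: eq_bigr => b _.
rewrite mulr_sumr; apply: eq_bigr => c _; rewrite !ffunE /=; ring.
Qed.

Lemma br0l y : br 0 y = 0.
Proof. by have := brZl 0 0 y; rewrite !cscale0. Qed.

Lemma br0r y : br y 0 = 0.
Proof. by have := brZr 0 y 0; rewrite !cscale0. Qed.

Lemma brNr x y : br x (- y) = - br x y.
Proof. by apply/eqP; rewrite -addr_eq0 -brDr addNr br0r. Qed.

Lemma root_coordE y (a : Phi) : root_coord y (val a) = y (inl a).
Proof. by rewrite /root_coord valK. Qed.

Lemma root_coord_notin y v : v \notin Phi -> root_coord y v = 0.
Proof. by move=> vP; rewrite /root_coord insubN. Qed.

Lemma root_coord0 v : root_coord (0 : {ffun B -> A}) v = 0.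
Proof. by rewrite /root_coord; case: insub => // a; rewrite ffunE. Qed.

Lemma root_coordD y z v : root_coord (y + z) v = root_coord y v + root_coord z v.
Proof. by rewrite /root_coord; case: insub => [a|]; rewrite ?ffunE ?addr0. Qed.

Lemma root_coordZ t y v : root_coord (cscale t y) v = t * root_coord y v.
Proof. by rewrite /root_coord; case: insub => [a|]; rewrite ?ffunE ?mulr0. Qed.

Lemma root_coord_vec v w : v \in Phi ->
  root_coord (root_vec Phi A v) w = (w == v)%:R.
Proof.
move=> vP; rewrite /root_coord; case: insubP => [a _ <-|wP]; first by rewrite ffunE.
by rewrite (negPf (contraNneq _ wP)) // => ->.
Qed.

Lemma root_vec_notin v : v \notin Phi -> root_vec Phi A v = 0.
Proof.
move=> vP; apply/ffunP => -[a|i]; rewrite !ffunE //.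
by rewrite (negPf (contraNneq _ vP)) // => <-; apply: valP.
Qed.

Lemma root_vecE (a : Phi) : root_vec Phi A (val a) = basis_vec A (inl a).
Proof. by apply/ffunP => -[b|i]; rewrite !ffunE. Qed.

Lemma sum_basis (F : B -> A) (b : B) : \sum_c (c == b)%:R * F c = F b.
Proof.
rewrite (bigD1 b) //= eqxx mul1r big1 ?addr0 // => c /negPf ->.
by rewrite mul0r.
Qed.

Lemma br_basis b y d :
  br (basis_vec A b) y d = \sum_c y c * (basis_bracket Pi N b c d)%:~R.
Proof.
rewrite ffunE -[RHS](sum_basis (fun b => \sum_c y c * (basis_bracket Pi N b c d)%:~R)).
apply: eq_bigr => c _; rewrite mulr_sumr; apply: eq_bigr => e _.
by rewrite ffunE mulrA.
Qed.

Definition cartan_eval a y : A := \sum_i y (inr i) * (cartan_int a (tnth Pi i))%:~R.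

Lemma basis_bracket_rr (a b c : Phi) :
  basis_bracket Pi N (inl a) (inl b) (inl c) =
  (val a + val b != 0)%:R * ((val c == val a + val b)%:R * N (val a) (val b)).
Proof.
by rewrite /basis_bracket; case: eqP => _; rewrite ?ffunMzE !ffunE ?mul0r // mul1r -mulrzr intz.
Qed.

Lemma basis_bracket_rc (a b : Phi) (i : 'I_n) :
  basis_bracket Pi N (inl a) (inl b) (inr i) =
  (val a + val b == 0)%:R * coroot_coef Pi (val a) i.
Proof.
by rewrite /basis_bracket; case: eqP => _; rewrite ?ffunMzE !ffunE ?mul1r // mul0rz mul0r.
Qed.

Lemma basis_bracket_cr (a c : Phi) (i : 'I_n) :
  basis_bracket Pi N (inl a) (inr i) (inl c) =
  - ((val c == val a)%:R * cartan_int (val a) (tnth Pi i)).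
Proof. by rewrite /basis_bracket ffunMzE !ffunE -mulrzr intz mulNr. Qed.

Lemma basis_bracket_cc (a : Phi) (i j : 'I_n) :
  basis_bracket Pi N (inl a) (inr i) (inr j) = 0.
Proof. by rewrite /basis_bracket ffunMzE !ffunE oppr0 mul0rz. Qed.

(** The formula through which [ad e_a] is computed from here on. As [root_coord] is 0 off the roots,
    it needs no case distinction on whether [val c - a] is a root. *)
Lemma br_root (a : 'rV[R]_n) y : a \in Phi ->
  br (root_vec Phi A a) y = [ffun d => match d with
    | inl c => root_coord y (val c - a) * (N a (val c - a))%:~R
               - (val c == a)%:R * cartan_eval a y
    | inr i => root_coord y (- a) * (coroot_coef Pi a i)%:~R
    end].
Proof.
move=> aP; pose a' : Phi := [` aP]%fset.
rewrite -[a]/(val a') root_vecE; apply/ffunP => d; rewrite br_basis ffunE.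
rewrite big_sumType /=; case: d => [c|i].
  congr (_ + _).
    rewrite (eq_bigr (fun b : Phi => y (inl b) *
       ((val b == val c - val a')%:R * (N (val a') (val c - val a'))%:~R))); last first.
      move=> b _; rewrite basis_bracket_rr.
      rewrite [val b == _]eq_sym subr_eq [val b + _]addrC.
      case: (val c =P _) => [cE|_]; last by rewrite !(mul0r, mulr0, mulr0z).
      have -> : val c - val a' = val b by rewrite cE addrAC subrr add0r.
      rewrite -cE; case: eqP => [c0|_]; last by rewrite !mul1r.
      by move: zero_notin; rewrite -c0 (valP c).
    rewrite /root_coord; case: insubP => [b _ bE|cP].
      rewrite (bigD1 b) //= bE eqxx mul1r big1 ?addr0 // => e eb.
      by rewrite -bE (inj_eq val_inj) (negPf eb) mul0r mulr0.
    rewrite mul0r big1 // => b _; case: eqP => [bE|_]; last by rewrite mul0r mulr0.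
    by rewrite -bE (valP b) in cP.
  rewrite /cartan_eval mulr_sumr -sumrN; apply: eq_bigr => i _.
  rewrite basis_bracket_cr mulrNz intrM; case: eqP => _; last first.
    by rewrite !mul0r oppr0 mulr0.
  by rewrite !mul1r mulrN.
rewrite [X in _ + X]big1 => [|j _]; last by rewrite basis_bracket_cc mulr0.
rewrite addr0 (eq_bigr (fun b : Phi => y (inl b) *
       ((val b == - val a')%:R * (coroot_coef Pi (val a') i)%:~R))); last first.
  move=> b _; rewrite basis_bracket_rc addrC addr_eq0 intrM.
  by case: eqP => _; rewrite ?mul0r.
rewrite /root_coord; case: insubP => [b _ bE|cP].
  rewrite (bigD1 b) //= bE eqxx mul1r big1 ?addr0 // => e eb.
  by rewrite -bE (inj_eq val_inj) (negPf eb) mul0r mulr0.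
rewrite mul0r big1 // => b _; case: eqP => [bE|_]; last by rewrite mul0r mulr0.
by rewrite -bE (valP b) in cP.
Qed.

End BracketOverRing.

(** * Identities over the integers *)

Section IntegralForm.
Implicit Types (x y z : {ffun B -> int}).

Lemma ip_notin v t : ip v v = t -> t != 2 -> v \notin Phi.
Proof. by move=> vt t2; apply: contra t2 => /ip_root; rewrite vt => ->. Qed.

(** If [a + b] is a root, then [ip a b = -1] and [b - a] has norm 6; so the string through [b]
    starts at [b], and [p = 0]. *)
Lemma chev_sign a b : a \in Phi -> b \in Phi -> a + b \in Phi ->
  N a b = 1 \/ N a b = -1.
Proof.
move=> aP bP abP; have [_ _ h] := chevP; apply: (h a b 0%N) => //.
  by move=> k; rewrite leqn0 => /eqP ->; rewrite scale0r subr0.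
rewrite scale1r; apply: (@ip_notin _ 6); last by rewrite gt_eqF //; lra.
by have := root_add_ip aP bP abP; rewrite !ip_lin !ip_root // (ipC Pi b a); lra.
Qed.

Lemma brZC x y : brZ x y = - brZ y x.
Proof.
have [h _ _] := chevP; have := h (x + y).
by rewrite !brDl !brDr !h add0r addr0 => /eqP; rewrite addr_eq0 => /eqP.
Qed.

Lemma ad_derivation a x y : brZ a (brZ x y) = brZ (brZ a x) y + brZ x (brZ a y).
Proof.
have [_ h _] := chevP; have /eqP := h a x y.
rewrite -addrA addr_eq0 => /eqP ->; rewrite opprD addrC -brZC; congr (_ + _).
by rewrite (brZC a y) brNr.
Qed.

(** Adding [a] twice leads from a root to a root only from [-a] to [a], by way of [h_a]; there
    [[e_a, [e_a, e_(-a)]] = [e_a, h_a] = -2 e_a]. *)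
Lemma ad_root_sqr a x : a \in Phi ->
  brZ (eZ a) (brZ (eZ a) x) = cscale (-2 * root_coord x (- a)) (eZ a).
Proof.
move=> aP; have aa := ip_root aP.
have aN := opp_root aP.
have cN : root_coord (brZ (eZ a) x) (- a) = 0.
  rewrite -[- a]/(val [` aN]%fset) root_coordE br_root // ffunE /=.
  rewrite root_coord_notin ?mul0r; last first.
    by apply: (@ip_notin _ 8); [rewrite !ip_lin aa; lra|rewrite gt_eqF //; lra].
  rewrite (negPf (_ : - a != a)) ?mul0r ?subr0 //.
  by apply/eqP => /(congr1 (ip a)); rewrite !ip_lin aa; lra.
apply/ffunP => d; rewrite (br_root _ aP) !ffunE; case: d => [c|i]; last first.
  by rewrite cN mul0r mulr0.
rewrite [root_coord (brZ _ _) _]/root_coord; case: insubP => [b bP bE|_]; last first.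
  rewrite mul0r add0r; case: eqP => [cE|_]; last by rewrite mul0r mulr0 oppr0.
  rewrite mul1r mulr1 mulNr; congr (- _).
  rewrite /cartan_eval (eq_bigr (fun i => root_coord x (- a) *
     (coroot_coef Pi a i * cartan_int a (tnth Pi i)))); last first.
    by move=> i _; rewrite (br_root _ aP) ffunE !intz mulrA.
  rewrite -mulr_sumr mulrC; congr (_ * _).
  by apply: (@intr_inj R); rewrite sum_coroot_coef.
have cab : a + val b = val c by rewrite bE addrC subrK.
have iab : ip a (val b) = -1 by apply: root_add_ip; rewrite ?cab // fsvalP.
have bb := ip_root (fsvalP b).
rewrite br_root // ffunE /= root_coord_notin ?mul0r; last first.
  apply: (@ip_notin _ 6); last by rewrite gt_eqF //; lra.
  by rewrite !ip_lin aa bb (ipC Pi (val b) a) iab; lra.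
rewrite (negPf (_ : val b != a)) ?mul0r ?subr0 ?mul0r; last first.
  by apply/eqP => ba; move: iab; rewrite ba aa; lra.
rewrite (negPf (_ : val c != a)) ?mul0r ?subr0 ?mulr0 //.
by apply/eqP => /(congr1 (ip a)); rewrite -cab !ip_lin aa iab; lra.
Qed.

Lemma ad_root_cube a x : a \in Phi ->
  brZ (eZ a) (brZ (eZ a) (brZ (eZ a) x)) = 0.
Proof.
by move=> aP; rewrite (ad_root_sqr x aP) brZr; have [-> _ _] := chevP;
   apply/ffunP => d; rewrite !ffunE mulr0.
Qed.

(* Half of the Leibniz formula for [(ad e_a)^2], where [(ad e_a)^2 = -2 P] for
   the rank one map [P] onto the line of [e_a]. *)
Lemma ad_root_leibniz a x y : a \in Phi ->
  cscale (root_coord (brZ x y) (- a)) (eZ a) =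
  cscale (root_coord x (- a)) (brZ (eZ a) y)
  - brZ (brZ (eZ a) x) (brZ (eZ a) y)
  + cscale (root_coord y (- a)) (brZ x (eZ a)).
Proof.
move=> aP; have := ad_root_sqr (brZ x y) aP.
rewrite (ad_derivation (eZ a) x y) brDr (ad_derivation _ (brZ (eZ a) x)).
rewrite (ad_derivation _ x (brZ (eZ a) y)) (ad_root_sqr x) // (ad_root_sqr y) //.
rewrite brZl brZr.
move=> /ffunP h; apply/ffunP => d; move/(_ d): h.
rewrite !(ffun_addE, ffun_oppE, cscaleE) => h.
(* Cancelling -2 is what forces the detour through the integers. *)
by apply: (mulfI (isT : (-2 : int) != 0)); rewrite mulrA -h; ring.
Qed.

End IntegralForm.

(** * Reduction modulo 2 *)

Lemma K01 (t : K) : t = 0 \/ t = 1.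
Proof.
suff: (t == 0) || (t == 1) by case/orP => /eqP; [left | right].
apply: contraPT (leqnn #|K|); rewrite negb_or => /andP[t0 t1].
apply/negP; rewrite -ltnNge {1}cardK.
have : uniq [:: 0; 1; t] by rewrite /= !inE eq_sym oner_eq0 negb_or !(eq_sym _ t) t0 t1.
by move=> /card_uniqP h; have := max_card (mem [:: 0; 1; t]); rewrite h.
Qed.

Lemma K_addrr (t : K) : t + t = 0.
Proof.
have h : 1 + 1 = 0 :> K.
  by have [//|/eqP] := K01 (1 + 1); rewrite -subr_eq0 addrK oner_eq0.
by rewrite -[t]mulr1 -mulrDr h mulr0.
Qed.

Lemma K_oppr (t : K) : - t = t.
Proof. by apply/eqP; rewrite eq_sym -addr_eq0 K_addrr. Qed.

Lemma ffun_addrr (T : finType) (y : {ffun T -> K}) : y + y = 0.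
Proof. by apply/ffunP => b; rewrite !ffunE K_addrr. Qed.

Lemma ffun_addrK (T : finType) (y z : {ffun T -> K}) : y + z + z = y.
Proof. by rewrite -addrA ffun_addrr addr0. Qed.

Local Notation V := (chev_alg Phi K).
Local Notation br := (@bracket R n Phi Pi N K).
Local Notation e := (root_vec Phi K).
Local Notation co := root_coord.
Implicit Types (x y z : V).

Definition red (x : {ffun B -> int}) : V := [ffun b => (x b)%:~R].
(** A mere set-theoretic section of [red], not additive. It presents every vector over [K] as a
    reduction, so that identities holding for all integral vectors descend. *)
Definition lift (y : V) : {ffun B -> int} := [ffun b => (y b != 0)%:R].

Lemma liftK y : red (lift y) = y.
Proof.
apply/ffunP => b; rewrite !ffunE.
by have [->|->] := K01 (y b); rewrite ?eqxx ?oner_eq0.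
Qed.

Lemma redD (x y : {ffun B -> int}) : red (x + y) = red x + red y.
Proof. by apply/ffunP => b; rewrite !ffunE intrD. Qed.

Lemma redN (x : {ffun B -> int}) : red (- x) = red x.
Proof. by apply/ffunP => b; rewrite !ffunE mulrNz K_oppr. Qed.

Lemma red0 : red 0 = 0.
Proof. by apply/ffunP => b; rewrite !ffunE. Qed.

Lemma red_scale t (x : {ffun B -> int}) : red (cscale t x) = cscale t%:~R (red x).
Proof. by apply/ffunP => b; rewrite !ffunE intrM. Qed.

Lemma red_br (x y : {ffun B -> int}) : red (brZ x y) = br (red x) (red y).
Proof.
apply/ffunP => d; rewrite !ffunE rmorph_sum; apply: eq_bigr => b _ /=.
rewrite rmorph_sum; apply: eq_bigr => c _ /=.
by rewrite !ffunE !intrM intz.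
Qed.

Lemma red_root_vec v : red (eZ v) = e v.
Proof. by apply/ffunP => -[a|i]; rewrite !ffunE //; case: eqP. Qed.

Lemma co_red (x : {ffun B -> int}) v : co (red x) v = (co x v)%:~R.
Proof. by rewrite /root_coord; case: insub => [a|] //; rewrite ffunE. Qed.

Lemma brxx x : br x x = 0.
Proof. by have [h _ _] := chevP; rewrite -(liftK x) -red_br h red0. Qed.

Lemma brC x y : br x y = br y x.
Proof. by rewrite -(liftK x) -(liftK y) -!red_br brZC redN. Qed.

Lemma br_jacobi x y z : br x (br y z) = br (br x y) z + br y (br x z).
Proof.
rewrite -(liftK x) -(liftK y) -(liftK z) -!red_br ad_derivation.
exact: redD.
Qed.

Lemma ad_root_sqr2 a y : a \in Phi -> br (e a) (br (e a) y) = 0.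
Proof.
move=> aP; rewrite -(liftK y) -red_root_vec -!red_br.
rewrite ad_root_sqr // red_scale intrM.
have -> : (-2 : int)%:~R = 0 :> K by rewrite mulrNz -[2%:~R]/(1 + 1 : K) K_addrr oppr0.
by rewrite mul0r cscale0.
Qed.

(** Premet's second identity for [e_a]; the function attached to [e_a] is the coordinate at
    [- a]. *)
Lemma premet_root a y z : a \in Phi ->
  cscale (co (br y z) (- a)) (e a) =
  cscale (co y (- a)) (br (e a) z) + cscale (co z (- a)) (br (e a) y)
  + br (br (e a) y) (br (e a) z).
Proof.
move=> aP; rewrite -(liftK y) -(liftK z) -red_root_vec -!red_br !co_red.
rewrite -!red_scale ad_root_leibniz //.
by rewrite !redD redN !red_scale (brZC (lift y) (eZ a)) redN addrAC.
Qed.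

Definition hh (a : 'rV[R]_n) : V :=
  [ffun d => if d is inr i then (coroot_coef Pi a i)%:~R else 0].

Definition parity (a b : 'rV[R]_n) : K :=
  (\sum_i coroot_coef Pi a i * cartan_int b (tnth Pi i))%:~R.

Lemma parityE a b (k : int) : a \in Phi -> b \in Phi -> ip b a = k%:~R ->
  parity a b = k%:~R.
Proof.
move=> aP bP abE; rewrite /parity; congr (_%:~R); apply: (@intr_inj R).
by rewrite sum_coroot_coef.
Qed.

Lemma parity1 a b : a \in Phi -> b \in Phi -> ip b a = 1 -> parity a b = 1.
Proof. by move=> aP bP h; rewrite (parityE (k := 1)). Qed.

Lemma parity0 a b : a \in Phi -> b \in Phi -> ip b a = 0 -> parity a b = 0.
Proof. by move=> aP bP h; rewrite (parityE (k := 0)). Qed.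

Lemma parityN1 a b : a \in Phi -> b \in Phi -> ip b a = -1 -> parity a b = 1.
Proof.
by move=> aP bP h; rewrite (parityE (k := -1)) ?mulrNz ?K_oppr // h mulrNz.
Qed.

Lemma parity2 a : a \in Phi -> parity a a = 0.
Proof.
move=> aP; rewrite (parityE (k := 2)) ?ip_root //.
by rewrite -[2%:~R]/(1 + 1 : K) K_addrr.
Qed.

Lemma cartan_eval_hh a b : cartan_eval b (hh a) = parity a b.
Proof.
rewrite /cartan_eval /parity rmorph_sum; apply: eq_bigr => i _ /=.
by rewrite ffunE intrM.
Qed.

Lemma cartan_evalD a y z : cartan_eval a (y + z) = cartan_eval a y + cartan_eval a z.
Proof.
by rewrite /cartan_eval -big_split; apply: eq_bigr => i _; rewrite ffunE mulrDl.
Qed.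

Lemma cartan_eval_vec a b : cartan_eval a (e b) = 0.
Proof. by rewrite /cartan_eval big1 // => i _; rewrite ffunE mul0r. Qed.

Lemma br_e a y : a \in Phi ->
  br (e a) y = [ffun d => match d with
    | inl c => co y (val c - a) + (val c == a)%:R * cartan_eval a y
    | inr i => co y (- a) * (coroot_coef Pi a i)%:~R
    end].
Proof.
move=> aP; rewrite br_root //.
apply/ffunP => -[c|i]; rewrite !ffunE // K_oppr; congr (_ + _).
have [cP|cP] := boolP (val c - a \in Phi); last by rewrite root_coord_notin ?mul0r.
have [|-> |->] := chev_sign aP cP.
- by rewrite addrC subrK fsvalP.
- by rewrite mulr1.
- by rewrite mulrNz K_oppr mulr1.
Qed.

Lemma co_br a y c : a \in Phi -> c \in Phi ->
  co (br (e a) y) c = co y (c - a) + (c == a)%:R * cartan_eval a y.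
Proof.
by move=> aP cP; rewrite -[c]/(val [` cP]%fset) root_coordE br_e // ffunE.
Qed.

Lemma cart_br a y i : a \in Phi ->
  br (e a) y (inr i) = co y (- a) * (coroot_coef Pi a i)%:~R.
Proof. by move=> aP; rewrite br_e // ffunE. Qed.

Lemma vec_ext y z : (forall c, c \in Phi -> co y c = co z c) ->
  (forall i, y (inr i) = z (inr i)) -> y = z.
Proof.
move=> h1 h2; apply/ffunP => -[c|i]; last exact: h2.
by rewrite -!root_coordE h1 // fsvalP.
Qed.

Lemma co_hh a c : co (hh a) c = 0.
Proof. by rewrite /root_coord; case: insub => [b|] //; rewrite ffunE. Qed.

Lemma hhE a i : hh a (inr i) = (coroot_coef Pi a i)%:~R.
Proof. by rewrite ffunE. Qed.

Lemma vec_cart a i : e a (inr i) = 0.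
Proof. by rewrite ffunE. Qed.

Lemma co_e a c : a \in Phi -> co (e a) c = (c == a)%:R.
Proof. exact: root_coord_vec. Qed.

Lemma br_ee a b : a \in Phi -> b \in Phi -> a + b != 0 -> br (e a) (e b) = e (a + b).
Proof.
move=> aP bP ab0; apply: vec_ext => [c cP|i].
  rewrite co_br // cartan_eval_vec mulr0 addr0 co_e // subr_eq addrC.
  have [abP|abP] := boolP (a + b \in Phi); first by rewrite co_e.
  rewrite root_vec_notin // root_coord0.
  by case: eqP => // cab; rewrite -cab cP in abP.
rewrite cart_br // vec_cart co_e // eq_sym -addr_eq0 addrC.
by rewrite (negPf ab0) mul0r.
Qed.

Lemma br_eN a : a \in Phi -> br (e a) (e (- a)) = hh a.
Proof.
move=> aP; have aN := opp_root aP; apply: vec_ext => [c cP|i].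
  rewrite co_br // cartan_eval_vec mulr0 addr0 co_e // co_hh.
  rewrite -subr_eq0 opprK subrK; case: eqP => // c0.
  by have := zero_notin; rewrite -c0 cP.
by rewrite cart_br // co_e // eqxx mul1r hhE.
Qed.

Lemma br_cartan h y : (forall c, co h c = 0) ->
  br h y = [ffun d => if d is inl c then cartan_eval (val c) h * y (inl c) else 0].
Proof.
move=> h0; apply/ffunP => d; rewrite !ffunE big_sumType /= big1 ?add0r; last first.
  by move=> b _; rewrite big1 // => c _; rewrite -root_coordE h0 !mul0r.
case: d => [c|j].
  rewrite /cartan_eval mulr_suml; apply: eq_bigr => i _.
  rewrite big_sumType /= [X in _ + X]big1 ?addr0; last first.
    by move=> j _; rewrite /basis_bracket ffunE mulr0.
  rewrite (bigD1 c) //= big1 ?addr0.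
    by rewrite /basis_bracket ffunMzE ffunE eqxx -mulrzr mul1r intz mulrAC.
  move=> b bc; rewrite /basis_bracket ffunMzE ffunE (inj_eq val_inj) eq_sym.
  by rewrite (negPf bc) mul0rz mulr0.
rewrite big1 // => i _; rewrite big1 // => -[b|k] _.
  by rewrite /basis_bracket ffunMzE ffunE mul0rz mulr0.
by rewrite /basis_bracket ffunE mulr0.
Qed.

Lemma co_br_hh a y c : c \in Phi -> co (br (hh a) y) c = parity a c * co y c.
Proof.
move=> cP; rewrite -[c]/(val [` cP]%fset) !root_coordE br_cartan; last exact: co_hh.
by rewrite ffunE cartan_eval_hh.
Qed.

Lemma cart_br_hh a y i : br (hh a) y (inr i) = 0.
Proof. by rewrite br_cartan ?ffunE //; apply: co_hh. Qed.

(* [x_v(1)], see [x_root1]; the identity if [v] is not a root. *)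
Definition xr (v : 'rV[R]_n) (y : V) : V :=
  y + br (e v) y + cscale (co y (- v)) (e v).

Lemma xrD v y z : xr v (y + z) = xr v y + xr v z.
Proof.
apply/ffunP => d; rewrite /xr brDr root_coordD !(ffun_addE, cscaleE); ring.
Qed.

Lemma xr0 v : xr v 0 = 0.
Proof. by rewrite /xr br0r root_coord0 cscale0 !addr0. Qed.

Lemma xr_notin v y : v \notin Phi -> xr v y = y.
Proof.
move=> vP; rewrite /xr root_vec_notin // br0l addr0.
by apply/ffunP => d; rewrite !ffunE mulr0 addr0.
Qed.

Lemma co_xr a y c : a \in Phi -> c \in Phi -> c != a ->
  co (xr a y) c = co y c + co y (c - a).
Proof.
move=> aP cP ca; rewrite /xr !root_coordD root_coordZ co_br // co_e //.
by rewrite (negPf ca) mul0r mulr0 !addr0.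
Qed.

Lemma co_xr_diag a y : a \in Phi ->
  co (xr a y) a = co y a + cartan_eval a y + co y (- a).
Proof.
move=> aP; rewrite /xr !root_coordD root_coordZ co_br // co_e // eqxx mulr1 mul1r.
by rewrite subrr (root_coord_notin y zero_notin) add0r.
Qed.

Lemma cart_xr a y i : a \in Phi ->
  xr a y (inr i) = y (inr i) + co y (- a) * (coroot_coef Pi a i)%:~R.
Proof.
by move=> aP; rewrite /xr !ffun_addE cscaleE vec_cart mulr0 addr0 cart_br.
Qed.

Lemma co_br_eN a y : a \in Phi -> co (br (e a) y) (- a) = 0.
Proof.
move=> aP; have aN := opp_root aP; have aa := ip_root aP.
rewrite co_br // root_coord_notin ?add0r; last first.
  apply: (ip_notin (t := 8)); first by rewrite !ip_lin aa; lra.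
  by rewrite gt_eqF //; lra.
rewrite (negPf (_ : - a != a)) ?mul0r //.
by apply/eqP => /(congr1 (ip a)); rewrite !ip_lin aa; lra.
Qed.

(** Neither [y^(-a)] nor [[e_a, y]] changes when [y] is replaced by [xr a y], since [ad e_a] squares
    to 0 and kills [e_a]. The second application adds the same two terms again, and they cancel. *)
Lemma xrK a : involutive (xr a).
Proof.
move=> y; have [aP|aP] := boolP (a \in Phi); last by rewrite !xr_notin.
have aN : - a != a.
  by apply/eqP => /(congr1 (ip a)); rewrite !ip_lin ip_root //; lra.
have cY : co (xr a y) (- a) = co y (- a).
  rewrite /xr !root_coordD root_coordZ co_br_eN // co_e //.
  by rewrite (negPf aN) mulr0 !addr0.
have dY : br (e a) (xr a y) = br (e a) y.
  by rewrite /xr !brDr ad_root_sqr2 // brZr brxx cscaler0 !addr0.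
rewrite {1}/xr cY dY /xr; set c := cscale _ _.
by rewrite [y + _ + c]addrAC ffun_addrK ffun_addrK.
Qed.

(* The automorphism property of [exp (ad e_a)]; its quadratic part is the
   identity [premet_root]. *)
Lemma xr_br a y z : xr a (br y z) = br (xr a y) (xr a z).
Proof.
have [aP|aP] := boolP (a \in Phi); last by rewrite !xr_notin.
rewrite {1}/xr premet_root // (br_jacobi (e a) y z) /xr.
set Dy := br (e a) y; set Dz := br (e a) z; set p := co y _; set q := co z _.
rewrite !brDl !brDr !brZl !brZr brxx.
rewrite (brC y (e a)) -/Dy (brC Dy (e a)) /Dy ad_root_sqr2 // -/Dy.
rewrite -/Dz {4}/Dz ad_root_sqr2 //.
rewrite !cscaler0 !addr0; apply/ffunP => d; rewrite !ffun_addE !cscaleE; ring.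
Qed.

Lemma x_root0 (a : Phi) y : x_root Pi N a 0 y = y.
Proof.
apply/ffunP => d; rewrite ffunE -[RHS](sum_basis y); apply: eq_bigr => c _.
rewrite !big_ord_recl big_ord0 /= expr0 mul1r !expr0n /= !mul0r !addr0 mulrC.
congr (_ * _); rewrite /ad_divpow ffunE /= divz1 ffunE eq_sym.
by case: eqP.
Qed.

(** The exponential series stops at degree 2: the divided square is minus the rank one map by
    [ad_root_sqr], the cube is 0, and the sign disappears in [K]. *)
Lemma x_root1 (a : Phi) y : x_root Pi N a 1 y = xr (val a) y.
Proof.
have aP : val a \in Phi := fsvalP a.
apply/ffunP => d; rewrite ffunE /xr !ffun_addE cscaleE.
have y1 : y d = \sum_c y c * (basis_vec int c d)%:~R.
  rewrite -[LHS](sum_basis y); apply: eq_bigr => c _; rewrite mulrC ffunE eq_sym.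
  by case: eqP.
have y2 : br (e (val a)) y d =
    \sum_c y c * (brZ (eZ (val a)) (basis_vec int c) d)%:~R.
  rewrite root_vecE br_basis; apply: eq_bigr => c _; congr (_ * _%:~R).
  rewrite root_vecE br_basis (bigD1 c) //= ffunE eqxx mul1r intz big1 ?addr0 //.
  by move=> b bc; rewrite ffunE (negPf bc) mul0r.
have y3 : co y (- val a) = \sum_c y c * (co (basis_vec int c) (- val a))%:~R.
  rewrite /root_coord; case: insubP => [b _ _|_]; last first.
    by rewrite big1 // => c _; rewrite mulr0.
  rewrite -(sum_basis y); apply: eq_bigr => c _; rewrite mulrC ffunE eq_sym.
  by case: eqP.
rewrite y1 y2 y3 mulr_suml -!big_split /=; apply: eq_bigr => c _.
have D0 : ad_divpow Pi N a 0 c d = basis_vec int c d.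
  by rewrite /ad_divpow ffunE divz1.
have D1 : ad_divpow Pi N a 1 c d = brZ (eZ (val a)) (basis_vec int c) d.
  by rewrite /ad_divpow ffunE divz1.
have D2 : ad_divpow Pi N a 2 c d = - (co (basis_vec int c) (- val a) * eZ (val a) d).
  rewrite /ad_divpow ffunE.
  rewrite -[iter _ _ _]/(brZ (eZ (val a)) (brZ (eZ (val a)) (basis_vec int c))).
  rewrite ad_root_sqr // cscaleE.
  by rewrite !mulNr -mulrA -mulrN mulKz.
have D3 : ad_divpow Pi N a 3 c d = 0.
  rewrite /ad_divpow ffunE -[iter _ _ _]/(brZ (eZ (val a))
    (brZ (eZ (val a)) (brZ (eZ (val a)) (basis_vec int c)))).
  by rewrite ad_root_cube // ffunE div0z.
rewrite !big_ord_recr big_ord0 /= D0 D1 D2 D3 !expr1n !mul1r add0r addr0.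
rewrite mulrNz K_oppr intrM mulrDr mulrDr mulrA; congr (_ + _ * _).
by rewrite !ffunE; case: d {y1 y2 D0 D1 D2 D3} => // b; case: eqP.
Qed.

(** * Extremal elements *)

Lemma absurd_le10 : 1 <= 0 :> R -> False.
Proof. lra. Qed.

(* On the goal [False], [lra] would look for an ordered field among the types of
   all equations of the context; clearing the other hypotheses is for speed. *)
Local Ltac ip_lra :=
  rewrite ?ip_lin ?ip0l; try (let h := fresh in intro h);
  lazymatch goal with |- False => apply: absurd_le10 | _ => idtac end;
  repeat match goal with
  | H : is_true (_ \in _) |- _ => clear H
  | H : is_true (_ \notin _) |- _ => clear H
  | H : forall _, _ |- _ => clear H
  end; lra.

Lemma ip_eq2 a b : a \in Phi -> b \in Phi -> ip a b = 2 -> a = b.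
Proof. by move=> aP bP; case: (ipP aP bP) => // *; exfalso; ip_lra. Qed.

Lemma root_sub_ip a b : a \in Phi -> b \in Phi -> a - b \in Phi -> ip a b = 1.
Proof.
move=> aP bP h; have := root_add_ip aP (opp_root bP) h; rewrite ipNr; lra.
Qed.

Lemma neq_ip c a b : (ip a c = ip b c -> False) -> a != b.
Proof. by move=> h; apply/eqP => ab; apply: h; rewrite ab. Qed.

Lemma notin_norm c : (ip c c = 2 -> False) -> c \notin Phi.
Proof. by move=> h; apply/negP => /ip_root. Qed.

Lemma xr_fix a b : a \in Phi -> b \in Phi -> 0 <= ip a b -> xr a (e b) = e b.
Proof.
move=> aP bP ab; have nba : - a != b.
  by apply/eqP => ba; move: ab; rewrite -ba ipNr ip_root //; lra.
rewrite /xr co_e // (negPf nba) cscale0 addr0 br_ee //.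
  rewrite (@root_vec_notin _ (a + b)) ?addr0 //; apply/negP => abP.
  by have := root_add_ip aP bP abP; lra.
by rewrite addrC addr_eq0 eq_sym.
Qed.

Lemma xr_add a b : a \in Phi -> b \in Phi -> ip a b = -1 ->
  xr a (e b) = e b + e (a + b).
Proof.
move=> aP bP ab; have nba : - a != b.
  by apply/eqP => ba; move: ab; rewrite -ba ipNr ip_root //; lra.
rewrite /xr co_e // (negPf nba) cscale0 addr0 br_ee //.
by rewrite addrC addr_eq0 eq_sym.
Qed.

Lemma hhN a : a \in Phi -> hh (- a) = hh a.
Proof.
move=> aP; apply/ffunP => -[b|i]; rewrite !ffunE //.
by rewrite coroot_coefN // mulrNz K_oppr.
Qed.

Lemma xr_eN a : a \in Phi -> xr a (e (- a)) = e (- a) + hh a + e a.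
Proof.
move=> aP; have aN := opp_root aP.
by rewrite /xr co_e // eqxx cscale1 br_eN.
Qed.

Lemma br_hh_e a b : a \in Phi -> b \in Phi -> br (hh a) (e b) = cscale (parity a b) (e b).
Proof.
move=> aP bP; apply: vec_ext => [c cP|i]; last by rewrite cart_br_hh cscaleE vec_cart mulr0.
rewrite co_br_hh // root_coordZ !co_e //; case: eqP => [->//|_].
by rewrite !mulr0.
Qed.

Lemma xr_hh a b : a \in Phi -> b \in Phi -> xr a (hh b) = hh b + cscale (parity b a) (e a).
Proof.
move=> aP bP; rewrite /xr co_hh cscale0 addr0; congr (_ + _).
by rewrite brC br_hh_e.
Qed.

(* Premet's identities over [F_2]. *)
Definition extremal (y : V) : Prop :=
  (forall v, br y (br y v) = 0) /\
  exists2 phi : V -> K, phi 0 = 0 &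
  forall v w, cscale (phi (br v w)) y =
    cscale (phi v) (br y w) + cscale (phi w) (br y v) + br (br y v) (br y w).

Lemma extremal_root a : a \in Phi -> extremal (e a).
Proof.
move=> aP; split=> [v|]; first exact: ad_root_sqr2.
exists (fun v => co v (- a)); first exact: root_coord0.
by move=> v w; apply: premet_root.
Qed.

(* The grades [ip c d] add up under the bracket, and [d] has grade 2. *)
Lemma co_br_grade d y z : d \in Phi ->
  (forall i, y (inr i) = 0) ->
  (forall c, c \in Phi -> co y c != 0 -> ip c d <= -1) ->
  (forall c, c \in Phi -> co z c != 0 -> ip c d <= 1) ->
  co (br y z) d = 0.
Proof.
move=> dP y0 yc zc; rewrite -[d]/(val [` dP]%fset) root_coordE ffunE.
rewrite big1 // => -[b|i] _; last by rewrite big1 // => c _; rewrite y0 !mul0r.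
have [->|yb] := eqVneq (y (inl b)) 0; first by rewrite big1 // => c _; rewrite !mul0r.
have bd : ip (val b) d <= -1 by apply: yc; rewrite ?root_coordE // fsvalP.
have bb := fsvalP b.
rewrite big1 // => -[c|i] _; last first.
  rewrite basis_bracket_cr; case: eqP => [db|_]; last by rewrite mul0r oppr0 mulr0.
  by exfalso; move: bd; rewrite -db /= ip_root //; lra.
have [->|zb] := eqVneq (z (inl c)) 0; first by rewrite mulr0 mul0r.
have cd : ip (val c) d <= 1 by apply: zc; rewrite ?root_coordE // fsvalP.
rewrite basis_bracket_rr; case: (_ =P _ + _) => [/= db|_]; last by rewrite mul0r !mulr0.
by exfalso; have := ip_root dP; rewrite {1}db ipDl; lra.
Qed.

(** * Extremal elements with coordinate 1 at [d] and nothing in degree 1 *)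

Section Top.
Variables (d : 'rV[R]_n) (y : V).
Hypotheses (dP : d \in Phi) (yE : extremal y) (yd : co y d = 1).
Hypothesis (y1 : forall a, a \in Phi -> ip a d = 1 -> co y a = 0).

Let dN : - d \in Phi. Proof. exact: opp_root. Qed.
Let dd : ip d d = 2. Proof. exact: ip_root. Qed.

Lemma parity_odd a b : a \in Phi -> b \in Phi -> ip b a = 1 \/ ip b a = -1 ->
  parity a b = 1.
Proof.
move=> aP bP [ab|ab]; first by rewrite parity1.
by rewrite parityN1.
Qed.

(** The bracket with [e_(-d)] lowers the degree by 2: degree 2 yields [h_d], degree 1 is empty, and
    in degree 0 only the Cartan part contributes, since [b - d] is not a root for [b] orthogonal to
    [d]. *)
Lemma top_br_aux : br (e (- d)) y = hh d + cscale (cartan_eval (- d) y) (e (- d)).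
Proof.
apply: vec_ext => [c cP|i]; last first.
  by rewrite cart_br // opprK yd mul1r ffun_addE cscaleE vec_cart mulr0 addr0 -(hhN dP) hhE.
rewrite co_br // opprK root_coordD root_coordZ co_hh co_e // mulrC; congr (_ + _).
have [cdP|cdP] := boolP (c + d \in Phi); last by rewrite root_coord_notin.
by apply: y1 => //; have := root_add_ip cP dP cdP; rewrite ipDl dd; lra.
Qed.

(** Write [k] for the evaluation. The first Premet identity on [e_(-d)] reads [[h_d, y] + k (h_d + k
    e_(-d)) = 0]. Its Cartan part, evaluated at a root of degree 1, gives [k = 0]; then [[h_d, y] =
    0], and [h_d] acts as the identity in odd degrees. *)
Lemma top_facts : cartan_eval (- d) y = 0 /\
  forall b, b \in Phi -> ip b d = 1 \/ ip b d = -1 -> co y b = 0.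
Proof.
have [y2 _] := yE; have := y2 (e (- d)).
rewrite [br y (e _)]brC top_br_aux brC; set k := cartan_eval _ _.
rewrite brDl brZl top_br_aux -/k => h.
have k0 : k = 0.
  have [g gP gd] := ex_ip1 dP.
  have := congr1 (cartan_eval g) h.
  have c0 z : (forall i, z (inr i) = 0) -> cartan_eval g z = 0.
    by move=> z0; rewrite /cartan_eval big1 // => i _; rewrite z0 mul0r.
  rewrite (c0 0) => [|i]; last by rewrite ffunE.
  rewrite cartan_evalD c0 => [|i]; last exact: cart_br_hh.
  have -> : cscale k (hh d + cscale k (e (- d))) = cscale k (hh d) + cscale (k * k) (e (- d)).
    by apply/ffunP => b; rewrite !(ffun_addE, cscaleE) mulrDr mulrA.
  rewrite cartan_evalD [X in _ + (_ + X)]c0 => [|i]; last by rewrite cscaleE vec_cart mulr0.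
  have -> : cartan_eval g (cscale k (hh d)) = k * cartan_eval g (hh d).
    by rewrite /cartan_eval mulr_sumr; apply: eq_bigr => i _; rewrite cscaleE mulrA.
  by rewrite cartan_eval_hh parity_odd ?add0r ?addr0 ?mulr1 //; left.
split=> // b bP bd; have := congr1 (fun z => co z b) h.
by rewrite k0 cscale0 addr0 co_br_hh // parity_odd // mul1r root_coord0.
Qed.

Let ev_d : cartan_eval (- d) y = 0. Proof. by case: top_facts. Qed.
Let odd0 b : b \in Phi -> ip b d = 1 \/ ip b d = -1 -> co y b = 0.
Proof. by case: top_facts => _; apply. Qed.

Lemma top_br : br y (e (- d)) = hh d.
Proof. by rewrite brC top_br_aux ev_d cscale0 addr0. Qed.

Lemma top_pair a : a \in Phi -> ip a d = 1 -> br (e (- a)) (e (a - d)) = e (- d).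
Proof.
move=> aP ad; have dd' := dd; have aN := opp_root aP.
have adP : a - d \in Phi by apply: root_sub.
have E : - a + (a - d) = - d by rewrite addrA addNr add0r.
by rewrite br_ee ?E //; apply: (neq_ip (c := d)); ip_lra.
Qed.

(** As [y] has no component of odd degree, [[y, e_(-a)]] is [e_(d-a)] plus terms of degree at most
    -1, while [[y, e_(a-d)]] has degree at most 1. Only [[e_(d-a), e_a] = e_d] reaches degree 2. *)
Lemma top_pair_coord a : a \in Phi -> ip a d = 1 ->
  co (br (br y (e (- a))) (br y (e (a - d)))) d = 1.
Proof.
move=> aP ad; have dd' := dd; have aa := ip_root aP.
have da : ip d a = 1 by rewrite ipC.
have aN := opp_root aP.
have adP : a - d \in Phi by apply: root_sub.
have daP : d - a \in Phi by rewrite -opprB opp_root.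
set A := br y (e (- a)); set Z := br y (e (a - d)).
have Zc c : c \in Phi -> c != a - d -> co Z c = co y (c - a + d).
  move=> cP ca; rewrite /Z brC co_br // (negPf ca) mul0r addr0.
  by rewrite opprB addrA addrAC.
have Ac c : c \in Phi -> c != - a -> co A c = co y (c + a).
  by move=> cP ca; rewrite /A brC co_br // (negPf ca) mul0r addr0 opprK.
have Adec : A = e (d - a) + (A + e (d - a)) by rewrite addrC ffun_addrK.
have dad : d - a != - a by apply: (neq_ip (c := d)); ip_lra.
have daa : a != a - d by apply: (neq_ip (c := d)); ip_lra.
rewrite Adec brDl root_coordD [X in _ + X]co_br_grade ?addr0 //.
- rewrite co_br // [d == _](negPf _) ?mul0r ?addr0; last first.
    by apply: (neq_ip (c := d)); ip_lra.
  by rewrite opprB addrCA subrr addr0 Zc // subrr add0r yd.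
- move=> i; rewrite ffun_addE vec_cart addr0 /A brC cart_br // opprK.
  by rewrite y1 ?mul0r.
- move=> c cP; rewrite root_coordD co_e //.
  have [->|cda] := eqVneq c (d - a).
    by rewrite Ac // subrK yd K_addrr eqxx.
  rewrite addr0; have [->|ca] := eqVneq c (- a); first by rewrite ipNl ad.
  rewrite Ac //; have [caP|] := boolP (c + a \in Phi); last first.
    by move=> h; rewrite root_coord_notin ?eqxx.
  have := ipDl Pi c a d; rewrite ad; case: (ipP caP dP) => [h||||h] E.
  + by move: cda; rewrite -h addrK eqxx.
  + by rewrite odd0 ?eqxx //; left; rewrite ipDl ad -E.
  + by move=> _; lra.
  + by move=> _; lra.
  + by move=> _; lra.
- move=> c cP; have [->|ca] := eqVneq c (a - d); first by move=> _; ip_lra.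
  rewrite Zc //; have [cdP|] := boolP (c - a + d \in Phi); last first.
    by move=> h; rewrite root_coord_notin ?eqxx.
  have : ip (c - a + d) d = ip c d - 1 + 2 by rewrite !ip_lin ad dd.
  by case: (ipP cdP dP) => [h||||h] E _; lra.
Qed.

Lemma extremal_top : y = e d \/ y = xr (- d) (e d).
Proof.
have [_ [phi phi0 P]] := yE; have dd' := dd.
have [a aP ad] := ex_ip1 dP.
have aa := ip_root aP.
have da : ip d a = 1 by rewrite ipC.
have aN := opp_root aP.
have adP : a - d \in Phi by apply: root_sub.
have daP : d - a \in Phi by rewrite -opprB opp_root.
have notd c : ip c d != 2 -> (d == c) = false.
  by move=> h; apply/negbTE/eqP => dc; rewrite -dc dd eqxx in h.
(* The pair [e_(-a)], [e_(a-d)] has bracket [e_(-d)], so the coordinate at [d] of the second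
   identity is [phi (e (- d))] on the left and the value of [top_pair_coord] on the right. *)
have p1 : phi (e (- d)) = 1.
  have := congr1 (fun z => co z d) (P (e (- a)) (e (a - d))).
  rewrite !root_coordD !root_coordZ top_pair // top_pair_coord // yd mulr1 => ->.
  rewrite [br y (e (a - d))]brC [br y (e (- a))]brC !co_br // !notd.
  - rewrite !mul0r !addr0 !(@root_coord_notin _ y) ?mulr0 ?add0r //.
      by apply: notin_norm; ip_lra.
    by apply: notin_norm; ip_lra.
  - by rewrite ip_lin ad lt_eqF //; lra.
  - by rewrite !ip_lin ad dd lt_eqF //; lra.
(* The second identity for [e_(-d)] and [h_g]. At the roots it says that the products of [g] with
   [d] and with any root in the support of [y] agree modulo 2; on the Cartan part it compares [y]
   with [h_d]. *)
have Pg g : g \in Phi -> (forall b, b \in Phi ->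
      parity g d * co y b = parity g b * co y b) /\
      (forall i, parity g d * y (inr i) = phi (hh g) * (coroot_coef Pi d i)%:~R).
  move=> gP; have := P (e (- d)) (hh g).
  rewrite top_br p1 cscale1 [br (e (- d)) _]brC br_hh_e //.
  have -> : parity g (- d) = parity g d.
    have h0 : cartan_eval (- d) (hh g) = cartan_eval d (hh g).
      rewrite /cartan_eval; apply: eq_bigr => i _; congr (_ * _).
      rewrite -(K_oppr (cartan_int d _)%:~R) -mulrNz; congr (_%:~R).
      apply: (@intr_inj R); rewrite mulrNz !cartan_intE //.
      by rewrite ipNl.
    by rewrite -!cartan_eval_hh.
  have -> : phi (cscale (parity g d) (e (- d))) = parity g d.
    by have [->|->] := K01 (parity g d); rewrite ?cscale0 ?cscale1 ?phi0 ?p1.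
  move=> h; split=> [b bP|i].
    have := congr1 (fun z => co z b) h.
    rewrite !root_coordD !root_coordZ co_hh mulr0 addr0 [br y (hh g)]brC.
    rewrite !co_br_hh // => ->; rewrite [parity d b * _]mulrCA.
    suff -> : parity d b * co y b = 0 by rewrite mulr0 addr0.
    have [->|bd] := eqVneq b d; first by rewrite parity2 // mul0r.
    have hb := @odd0 b bP; case E: (ip b d) / (ipP bP dP) => [bE|||| dE].
    - by rewrite bE eqxx in bd.
    - by rewrite hb ?mulr0 //; left.
    - by rewrite parity0 ?mul0r.
    - by rewrite hb ?mulr0 //; right.
    - have -> : parity d b = (-2)%:~R by apply: parityE; rewrite // E mulrNz.
      by rewrite mulrNz -[2%:~R]/(1 + 1 : K) K_addrr oppr0 mul0r.
  have := congr1 (fun z : V => z (inr i)) h.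
  rewrite !ffun_addE !cscaleE hhE cart_br_hh => ->.
  by rewrite [br y (hh g)]brC cart_br_hh add0r addr0.
(* A root [g] orthogonal to [d] with [ip g b = 1] violates this agreement of parities unless
   [co y b = 0]. *)
have y0 b : b \in Phi -> ip b d = 0 -> co y b = 0.
  move=> bP bd; have db : ip d b = 0 by rewrite ipC.
  have [_ [g gP [gb gd]]] := ex_orth_pair bP dP bd.
  have [/(_ b bP) + _] := Pg g gP.
  by rewrite parity0 1?ipC // parity1 1?ipC // mul0r mul1r.
(* For [g = a] of degree 1 the left factor is 1, so the Cartan part of [y] is a multiple of
   [h_d]. *)
have [s yh] : exists s, forall i, y (inr i) = s * (coroot_coef Pi d i)%:~R.
  have [_ /= h] := Pg a aP; exists (phi (hh a)) => i; rewrite -h parity1 ?mul1r //.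
have yE' : y = e d + cscale s (hh d) + cscale (co y (- d)) (e (- d)).
  have dNd : - d != d by apply: (neq_ip (c := d)); ip_lra.
  apply: vec_ext => [c cP|i]; last first.
    by rewrite !ffun_addE !cscaleE !vec_cart hhE yh mulr0 addr0 add0r.
  rewrite !root_coordD !root_coordZ co_hh !co_e // mulr0 addr0.
  have [->|cd] := eqVneq c d; first by rewrite eq_sym (negPf dNd) mulr0 addr0.
  have [->|cdN] := eqVneq c (- d); first by rewrite mulr1 add0r.
  rewrite mulr0 addr0; case E: (ip c d) / (ipP cP dP) => [cE|||| dE].
  - by rewrite cE eqxx in cd.
  - exact: y1.
  - exact: y0.
  - by apply: odd0 => //; right.
  - by rewrite dE opprK eqxx in cdN.
(* The identity that gave [p1], now read at [- d]: the right-hand side contributes [s * s], which is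
   [s] over two elements. *)
have tE : co y (- d) = s.
  have := congr1 (fun z => co z (- d)) (P (e (- a)) (e (a - d))).
  rewrite !root_coordD !root_coordZ top_pair // p1 mul1r => ->.
  have AE : br y (e (- a)) = e (d - a) + cscale s (e (- a)).
    rewrite yE' !brDl !brZl !br_ee //; last 2 first.
    - by apply: (neq_ip (c := d)); ip_lra.
    - by apply: (neq_ip (c := d)); ip_lra.
    rewrite (@root_vec_notin _ (- d - a)) ?cscaler0 ?addr0; last first.
      by apply: notin_norm; ip_lra.
    by rewrite br_hh_e // parityN1 ?ipNl ?ad ?cscale1.
  have ZE : br y (e (a - d)) = e a + cscale s (e (a - d)).
    rewrite yE' !brDl !brZl !br_ee //; last 2 first.
    - by apply: (neq_ip (c := d)); ip_lra.
    - by apply: (neq_ip (c := d)); ip_lra.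
    rewrite (@root_vec_notin _ (- d + (a - d))) ?cscaler0 ?addr0; last first.
      by apply: notin_norm; ip_lra.
    rewrite br_hh_e // parityN1 ?cscale1 //; first by rewrite addrCA subrr addr0.
    by ip_lra.
  have nd c : (ip c d = - 2 -> False) -> (- d == c) = false.
    by move=> h; apply/negbTE/eqP => dc; apply: h; rewrite -dc; ip_lra.
  rewrite AE ZE !root_coordD !root_coordZ !co_e //.
  rewrite !nd; [|ip_lra..].
  rewrite !(mulr0, addr0, add0r) !brDl !brDr !brZl !brZr !root_coordD !root_coordZ.
  rewrite [br (e (- a)) (e a)]brC br_eN // co_hh top_pair //.
  rewrite -[a - d]opprB br_eN // co_hh br_ee //; last first.
    by apply: (neq_ip (c := d)); ip_lra.
  rewrite subrK !co_e // eqxx nd; last by ip_lra.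
  rewrite !(mulr0, addr0, add0r, mulr1).
  by have [->|->] := K01 s; rewrite ?mulr0 ?mulr1.
have xdE : xr (- d) (e d) = e d + hh d + e (- d).
  by have := xr_eN dN; rewrite opprK hhN.
rewrite xdE [y]yE' tE; have [->|->] := K01 s; [left|right].
  by rewrite !cscale0 !addr0.
by rewrite !cscale1.
Qed.
End Top.

(** * The elementary group and its invariants *)

Definition pX (a : 'rV[R]_n) : {perm V} := perm (inv_inj (xrK a)).

Lemma pXE a y : pX a y = xr a y.
Proof. by rewrite permE. Qed.

Lemma mem_pX (S : {set Phi}) a : a \in S -> pX (val a) \in elementary_group Pi N K S.
Proof.
move=> aS; apply: mem_gen; rewrite inE; apply/existsP; exists a; rewrite aS /=.
by apply/existsP; exists 1; apply/forallP => v; rewrite pXE x_root1.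
Qed.

(** The parameter takes only the values 0 and 1, so a generator is the identity or some [pX]. *)
Lemma elementary_ind (S : {set Phi}) (P : {perm V} -> Prop) :
  P 1%g -> (forall a, a \in S -> P (pX (val a))) ->
  (forall g h, P g -> P h -> P (g * h)%g) ->
  forall g, g \in elementary_group Pi N K S -> P g.
Proof.
move=> P1 PX PM g /gen_prodgP[m [c cS ->]]; apply: (big_ind P) => // i _.
have := cS i; rewrite inE => /existsP[a /andP[aS /existsP[t /forallP h]]].
have [t0|t1] := K01 t.
  suff -> : c i = 1%g by [].
  by apply/permP => v; rewrite (eqP (h v)) t0 x_root0 perm1.
suff -> : c i = pX (val a) by apply: PX.
by apply/permP => v; rewrite (eqP (h v)) t1 x_root1 pXE.
Qed.

Section Automorphisms.
Variable S : {set Phi}.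
Local Notation G := (elementary_group Pi N K S).

Lemma elemD g y z : g \in G -> g (y + z) = g y + g z.
Proof.
move=> gG; elim/elementary_ind: gG y z => [|a _|h k hh kk] y z.
- by rewrite !perm1.
- by rewrite !pXE xrD.
- by rewrite !permM hh kk.
Qed.

Lemma elem0 g : g \in G -> g 0 = 0.
Proof. by move=> gG; have /eqP := elemD 0 0 gG; rewrite addr0 -subr_eq subrr eq_sym => /eqP. Qed.

Lemma elem_br g y z : g \in G -> g (br y z) = br (g y) (g z).
Proof.
move=> gG; elim/elementary_ind: gG y z => [|a _|h k hh kk] y z.
- by rewrite !perm1.
- by rewrite !pXE xr_br.
- by rewrite !permM hh kk.
Qed.

Lemma elem_cscale g t y : g \in G -> g (cscale t y) = cscale t (g y).
Proof.
by move=> gG; have [->|->] := K01 t; rewrite ?cscale0 ?cscale1 ?elem0.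
Qed.

Lemma extremal_group g y : g \in G -> extremal y -> extremal (g y).
Proof.
move=> gG [y2 [phi phi0 P]]; have giG := groupVr gG; split=> [v|].
  by rewrite -[v](permKV g) -!elem_br // y2 elem0.
exists (fun v => phi (g^-1%g v)); first by rewrite elem0.
move=> v w.
have key v' w' : cscale (phi (br v' w')) (g y) = cscale (phi v') (br (g y) (g w'))
    + cscale (phi w') (br (g y) (g v')) + br (br (g y) (g v')) (br (g y) (g w')).
  by rewrite -!elem_br // -!elem_cscale // -!elemD // P.
by have := key (g^-1%g v) (g^-1%g w); rewrite -(elem_br _ _ giG) !permKV.
Qed.

End Automorphisms.

(** * Brackets that detect the angle between two roots *)

Lemma e_neq0 a : a \in Phi -> e a != 0.
Proof.
move=> aP; apply/eqP => /(congr1 (fun z => co z a)) /eqP.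
by rewrite co_e // eqxx root_coord0 oner_eq0.
Qed.

Lemma e_inj a b : a \in Phi -> b \in Phi -> e a = e b -> a = b.
Proof.
move=> aP bP /(congr1 (fun z => co z b)); rewrite !co_e // eqxx.
by case: (b =P a) => [->//|_] /eqP; rewrite eq_sym oner_eq0.
Qed.

(** The four alternatives are the elements of the span of [y] and [z] over two elements: [ad y]
    after [ad z] has its image there. Among commuting distinct root vectors this marks the angle
    [pi / 3]. *)
Definition rank_two y z := forall v, [\/ br y (br z v) = 0, br y (br z v) = y,
  br y (br z v) = z | br y (br z v) = y + z].

(** The bracket of [y] and [z] does not square to zero. This separates opposite roots, whose bracket
    is [h_a], from roots with product -1, whose bracket is a root vector. *)
Definition toral y z := exists v, br (br y z) (br (br y z) v) != 0.

(** If [c], [c - a] and [c - a - b] are roots, then [ip c a = 1] and [ip c b = 2], hence [c = b].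
    The only other route passes through [h_b] and ends at [a]. *)
Lemma rank_two_root a b : a \in Phi -> b \in Phi -> ip a b = 1 -> rank_two (e a) (e b).
Proof.
move=> aP bP ab v; have aa := ip_root aP; have bb := ip_root bP.
have ba : ip b a = 1 by rewrite ipC.
suff -> : br (e a) (br (e b) v) = cscale (co v (- b)) (e a) + cscale (co v (- a)) (e b).
  have [->|->] := K01 (co v (- b)); have [->|->] := K01 (co v (- a));
    rewrite ?cscale0 ?cscale1 ?addr0 ?add0r;
    [exact: Or41 | exact: Or43 | exact: Or42 | exact: Or44].
have abN : a + b \notin Phi by apply: notin_norm; ip_lra.
apply: vec_ext => [c cP|i]; last first.
  rewrite cart_br // co_br // ?opp_root // [co v (- a - b)]root_coord_notin; last first.
    by rewrite -opprD; apply: contra abN => /opp_root; rewrite opprK.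
  rewrite ffun_addE !cscaleE !vec_cart !mulr0 addr0 (negPf (_ : - a != b)) ?mul0r ?add0r ?mul0r //.
  by apply: (neq_ip (c := a)); ip_lra.
rewrite root_coordD !root_coordZ !co_e // co_br // addrC; congr (_ + _).
  rewrite mulrC; congr (_ * _); rewrite /cartan_eval.
  rewrite (eq_bigr (fun i => co v (- b) *
    ((coroot_coef Pi b i)%:~R * (cartan_int a (tnth Pi i))%:~R))).
    rewrite -mulr_sumr -[RHS]mulr1; congr (_ * _).
    rewrite -[RHS](parity1 bP aP ab) /parity rmorph_sum; apply: eq_bigr => i _ /=.
    by rewrite intrM.
  by move=> i _; rewrite cart_br // mulrA.
have [cP'|cN] := boolP (c - a \in Phi); last first.
  rewrite [co _ (c - a)]root_coord_notin //; case: eqP => [cb|_]; last by rewrite mulr0.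
  by rewrite cb root_sub in cN.
have ca : ip c a = 1 by apply: root_sub_ip.
rewrite co_br // (negPf (_ : c - a != b)) ?mul0r ?addr0; last first.
  by rewrite subr_eq addrC; apply: contraNneq abN => <-.
have [->|cb] := eqVneq c b; first by rewrite mulr1 addrAC subrr add0r.
rewrite mulr0 root_coord_notin //; apply/negP => h; have := root_sub_ip cP' bP h.
rewrite ipDl ipNl ab; case E: (ip c b) / (ipP cP bP) => [cE|||| bE]; try ip_lra.
by rewrite cE eqxx in cb.
Qed.

Lemma not_rank_two_root a b : a \in Phi -> b \in Phi -> ip a b = 0 -> ~ rank_two (e a) (e b).
Proof.
move=> aP bP ab /=; have aa := ip_root aP; have bb := ip_root bP.
have ba : ip b a = 0 by rewrite ipC.
have [[g gP [ga gb]] _] := ex_orth_pair aP bP ab; have gg := ip_root gP.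
have ag : ip a g = -1 by rewrite ipC.
have bg : ip b g = -1 by rewrite ipC.
have bgP : b + g \in Phi by apply: root_add.
have abg : ip a (b + g) = -1 by ip_lra.
have cP : a + (b + g) \in Phi by apply: root_add.
have E : br (e a) (br (e b) (e g)) = e (a + (b + g)) by rewrite !br_ee ?root_neq0.
have na : (a + (b + g) == a) = false.
  by apply/negbTE; apply: (neq_ip (c := a)); ip_lra.
have nb : (a + (b + g) == b) = false.
  by apply/negbTE; apply: (neq_ip (c := b)); ip_lra.
(* As [g] has product -1 with [a] and [b], the double bracket climbs to a third root vector, outside
   the span of [e a] and [e b]. *)
move=> /(_ (e g)); rewrite E => -[] /(congr1 (fun z => co z (a + (b + g)))) /eqP;
by rewrite ?root_coordD ?root_coord0 !co_e // eqxx ?na ?nb ?addr0 oner_eq0.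
Qed.

Lemma br_roots_eq0 a b : a \in Phi -> b \in Phi ->
  (br (e a) (e b) == 0) = (0 <= ip a b).
Proof.
move=> aP bP; have aa := ip_root aP; have bb := ip_root bP.
have dec c : c \notin Phi -> e c = 0 by apply: root_vec_notin.
case E: (ip a b) / (ipP aP bP) => [ab|||| ba].
- by rewrite ab brxx eqxx ler0n.
- have ba : ip b a = 1 by rewrite ipC.
  have ab0 : a + b != 0 by apply: (neq_ip (c := a)); ip_lra.
  have abN : a + b \notin Phi by apply: notin_norm; ip_lra.
  by rewrite br_ee // dec // eqxx ler01.
- have ba : ip b a = 0 by rewrite ipC.
  have ab0 : a + b != 0 by apply: (neq_ip (c := a)); ip_lra.
  have abN : a + b \notin Phi by apply: notin_norm; ip_lra.
  by rewrite br_ee // dec // eqxx lexx.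
- have abP := root_add aP bP E.
  have ab0 : a + b != 0 by apply: contraNneq zero_notin => <-.
  by rewrite br_ee // (negPf (e_neq0 _)) // lerNr oppr0 ler10.
- rewrite ba br_eN //; have [g gP ga] := ex_ip1 aP.
  rewrite lerNr oppr0 lern0; apply/negbTE.
  apply/eqP => h; have := cartan_eval_hh a g.
  rewrite h parity1 // /cartan_eval big1; last by move=> i _; rewrite ffunE mul0r.
  by move/eqP; rewrite eq_sym oner_eq0.
Qed.

Lemma not_toral_root a b : a \in Phi -> b \in Phi -> ip a b = -1 -> ~ toral (e a) (e b).
Proof.
move=> aP bP ab [v]; have abP := root_add aP bP ab.
rewrite br_ee //; first by rewrite ad_root_sqr2 ?eqxx.
by apply: contraNneq zero_notin => <-.
Qed.

Lemma toral_root a : a \in Phi -> toral (e a) (e (- a)).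
Proof.
move=> aP; have [g gP ga] := ex_ip1 aP; exists (e g).
by rewrite br_eN // br_hh_e // brZr br_hh_e // parity1 // !cscale1 e_neq0.
Qed.

(* The angle between the roots is read off from the brackets of the root
   vectors, so that it is invariant under automorphisms. *)
Lemma ip_invariant (S : {set Phi}) g a b a' b' :
  g \in elementary_group Pi N K S ->
  a \in Phi -> b \in Phi -> a' \in Phi -> b' \in Phi ->
  g (e a) = e a' -> g (e b) = e b' -> ip a b = ip a' b'.
Proof.
move=> gG aP bP aP' bP' ga gb.
have A : (a == b) = (a' == b').
  apply/eqP/eqP => [ab|ab]; first by apply: e_inj; rewrite // -ga -gb ab.
  by apply: e_inj => //; apply: (@perm_inj _ g); rewrite ga gb ab.
have Bq : (0 <= ip a b) = (0 <= ip a' b').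
  rewrite -!br_roots_eq0 // -ga -gb -(elem_br _ _ gG).
  by rewrite -[in RHS](elem0 gG) (inj_eq perm_inj).
have C : rank_two (e a) (e b) <-> rank_two (e a') (e b').
  rewrite -ga -gb; split=> h v.
    have := h (g^-1%g v); rewrite -[in X in _ -> X](permKV g v) -!(elem_br _ _ gG).
    by case=> ->; rewrite ?(elem0 gG) ?(elemD _ _ gG);
      [apply: Or41|apply: Or42|apply: Or43|apply: Or44].
  have := h (g v); rewrite -!(elem_br _ _ gG) -(elemD _ _ gG) -{1}(elem0 gG).
  by case=> /perm_inj ->; [apply: Or41|apply: Or42|apply: Or43|apply: Or44].
have D : toral (e a) (e b) <-> toral (e a') (e b').
  rewrite -ga -gb; split=> -[v hv].
    by exists (g v); rewrite -!(elem_br _ _ gG) -(elem0 gG) (inj_eq perm_inj).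
  exists (g^-1%g v); move: hv; rewrite -{1}(permKV g v) -!(elem_br _ _ gG).
  by rewrite -{1}(elem0 gG) (inj_eq perm_inj).
have ge0 u t : u \in Phi -> t \in Phi -> u != t -> 0 <= ip u t ->
    ip u t = 1 \/ ip u t = 0.
  move=> uP tP ut; case: (ipP uP tP) => [eut|||| _] h; last 4 first.
  - by left.
  - by right.
  - by exfalso; ip_lra.
  - by exfalso; ip_lra.
  by rewrite eut eqxx in ut.
have lt0 u t : u \in Phi -> t \in Phi -> ip u t < 0 ->
    ip u t = -1 \/ (ip u t = -2 /\ t = - u).
  move=> uP tP; case: (ipP uP tP) => [_|||| ->] h; last 2 first.
  - by left.
  - by right.
  - by exfalso; ip_lra.
  - by exfalso; ip_lra.
  - by exfalso; ip_lra.
have [ge|lt] := leP 0 (ip a b).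
  have ge' : 0 <= ip a' b' by rewrite -Bq.
  have [ab|ab] := eqVneq a b.
    by move: A; rewrite ab eqxx => /esym/eqP ->; rewrite !ip_root.
  have ab' : a' != b' by rewrite -A.
  have [E|E] := ge0 _ _ aP bP ab ge; have [E'|E'] := ge0 _ _ aP' bP' ab' ge'.
  - by rewrite E E'.
  - by case: (not_rank_two_root aP' bP' E'); apply: C.1; apply: rank_two_root.
  - by case: (not_rank_two_root aP bP E); apply: C.2; apply: rank_two_root.
  - by rewrite E E'.
have lt' : ip a' b' < 0 by rewrite ltNge -Bq -ltNge.
have [E|[E ba]] := lt0 _ _ aP bP lt; have [E'|[E' ba']] := lt0 _ _ aP' bP' lt'.
- by rewrite E E'.
- by case: (not_toral_root aP bP E); apply: D.2; rewrite ba'; apply: toral_root.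
- by case: (not_toral_root aP' bP' E'); apply: D.1; rewrite ba; apply: toral_root.
- by rewrite E E'.
Qed.

(** Triple angle: with [c = cos x], the second hypothesis becomes [(c + 1) (2c - 1)^2 = 0]. *)
Lemma cos_third (x : R) : 0 < cos x -> cos (x + (x + x)) = -1 -> cos x = 1 / 2.
Proof.
have := cos2Dsin2 x; rewrite !(cosD, sinD).
move: (cos x) (sin x) => c t h1 c0 h2.
have h3 : (c + 1) * (2 * c - 1) ^+ 2 = 0.
  have t2 : t ^+ 2 = 1 - c ^+ 2 by rewrite -h1 addrAC subrr add0r.
  have : c * (c * c - t * t) - t * (t * c + c * t) + 1 = 0 by rewrite h2 addNr.
  have -> : c * (c * c - t * t) - t * (t * c + c * t) + 1 =
            c ^+ 3 - 3 * c * t ^+ 2 + 1 by ring.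
  by rewrite t2 => <-; ring.
by move/eqP: h3; rewrite mulf_eq0 sqrf_eq0 => /orP[]/eqP; lra.
Qed.

Lemma cos_pi3 : cos (pi / 3) = 1 / 2 :> R.
Proof.
have p0 := pi_gt0 R; apply: cos_third.
  by apply: cos_gt0_pihalf; apply/andP; split; lra.
by rewrite (_ : _ + _ = pi) ?cospi //; field.
Qed.

Lemma acos_half : acos (1 / 2) = pi / 3 :> R.
Proof.
have p0 := pi_gt0 R.
by rewrite -cos_pi3 cosK // in_itv /=; apply/andP; split; lra.
Qed.

Lemma acos_halfN : acos (- (1 / 2)) = 2 * pi / 3 :> R.
Proof. by rewrite acosN ?acos_half; [|apply/andP; split]; lra. Qed.

Lemma dot_root a : a \in Phi -> dot a a = 2 * half_norm Pi.
Proof.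
move=> aP; have := ip_root aP; rewrite /Defs.dot.
by move=> <-; rewrite divfK // gt_eqF // half_norm_gt0.
Qed.

Lemma angleE a b : a \in Phi -> b \in Phi -> angle a b = acos (ip a b / 2).
Proof.
move=> aP bP; rewrite /angle !dot_root // -expr2 sqr_sqrtr; last first.
  by rewrite mulr_ge0 // ltW // half_norm_gt0.
by rewrite /ip invfM [_^-1 * _]mulrC mulrA.
Qed.

Lemma ip_bound a b : a \in Phi -> b \in Phi -> ip a b / 2 \in `[(-1 : R), 1].
Proof.
by move=> aP bP; rewrite in_itv /=; case: (ipP aP bP) => *; apply/andP; split; lra.
Qed.

Lemma angle_eq a b t : a \in Phi -> b \in Phi -> t / 2 \in `[(-1 : R), 1] ->
  (angle a b == acos (t / 2)) = (ip a b == t).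
Proof.
move=> aP bP tb; rewrite angleE //; apply/eqP/eqP => [|-> //].
by move/(congr1 cos); rewrite !acosK ?ip_bound //; lra.
Qed.

Lemma mem_Phi_1 (d a : Phi) : (a \in Phi_1 d) = (ip (val a) (val d) == 1).
Proof.
rewrite inE -acos_half angle_eq ?fsvalP // in_itv /=.
by apply/andP; split; lra.
Qed.

Lemma mem_Phi_0 (d a : Phi) : (a \in Phi_0 d) = (ip (val a) (val d) == 0).
Proof.
rewrite inE /ip mulf_eq0 invr_eq0 [half_norm _ == 0]gt_eqF ?orbF //.
exact: half_norm_gt0.
Qed.

Local Notation G := (@chev_group R n Phi Pi N K).

(** A line over two elements has a single nonzero vector, so conjugating lines amounts to
    conjugating vectors. *)
Lemma lineE y : line y = [set (0 : V)] :|: [set y].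
Proof.
apply/setP => z; rewrite !inE; apply/existsP/orP => [[t /forallP h]|].
  have -> : z = cscale t y by apply/ffunP => b; rewrite cscaleE (eqP (h b)).
  by have [->|->] := K01 t; rewrite ?cscale0 ?cscale1 eqxx; [left|right].
by case=> /eqP ->; [exists 0|exists 1]; apply/forallP => b;
  rewrite ?ffunE ?mul0r ?mul1r.
Qed.

Lemma line_root g y a : g \in G -> a \in Phi -> (g @: line y = line (e a)) <-> g y = e a.
Proof.
move=> gG aP; rewrite !lineE imsetU !imset_set1 (elem0 gG); split=> [h|->//].
have : e a \in [set (0 : V)] :|: [set g y] by rewrite h !inE eqxx orbT.
by rewrite !inE (negPf (e_neq0 aP)) => /eqP.
Qed.

Lemma has_angleP y z phi : has_angle Pi N y z phi <->
  exists a b g, [/\ a \in Phi, b \in Phi, g \in G & g y = e a /\ g z = e b /\ angle a b = phi].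
Proof.
split=> [[a [b [g [gG ya zb ab]]]]|[a [b [g [aP bP gG [ya [zb ab]]]]]]].
  exists (val a), (val b), g; split; rewrite ?fsvalP //; split.
    by apply/(line_root y gG (fsvalP a)).
  by split=> //; apply/(line_root z gG (fsvalP b)).
exists [` aP]%fset, [` bP]%fset, g; split=> //.
  exact/(line_root y gG aP).
exact/(line_root z gG bP).
Qed.

(** [has_angle] is existential; this makes it single valued. Two conjugations of the pair to root
    vectors differ by a group element, and [ip_invariant] applies to that element. *)
Lemma has_angle_root g y z a b phi : g \in G -> a \in Phi -> b \in Phi ->
  g y = e a -> g z = e b -> has_angle Pi N y z phi <-> phi = acos (ip a b / 2).
Proof.
move=> gG aP bP ya zb; rewrite -angleE //; split=> [|->]; last first.
  by apply/has_angleP; exists a, b, g.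
move=> /has_angleP[a' [b' [h [aP' bP' hG [ya' [zb' <-]]]]]].
rewrite !angleE //; congr (acos (_ / _)).
apply: (@ip_invariant [set: Phi] (h^-1 * g)%g) => //; first by rewrite groupM ?groupV.
  by rewrite permM -ya' permK.
by rewrite permM -zb' permK.
Qed.

Lemma has_angle_conj g y z phi : g \in G ->
  has_angle Pi N (g y) (g z) phi <-> has_angle Pi N y z phi.
Proof.
move=> gG; split=> /has_angleP[a [b [h [aP bP hG [ya [zb ab]]]]]]; apply/has_angleP.
  by exists a, b, (g * h)%g; rewrite !permM groupM.
by exists a, b, (g^-1 * h)%g; rewrite !permM !permK groupM ?groupV.
Qed.

(** * Transitivity on frames *)

Variable delta : Phi.
Hypothesis deltaP : maximal_root Pi delta.
Local Notation d := (val delta).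
Local Notation G0 := (G_0 Pi N K delta).
Local Notation Phi1 a := (a \in Phi /\ ip a d = 1).

Lemma ip_delta : ip d d = 2.
Proof. exact: ip_root (fsvalP delta). Qed.

Lemma ex_frame l : Phi1 l ->
  (exists2 m, Phi1 m & ip m l = 0) /\
  forall m, Phi1 m -> ip m l = 0 ->
  (exists2 v, Phi1 v & ip v l = 0 /\ ip v m = 0) /\
  forall v, Phi1 v -> ip v l = 0 -> ip v m = 0 ->
  exists2 e, Phi1 e & [/\ ip e l = 0, ip e m = 1 & ip e v = 1].
Proof.
move=> [lP ld].
have dmax a : a \in Phi -> nonneg_comb Pi (d - a) by move=> aP; apply: (deltaP [` aP]%fset).
have [[m mP [md ml]] h] := ex_orth_frame (fsvalP delta) dmax lP ld.
split=> [|{mP md ml}m [mP md] ml]; first by exists m.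
have [[v vP [vd vl vm]] h'] := h m mP md ml.
split=> [|{vP vd vl vm}v [vP vd] vl vm]; first by exists v.
by have [u uP [ud ul um uv]] := h' v vP vd vl vm; exists u.
Qed.

Lemma eq_delta a : a \in Phi -> ip a d = 2 -> a = d.
Proof. by move=> aP; apply: ip_eq2 (fsvalP delta). Qed.

Lemma Phi1_opposite a b : Phi1 a -> Phi1 b -> ip a b = -1 -> a + b = d.
Proof.
by move=> [aP ad] [bP bd] ab; apply: eq_delta; [apply: root_add | ip_lra].
Qed.

Lemma Phi1_compl a : Phi1 a -> Phi1 (d - a).
Proof.
move=> [aP ad]; have dd := ip_delta; have da : ip d a = 1 by rewrite ipC.
by split; [apply: root_sub => //; apply: fsvalP | ip_lra].
Qed.

(** [d - a], [d - a - b] and [d - a - b - c] are roots in turn, and the last one has product -1 with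
    [d]. *)
Lemma frame3_root a b c : Phi1 a -> Phi1 b -> Phi1 c ->
  ip a b = 0 -> ip a c = 0 -> ip b c = 0 -> Phi1 (d + d - a - b - c).
Proof.
move=> [aP ad] [bP bd] [cP cd] ab ac bc; have dd := ip_delta.
have dP := fsvalP delta.
have da : ip d a = 1 by rewrite ipC.
have db : ip d b = 1 by rewrite ipC.
have dc : ip d c = 1 by rewrite ipC.
have h1 : d - a \in Phi by apply: root_sub.
have h2 : d - a - b \in Phi by apply: root_sub => //; ip_lra.
have h3 : d - a - b - c \in Phi by apply: root_sub => //; ip_lra.
split; last by ip_lra.
have -> : d + d - a - b - c = d + (d - a - b - c) by rewrite -!addrA.
by apply: root_add => //; ip_lra.
Qed.

(** The product of [2d - a - b - c] with [f] is 2, so the two roots coincide: a frame of three has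
    exactly one completion, and frames stop at four. *)
Lemma frame4_sum a b c f : Phi1 a -> Phi1 b -> Phi1 c -> Phi1 f ->
  ip a b = 0 -> ip a c = 0 -> ip b c = 0 ->
  ip a f = 0 -> ip b f = 0 -> ip c f = 0 -> d + d - a - b - c = f.
Proof.
move=> a1 b1 c1 [fP fd] ab ac bc af bf cf.
have [qP _] := frame3_root a1 b1 c1 ab ac bc.
apply: ip_eq2 => //.
by have df : ip d f = 1; [rewrite ipC | ip_lra].
Qed.

Lemma mem_G0 c : c \in Phi -> ip c d = 0 -> pX c \in G0.
Proof.
move=> cP cd; rewrite -[c]/(val [` cP]%fset); apply: mem_pX.
by rewrite mem_Phi_0 cd.
Qed.

(** Beyond permuting the root vectors of [V_1], the map [w] is additive and fixes [d], so that it
    also controls the images of [d - a] and [2d - a - b - c]. *)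
Definition acts_as (g : {perm V}) (w : 'rV[R]_n -> 'rV[R]_n) : Prop :=
  [/\ g \in G0, forall u v, w (u - v) = w u - w v,
      forall u v, ip (w u) (w v) = ip u v, w d = d
    & forall a, Phi1 a -> Phi1 (w a) /\ g (e a) = e (w a)].

Lemma acts_as1 : acts_as 1%g id.
Proof. by split=> [|u v|u v||a a1] //; rewrite ?group1 ?perm1. Qed.

Lemma acts_asM g h w k : acts_as g w -> acts_as h k -> acts_as (g * h)%g (k \o w).
Proof.
move=> [gG gB gi gd gP] [hG hB hi hd hP]; split=> [|u v|u v||a aP] /=.
- by rewrite groupM.
- by rewrite gB hB.
- by rewrite hi gi.
- by rewrite gd hd.
- by have [wP ga] := gP a aP; have [kP ha] := hP _ wP; rewrite permM ga.
Qed.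

Definition reflection (c u : 'rV[R]_n) := u - ip u c *: c.

(** The usual representative of a reflection of the Weyl group; no signs appear over two
    elements. *)
Lemma acts_as_reflection c : c \in Phi -> ip c d = 0 ->
  acts_as (pX c * pX (- c) * pX c)%g (reflection c).
Proof.
move=> cP cd; have cN := opp_root cP; have cc := ip_root cP.
have dc : ip d c = 0 by rewrite ipC.
split=> [|u v|u v||a [aP ad]].
- by rewrite !groupM ?mem_G0 // ipNl cd oppr0.
- by rewrite /reflection ipDl ipNl scalerBl !opprB addrACA [RHS]addrACA [- v + _]addrC.
- by rewrite /reflection !ip_lin cc (ipC Pi c v); ring.
- by rewrite /reflection dc scale0r subr0.
have ca := ipC Pi c a.
have ra : Phi1 (reflection c a).
  split; last by rewrite /reflection !ip_lin cd mulr0 subr0.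
  by have [_ _ _ h _] := rootsP; have := h c a cP aP; rewrite dot_coroot.
split=> //; rewrite !permM !pXE /reflection.
case E: (ip a c) / (ipP aP cP) => [h|||| h].
- by exfalso; move: ad; rewrite h cd; ip_lra.
- rewrite scale1r.
  have acP : a - c \in Phi by apply: root_sub.
  have h1 : 0 <= ip c a by ip_lra.
  have h2 : ip (- c) a = -1 by ip_lra.
  have h3 : ip c (a - c) = -1 by ip_lra.
  rewrite (xr_fix cP aP h1) (xr_add cN aP h2) xrD (xr_fix cP aP h1).
  rewrite [- c + a]addrC (xr_add cP acP h3) [c + _]addrC subrK.
  by rewrite [_ + (_ + _)]addrC ffun_addrK.
- by rewrite scale0r subr0 !xr_fix // ?ipNl ?ca ?E ?oppr0.
- rewrite scaleN1r opprK.
  have acP : a + c \in Phi by apply: root_add.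
  have h1 : ip c a = -1 by ip_lra.
  have h2 : 0 <= ip (- c) a by ip_lra.
  have h3 : ip (- c) (a + c) = -1 by ip_lra.
  have h4 : 0 <= ip c (a + c) by ip_lra.
  rewrite (xr_add cP aP h1) [xr (- c) (_ + _)]xrD (xr_fix cN aP h2) [c + a]addrC (xr_add cN acP h3).
  rewrite [- c + _]addrC addrK [e a + _]addrC ffun_addrK.
  exact: xr_fix.
- by exfalso; have : ip c d = 0 := cd; rewrite h ipNl ad; ip_lra.
Qed.

(** The root [b - a] lies in [Phi_0], and its reflection exchanges [a] and [b]. *)
Lemma acts_adjacent a b : Phi1 a -> Phi1 b -> ip a b = 1 ->
  exists g w, [/\ acts_as g w, w a = b & forall p, ip p a = ip p b -> w p = p].
Proof.
move=> [aP ad] [bP bd] ab; have aa := ip_root aP.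
have ba : ip b a = 1 by rewrite ipC.
have cP : b - a \in Phi by apply: root_sub.
exists (pX (b - a) * pX (- (b - a)) * pX (b - a))%g, (reflection (b - a)).
split; first by apply: acts_as_reflection => //; ip_lra.
  rewrite /reflection ipDr ipNr ab aa; have -> : 1 - 2 = -1 :> R by ring.
  by rewrite scaleN1r opprK addrC subrK.
by move=> p pab; rewrite /reflection ipDr ipNr pab subrr scale0r subr0.
Qed.

Lemma acts_through a b c : Phi1 a -> Phi1 b -> Phi1 c -> ip c a = 1 -> ip c b = 1 ->
  exists g w, [/\ acts_as g w, w a = b &
    forall p, ip p a = ip p c -> ip p c = ip p b -> w p = p].
Proof.
move=> a1 b1 c1 ca cb.
have [|g [w [gw wa wp]]] := acts_adjacent a1 c1; first by rewrite ipC.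
have [|h [k [hk kc kp]]] := acts_adjacent c1 b1; first by [].
exists (g * h)%g, (k \o w); split; first exact: acts_asM.
  by rewrite /= wa.
by move=> p h1 h2; rewrite /= wp // kp.
Qed.

Lemma Phi1_orth_not_compl a b p : Phi1 a -> Phi1 b -> Phi1 p ->
  ip p a = 0 -> ip p b = 0 -> ip a b = -1 -> False.
Proof.
move=> a1 b1 [pP pd] pa pb ab; have E := Phi1_opposite a1 b1 ab.
by move: pd; rewrite -E ipDr pa pb; ip_lra.
Qed.

Lemma Phi1_not_opp a b : Phi1 a -> Phi1 b -> b = - a -> False.
Proof. by move=> [_ ad] [_ bd] ba; move: bd; rewrite ba ipNl ad; ip_lra. Qed.

Lemma acts_trans1 a b : Phi1 a -> Phi1 b -> exists g w, acts_as g w /\ w a = b.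
Proof.
have orth a' b' : Phi1 a' -> Phi1 b' -> ip a' b' = 0 ->
    exists g w, acts_as g w /\ w a' = b'.
  move=> a1 b1 ab; have ba : ip b' a' = 0 by rewrite ipC.
  (* Orthogonal roots are joined through a common neighbour [c], obtained from the frame made of a
     third root [v], [a'] and [b']. *)
  have [_ /(_ b' b1 ba)[[v v1 [va vb]] _]] := ex_frame a1.
  have av : ip a' v = 0 by rewrite ipC.
  have bv : ip b' v = 0 by rewrite ipC.
  have [_ /(_ a' a1 av)[_ /(_ b' b1 bv ba)[c c1 [_ ca cb]]]] := ex_frame v1.
  by have [g [w [gw wa _]]] := acts_through a1 b1 c1 ca cb; exists g, w.
move=> a1 b1; case E: (ip a b) / (ipP a1.1 b1.1) => [->|||| ba].
- by exists 1%g, id; split=> //; apply: acts_as1.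
- by have [g [w [gw wa _]]] := acts_adjacent a1 b1 E; exists g, w.
- exact: orth.
(* Here [b = d - a], and any [m] orthogonal to [a] has product 1 with [b]. *)
- have [[m m1 ma] _] := ex_frame a1.
  have am : ip a m = 0 by rewrite ipC.
  have [g [w [gw wa]]] := orth a m a1 m1 am.
  have [|h [k [hk km _]]] := acts_adjacent m1 b1.
    have [_ md] := m1; move: md.
    by rewrite -(Phi1_opposite a1 b1 E) ipDr ma add0r.
  exists (g * h)%g, (k \o w); split; first exact: acts_asM.
  by rewrite /= wa.
- by case: (Phi1_not_opp a1 b1 ba).
Qed.

Lemma acts_trans2 p a b : Phi1 p -> Phi1 a -> Phi1 b -> ip p a = 0 -> ip p b = 0 ->
  exists g w, [/\ acts_as g w, w a = b & w p = p].
Proof.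
move=> p1 a1 b1 pa pb; case E: (ip a b) / (ipP a1.1 b1.1) => [->|||| ba].
- by exists 1%g, id; split=> //; apply: acts_as1.
- have [g [w [gw wa wp]]] := acts_adjacent a1 b1 E; exists g, w; split=> //.
  by apply: wp; rewrite pa pb.
- have ap : ip a p = 0 by rewrite ipC.
  have bp : ip b p = 0 by rewrite ipC.
  have ba : ip b a = 0 by rewrite ipC.
  have [_ /(_ a a1 ap)[_ /(_ b b1 bp ba)[c c1 [cp ca cb]]]] := ex_frame p1.
  have [g [w [gw wa wp]]] := acts_through a1 b1 c1 ca cb; exists g, w; split=> //.
  by apply: wp; rewrite ?pa ?pb ipC.
- by case: (Phi1_orth_not_compl a1 b1 p1 pa pb E).
- by case: (Phi1_not_opp a1 b1 ba).
Qed.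

Lemma acts_trans3 p q a b : Phi1 p -> Phi1 q -> Phi1 a -> Phi1 b ->
  ip p q = 0 -> ip p a = 0 -> ip p b = 0 -> ip q a = 0 -> ip q b = 0 ->
  exists g w, [/\ acts_as g w, w a = b, w p = p & w q = q].
Proof.
move=> p1 q1 a1 b1 pq pa pb qa qb.
case E: (ip a b) / (ipP a1.1 b1.1) => [->|||| ba].
- by exists 1%g, id; split=> //; apply: acts_as1.
- have [g [w [gw wa wp]]] := acts_adjacent a1 b1 E; exists g, w; split=> //.
    by apply: wp; rewrite pa pb.
  by apply: wp; rewrite qa qb.
- have ap : ip a p = 0 by rewrite ipC.
  have bp : ip b p = 0 by rewrite ipC.
  have ba : ip b a = 0 by rewrite ipC.
  have [_ /(_ a a1 ap)[_ /(_ b b1 bp ba)[c c1 [cp ca cb]]]] := ex_frame p1.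
  (* In the orthogonal case [q] completes the frame, so its product with the intermediate root [c]
     is 2 - 0 - 1 - 1 = 0: the move fixes [q] automatically. *)
  have qE : d + d - p - a - b = q.
    by apply: frame4_sum => //; rewrite ipC.
  have qc : ip q c = 0.
    have [_ cd] := c1; rewrite ipC -qE !ip_lin cp ca cb cd; ring.
  have [g [w [gw wa wp]]] := acts_through a1 b1 c1 ca cb; exists g, w; split=> //.
    by apply: wp; rewrite ?pa ?pb ipC.
  by apply: wp; rewrite ?qa ?qb qc.
- by case: (Phi1_orth_not_compl a1 b1 p1 pa pb E).
- by case: (Phi1_not_opp a1 b1 ba).
Qed.

Lemma frame_trans a1 a2 a3 b1 b2 b3 :
  Phi1 a1 -> Phi1 a2 -> Phi1 a3 -> Phi1 b1 -> Phi1 b2 -> Phi1 b3 ->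
  ip a1 a2 = 0 -> ip a1 a3 = 0 -> ip a2 a3 = 0 ->
  ip b1 b2 = 0 -> ip b1 b3 = 0 -> ip b2 b3 = 0 ->
  exists g w, [/\ acts_as g w, w a1 = b1, w a2 = b2 & w a3 = b3].
Proof.
move=> A1 A2 A3 B1 B2 B3 a12 a13 a23 b12 b13 b23.
have [g1 [w1 [g1w w1a]]] := acts_trans1 A1 B1.
have [_ _ w1i _ w1P] := g1w.
have [C2 _] := w1P _ A2.
have [|g2 [w2 [g2w w2a w2b]]] := acts_trans2 B1 C2 B2 _ b12; first by rewrite -w1a w1i.
have [_ _ w2i _ w2P] := g2w.
have [C3 _] := w2P _ (w1P _ A3).1.
have [||g3 [w3 [g3w w3a w3b w3c]]] := acts_trans3 B1 B2 C3 B3 b12 _ b13 _ b23.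
- by rewrite -{1}w2b w2i -w1a w1i.
- by rewrite -{1}w2a w2i w1i.
exists (g1 * g2 * g3)%g, (w3 \o (w2 \o w1)).
split; first by do 2?apply: acts_asM.
- by rewrite /= w1a w2b.
- by rewrite /= w2a.
- by rewrite /= w3a.
Qed.

(** * Normal forms in V_1 *)

Local Notation V1 := (V_1 K delta).

Lemma V1P x : reflect ((forall i, x (inr i) = 0) /\
    forall c, c \in Phi -> ip c d != 1 -> co x c = 0) (x \in V1).
Proof.
rewrite inE; apply: (iffP forallP) => [h|[h1 h2] [c|i]].
- split=> [i|c cP cd]; first by apply/eqP; have := h (inr i); rewrite implybF negbK.
  rewrite -[c]/(val [` cP]%fset) root_coordE; apply/eqP.
  by have := h (inl [` cP]%fset); rewrite mem_Phi_1 (negPf cd) implybF negbK.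
- rewrite mem_Phi_1; case: (ip _ _ =P 1) => [_|/eqP cd]; first by rewrite implybT.
  by rewrite -root_coordE h2 ?fsvalP // eqxx.
- by rewrite h1 eqxx.
Qed.

Lemma G0_stable_V1 g x : g \in G0 -> x \in V1 -> g x \in V1.
Proof.
move=> gG; elim/elementary_ind: gG x => [|a aS|h k hP kP] x xV.
- by rewrite perm1.
- have ad : ip (val a) d = 0 by move: aS; rewrite mem_Phi_0 => /eqP.
  have aP := fsvalP a; rewrite pXE; have /V1P[xi xc] := xV; apply/V1P.
  have x0 c : c \in Phi -> ip c d = 0 -> co x c = 0.
    by move=> cP cd; apply: xc; rewrite // cd lt_eqF.
  split=> [i|c cP cd].
    by rewrite cart_xr // xi x0 ?opp_root ?ipNl ?ad ?oppr0 // mul0r addr0.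
  have [ca|ca] := eqVneq c (val a).
    rewrite ca co_xr_diag // x0 // x0 ?opp_root ?ipNl ?ad ?oppr0 //.
    by rewrite /cartan_eval big1 ?addr0 // => i _; rewrite xi mul0r.
  rewrite co_xr // xc // add0r.
  have [caP|caP] := boolP (c - val a \in Phi); last by rewrite root_coord_notin.
  by rewrite xc // ipDl ipNl ad subr0.
- by rewrite permM; apply: kP; apply: hP.
Qed.

Definition equivalent x y : Prop := exists2 g, g \in G0 & g x = y.

Lemma equivalent_refl x : equivalent x x.
Proof. by exists 1%g; rewrite ?group1 ?perm1. Qed.

Lemma equivalent_sym x y : equivalent x y -> equivalent y x.
Proof. by case=> g gG <-; exists g^-1%g; rewrite ?groupV ?permK. Qed.

Lemma equivalent_trans x y z : equivalent x y -> equivalent y z -> equivalent x z.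
Proof.
by case=> g gG <- [h hG <-]; exists (g * h)%g; rewrite ?groupM ?permM.
Qed.

Lemma equivalent_xr c x : c \in Phi -> ip c d = 0 -> equivalent x (xr c x).
Proof. by move=> cP cd; exists (pX c); rewrite ?mem_G0 ?pXE. Qed.

Lemma equivalent_V1 x y : equivalent x y -> x \in V1 -> y \in V1.
Proof. by case=> g gG <-; apply: G0_stable_V1. Qed.

(* The coordinate at [d - f1] cannot be removed. *)
Definition cleared f1 (fs : seq 'rV[R]_n) x : Prop :=
  (forall f, f \in fs -> co x f = 1) /\
  (forall a f, Phi1 a -> a != d - f1 -> f \in fs -> ip a f = 1 -> co x a = 0).

Definition frame (fs : seq 'rV[R]_n) : Prop :=
  (forall f, f \in fs -> Phi1 f) /\
  (forall f f', f \in fs -> f' \in fs -> f != f' -> ip f f' = 0).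

(** Each offending [b] adjacent to [f] is removed by [x_(b-f)(1)]. Both [b] and [f] are orthogonal
    to the old pivots, so shifting by [b - f] preserves the products with them and undoes none of
    the earlier clearing. *)
Lemma clear_step f1 fs f x : frame fs -> (fs == [::]) || (f1 \in fs) ->
  Phi1 f -> (forall f', f' \in fs -> ip f f' = 0) -> co x f = 1 ->
  x \in V1 -> cleared f1 fs x ->
  exists y, [/\ equivalent x y, y \in V1 & cleared f1 (f :: fs) y].
Proof.
move=> [fs1 fso] f1fs [fP fd] fo xf xV xC; have ff := ip_root fP.
(* The list [r] holds the roots already treated; the induction adds one at a time. *)
suff step (r : seq 'rV[R]_n) : exists y, [/\ equivalent x y, y \in V1, cleared f1 fs y,
    co y f = 1 & forall a, a \in r -> Phi1 a -> a != d - f1 -> ip a f = 1 -> co y a = 0].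
  have [y [xy yV [y1 y0] yf yr]] := step (enum_fset Phi); exists y; split=> //; split.
    by move=> f'; rewrite inE => /orP[/eqP -> //|/y1].
  move=> a f' aP ad; rewrite inE => /orP[/eqP -> af|f's af]; last exact: y0 aP ad f's af.
  by apply: yr => //; case: aP.
elim: r => [|b r [y [xy yV yC yf yr]]]; first by exists x; split=> //; apply: equivalent_refl.
have [yb0|yb] := eqVneq (co y b) 0.
  exists y; split=> // a; rewrite inE => /orP[/eqP -> //|]; exact: yr.
have [bP|bP] := boolP (b \in Phi); last by rewrite root_coord_notin ?eqxx in yb.
have [bd|bd] := eqVneq (ip b d) 1; last first.
  exists y; split=> // a; rewrite inE => /orP[/eqP -> [_ /eqP h]|]; last exact: yr.
  by rewrite h in bd.
have [b1|b1] := eqVneq b (d - f1).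
  exists y; split=> // a; rewrite inE => /orP[/eqP -> _ /eqP //|]; exact: yr.
have [bf|bf] := eqVneq (ip b f) 1; last first.
  exists y; split=> // a; rewrite inE => /orP[/eqP -> _ _ /eqP h|]; last exact: yr.
  by rewrite h in bf.
have [y1 y0] := yC; have {}yb : co y b = 1 by case: (K01 (co y b)) yb => ->; rewrite ?eqxx.
have bb := ip_root bP; have fb : ip f b = 1 by rewrite ipC.
have cP : b - f \in Phi by apply: root_sub.
have cd : ip (b - f) d = 0 by ip_lra.
(* Product 1 with an old pivot contradicts [cleared]. Product -1 means [b = d - f'] with [f'] other
   than [f1]; such a root is adjacent to [f1] and was cleared as well. *)
have bfs f' : f' \in fs -> ip b f' = 0.
  move=> f's; have [f'P f'd] := fs1 _ f's.
  case E: (ip b f') / (ipP bP f'P) => [bE|||| bE] //; exfalso.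
  - by have := fo _ f's; rewrite -bE; ip_lra.
  - have := y0 b f' (conj bP bd) b1 f's E; rewrite yb => /eqP.
    by rewrite oner_eq0.
  - have bE : b = d - f' by rewrite -(Phi1_opposite (conj bP bd) (conj f'P f'd) E) addrK.
    have f1s : f1 \in fs by case/orP: f1fs => // /eqP fs0; rewrite fs0 in f's.
    have [f1P f1d] := fs1 _ f1s.
    have f'1 : f' != f1 by apply: contraNneq b1 => <-; rewrite bE.
    have bf1 : ip b f1 = 1.
      by have df1 : ip d f1 = 1; [rewrite ipC | rewrite bE ipDl ipNl (fso f' f1) // df1 subr0].
    have := y0 b f1 (conj bP bd) b1 f1s bf1; rewrite yb => /eqP.
    by rewrite oner_eq0.
  - by move: f'd; rewrite bE ipNl bd; ip_lra.
have ne a : ip a d = 1 -> a != b - f by move=> ad; apply: (neq_ip (c := d)); ip_lra.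
have z_coord a : Phi1 a -> co (xr (b - f) y) a = co y a + co y (a - (b - f)).
  by move=> [aP ad]; apply: co_xr => //; apply: ne.
exists (xr (b - f) y); split.
- by apply: equivalent_trans xy _; apply: equivalent_xr.
- by apply: equivalent_V1 yV; apply: equivalent_xr.
- split=> [f' f's|a f' [aP ad] a1 f's af'].
    have [f'P f'd] := fs1 _ f's; rewrite z_coord // y1 // root_coord_notin ?addr0 //.
    apply/negP => h; have := root_sub_ip f'P cP h.
    by rewrite ipDr ipNr (ipC Pi f' b) (ipC Pi f' f) bfs // fo //; ip_lra.
  rewrite z_coord // (y0 a f') // add0r.
  have [aP'|] := boolP (a - (b - f) \in Phi); last by apply: root_coord_notin.
  have ac := root_sub_ip aP cP aP'.
  apply: (y0 _ f') => //.
  + by split=> //; ip_lra.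
  (* The exempted root is not hit: [d - f1] has product 0 with [b - f], whereas [a - (b - f)] has
     product -1 with it. *)
  + have f1s : f1 \in fs by case/orP: f1fs => // /eqP fs0; rewrite fs0 in f's.
    have f1b : ip f1 b = 0 by rewrite ipC bfs.
    have f1f : ip f1 f = 0 by rewrite ipC fo.
    have cc := ip_root cP.
    apply: (neq_ip (c := b - f)); rewrite ipDl ipNl ac cc.
    by rewrite [ip (_ - f1) _]ipDl ipNl (ipC Pi d) cd ipDr ipNr f1b f1f; ip_lra.
  + by rewrite !ip_lin af' bfs // fo // opprD !oppr0 !addr0.
- rewrite z_coord // yf root_coord_notin ?addr0 //.
  by apply/negP => h; have := root_sub_ip fP cP h; rewrite ipDr ipNr fb ff; ip_lra.
move=> a ar [aP ad] a1 af; rewrite z_coord //.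
have [->|ab] := eqVneq a b.
  have -> : b - (b - f) = f by rewrite opprB addrC subrK.
  by rewrite yb yf K_addrr.
have ar' : a \in r by move: ar; rewrite inE (negPf ab).
rewrite yr // add0r; have [aP'|] := boolP (a - (b - f) \in Phi); last by apply: root_coord_notin.
have E : a - (b - f) = f by apply: ip_eq2 => //; ip_lra.
by case/eqP: ab; rewrite -[a](subrK (b - f)) E addrC subrK.
Qed.

Lemma co_sum (fs : seq 'rV[R]_n) c : (forall f, f \in fs -> f \in Phi) -> uniq fs ->
  co (\sum_(f <- fs) e f) c = (c \in fs)%:R.
Proof.
elim: fs => [|f fs IHfs] /= fP; first by rewrite big_nil root_coord0.
case/andP=> ffs fsu; rewrite big_cons root_coordD co_e ?fP ?mem_head //.
rewrite IHfs // => [|f' f's]; last by rewrite fP // inE f's orbT.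
rewrite inE; have [->|cf] := eqVneq c f; first by rewrite (negPf ffs) addr0.
by rewrite add0r.
Qed.

Lemma cart_sum (fs : seq 'rV[R]_n) i : (\sum_(f <- fs) e f : V) (inr i) = 0.
Proof.
elim: fs => [|f fs IHfs]; first by rewrite big_nil ffunE.
by rewrite big_cons ffun_addE IHfs vec_cart addr0.
Qed.

(** A further root in the support is not adjacent to a pivot, and product -1 with a pivot [f] makes
    it [d - f], which is exempt or adjacent to [f1]. So it would be orthogonal to every pivot, which
    [xo] excludes. *)
Lemma cleared_normal f1 fs x : frame fs -> uniq fs -> f1 \in fs -> x \in V1 ->
  cleared f1 fs x ->
  (forall a, Phi1 a -> (forall f, f \in fs -> ip a f = 0) -> co x a = 0) ->
  x = \sum_(f <- fs) e f + cscale (co x (d - f1)) (e (d - f1)).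
Proof.
move=> [fs1 fso] fsu f1s xV [x1 x0] xo; have /V1P[xi xc] := xV.
have fsP f : f \in fs -> f \in Phi by move=> /fs1[].
have f1P := fs1 _ f1s; have [f1R f1d] := f1P; have [dfP dfd] := Phi1_compl f1P.
have f1f1 := ip_root f1R; have df1 : ip d f1 = 1 by rewrite ipC.
apply: vec_ext => [c cP|i]; last first.
  by rewrite ffun_addE cart_sum cscaleE vec_cart mulr0 addr0 xi.
rewrite root_coordD root_coordZ co_sum // co_e //.
have [cd|cd] := eqVneq (ip c d) 1; last first.
  rewrite xc // (negPf (_ : c \notin fs)); last by apply: contraNN cd => /fs1[_ ->].
  by rewrite (negPf (_ : c != _)) ?mulr0 ?addr0 //; apply: contraNneq cd => ->; apply/eqP.
have [cE|c1] := eqVneq c (d - f1).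
  rewrite mulr1 cE (negPf (_ : d - f1 \notin fs)) ?add0r //.
  have h0 : ip (d - f1) f1 = -1 by ip_lra.
  apply/negP => dfs; move: (h0); rewrite fso //; first by ip_lra.
  by apply: (neq_ip (c := f1)); ip_lra.
rewrite mulr0 addr0; have [cs|cs] := boolP (c \in fs); first exact: x1.
case: (K01 (co x c)) => // xc1; exfalso.
have xno f : f \in fs -> ip c f = 1 -> False.
  by move=> fs' cf; have := x0 c f (conj cP cd) c1 fs' cf; rewrite xc1 => /eqP; rewrite oner_eq0.
have := xo c (conj cP cd); rewrite xc1 => h.
suff c0 : forall f, f \in fs -> ip c f = 0 by have /eqP := h c0; rewrite oner_eq0.
move=> f fs'; have [fP fd] := fs1 _ fs'.
case E: (ip c f) / (ipP cP fP) => [cE|||| cE] //; exfalso.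
- by rewrite cE fs' in cs.
- exact: xno fs' E.
- have cE : c = d - f by rewrite -(Phi1_opposite (conj cP cd) (conj fP fd) E) addrK.
  have ff1 : f != f1 by apply: contraNneq c1 => <-; rewrite cE.
  by apply: (xno f1 f1s); rewrite cE ipDl ipNl df1 (fso f f1) // subr0.
- by move: fd; rewrite cE ipNl cd; ip_lra.
Qed.

Local Notation "x ~~> y" := (equivalent x y) (at level 70).

(** In [ffun_ring2 z], the argument collects the summands that cancel in pairs; what remains is an
    identity over any commutative ring. *)
Lemma char2_eq x y z : x = y + (z + z) -> x = y.
Proof. by rewrite ffun_addrr addr0. Qed.

Ltac ffun_ring := apply/ffunP => ?; rewrite !ffun_addE; ring.
Ltac ffun_ring2 z := apply: (@char2_eq _ _ z); ffun_ring.

Lemma ge0_nat (t : nat) (p : R) : p = t%:R -> 0 <= p.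
Proof. by move->; apply: ler0n. Qed.

Lemma neq_nat (t : nat) (p q : R) : p - q = t.+1%:R -> p = q -> False.
Proof. by move=> + pq; rewrite pq subrr => /eqP; rewrite eq_sym pnatr_eq0. Qed.

Lemma neq_natN (t : nat) (p q : R) : q - p = t.+1%:R -> p = q -> False.
Proof. by move=> h pq; apply: (neq_nat h); rewrite pq. Qed.

(** Signs and inequalities of products become identities with an explicit small natural number,
    found by trial. *)
Ltac ip_ring := lazymatch goal with
  | |- is_true (0 <= _) => first
      [apply: (@ge0_nat 1); ring | apply: (@ge0_nat 0); ring | apply: (@ge0_nat 2); ring]
  | |- _ -> False => first
      [apply: (@neq_nat 0); ring | apply: (@neq_natN 0); ring
      |apply: (@neq_nat 1); ring | apply: (@neq_natN 1); ring
      |apply: (@neq_nat 2); ring | apply: (@neq_natN 2); ring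
      |apply: (@neq_nat 3); ring | apply: (@neq_natN 3); ring]
  | _ => ring
  end.

(** * Explicit reductions between sums of root vectors *)

Section Reductions.
Variables f1 f2 f3 f4 : 'rV[R]_n.
Hypotheses (F1 : Phi1 f1) (F2 : Phi1 f2) (F3 : Phi1 f3) (F4 : Phi1 f4).
Hypotheses (f12 : ip f1 f2 = 0) (f13 : ip f1 f3 = 0) (f23 : ip f2 f3 = 0).
Hypotheses (f14 : ip f1 f4 = 0) (f24 : ip f2 f4 = 0) (f34 : ip f3 f4 = 0).

Let ips := (F1.2, F2.2, F3.2, F4.2, f12, f13, f23, f14, f24, f34,
  ip_root F1.1, ip_root F2.1, ip_root F3.1, ip_root F4.1, ip_delta).
Let ipCs := (ipC Pi d f1, ipC Pi d f2, ipC Pi d f3, ipC Pi d f4,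
  ipC Pi f2 f1, ipC Pi f3 f1, ipC Pi f3 f2, ipC Pi f4 f1, ipC Pi f4 f2, ipC Pi f4 f3).

Ltac ip_calc := rewrite ?ip_lin ?ip0l ?ipCs ?ips; ip_ring.
Ltac copy_roots :=
  have f1P := F1.1; have f2P := F2.1; have f3P := F3.1; have f4P := F4.1;
  have dP := fsvalP delta.

(** The root [d - f1] serves as a pivot itself: it is adjacent to [f2], and [x_(f1+f2-d)(1)] fixes
    [e f1] and [e f2]. *)
Lemma reduce_compl2 : e f1 + e f2 + e (d - f1) ~~> e f1 + e (d - f1).
Proof.
copy_roots; have [d1P _] := Phi1_compl F1.
have cP : f2 - (d - f1) \in Phi by apply: root_sub => //; ip_calc.
have cd : ip (f2 - (d - f1)) d = 0 by ip_calc.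
have E1 : xr (f2 - (d - f1)) (e f1) = e f1 by apply: xr_fix => //; ip_calc.
have E2 : xr (f2 - (d - f1)) (e f2) = e f2 by apply: xr_fix => //; ip_calc.
have E3 : xr (f2 - (d - f1)) (e (d - f1)) = e (d - f1) + e f2.
  by rewrite xr_add ?subrK //; ip_calc.
have := equivalent_xr (e f1 + e f2 + e (d - f1)) cP cd.
rewrite !xrD E1 E2 E3; congr (_ ~~> _).
by ffun_ring2 (e f2).
Qed.

(** The relation [f1 + f2 + f3 + f4 = 2d] makes this work. The first element creates [e (d - f4)]
    and [e (d - f1)]; the second carries [e (d - f1)] onto [e f3] and cancels it, leaving
    [e (d - f1) + e (d - f2)], which the third removes. *)
Lemma reduce_frame4 : e f1 + e f2 + e f3 + e f4 ~~> e f1 + e f2 + e f4.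
Proof.
copy_roots; have fsum := frame4_sum F1 F2 F3 F4 f12 f13 f23 f14 f24 f34.
have [d1P _] := Phi1_compl F1; have [d2P _] := Phi1_compl F2.
have [d4P _] := Phi1_compl F4.
have cP : d - f4 - f1 \in Phi by apply: root_sub => //; ip_calc.
have cd : ip (d - f4 - f1) d = 0 by ip_calc.
apply: equivalent_trans (equivalent_xr _ cP cd) _.
have -> : xr (d - f4 - f1) (e f1 + e f2 + e f3 + e f4) =
    e f1 + e f2 + e f3 + e f4 + e (d - f4) + e (d - f1).
  rewrite !xrD.
  rewrite (@xr_add _ f1) ?subrK //; last by ip_calc.
  rewrite (@xr_fix _ f2) //; last by ip_calc.
  rewrite (@xr_fix _ f3) //; last by ip_calc.
  rewrite (@xr_add _ f4) //; last by ip_calc.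
  by rewrite [d - f4 - f1 + f4]addrAC subrK; ffun_ring.
have {}cP : d - f4 - f2 \in Phi by apply: root_sub => //; ip_calc.
have {}cd : ip (d - f4 - f2) d = 0 by ip_calc.
apply: equivalent_trans (equivalent_xr _ cP cd) _.
have -> : xr (d - f4 - f2) (e f1 + e f2 + e f3 + e f4 + e (d - f4) + e (d - f1)) =
    e f1 + e f2 + e f4 + e (d - f2) + e (d - f1).
  rewrite !xrD.
  rewrite (@xr_fix _ f1) //; last by ip_calc.
  rewrite (@xr_add _ f2) ?subrK //; last by ip_calc.
  rewrite (@xr_fix _ f3) //; last by ip_calc.
  rewrite (@xr_add _ f4) //; last by ip_calc.
  rewrite (@xr_fix _ (d - f4)) //; last by ip_calc.
  rewrite (@xr_add _ (d - f1)) //; last by ip_calc.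
  have -> : d - f4 - f2 + (d - f1) = f3.
    rewrite -fsum; apply/rowP => i; rewrite !mxE; ring.
  by rewrite [d - f4 - f2 + f4]addrAC subrK; ffun_ring2 (e (d - f4) + e f3 : V).
have {}cP : d - f1 - f2 \in Phi by apply: root_sub => //; ip_calc.
have {}cd : ip (d - f1 - f2) d = 0 by ip_calc.
have := equivalent_xr (e f1 + e f2 + e f4 + e (d - f2) + e (d - f1)) cP cd.
congr (_ ~~> _); rewrite !xrD.
rewrite (@xr_add _ f1) //; last by ip_calc.
rewrite (@xr_add _ f2) ?subrK //; last by ip_calc.
rewrite (@xr_fix _ f4) //; last by ip_calc.
rewrite (@xr_fix _ (d - f1)) //; last by ip_calc.
rewrite (@xr_fix _ (d - f2)) //; last by ip_calc.
by rewrite [d - f1 - f2 + f1]addrAC subrK; ffun_ring2 (e (d - f1) + e (d - f2) : V).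
Qed.

(** Removing [e f2] with the pivot [d - f1] sends [f3] to [f1 + f2 + f3 - d = d - f4]. This new term
    is cleared by the pivot [f1], and then [e f3] by [d - f1]. *)
Lemma reduce_compl3 : e f1 + e f2 + e f3 + e (d - f1) ~~> e f1 + e (d - f1).
Proof.
copy_roots; have fsum := frame4_sum F1 F2 F3 F4 f12 f13 f23 f14 f24 f34.
have [d1P _] := Phi1_compl F1; have [d4P _] := Phi1_compl F4.
have cP : f2 - (d - f1) \in Phi by apply: root_sub => //; ip_calc.
have cd : ip (f2 - (d - f1)) d = 0 by ip_calc.
apply: equivalent_trans (equivalent_xr _ cP cd) _.
have -> : xr (f2 - (d - f1)) (e f1 + e f2 + e f3 + e (d - f1)) =
    e f1 + e f3 + e (d - f1) + e (d - f4).
  rewrite !xrD.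
  rewrite (@xr_fix _ f1) //; last by ip_calc.
  rewrite (@xr_fix _ f2) //; last by ip_calc.
  rewrite (@xr_add _ f3) //; last by ip_calc.
  rewrite (@xr_add _ (d - f1)) ?subrK //; last by ip_calc.
  have -> : f2 - (d - f1) + f3 = d - f4.
    by rewrite -fsum; apply/rowP => i; rewrite !mxE; ring.
  by ffun_ring2 (e f2).
have {}cP : d - f4 - f1 \in Phi by apply: root_sub => //; ip_calc.
have {}cd : ip (d - f4 - f1) d = 0 by ip_calc.
apply: equivalent_trans (equivalent_xr _ cP cd) _.
have -> : xr (d - f4 - f1) (e f1 + e f3 + e (d - f1) + e (d - f4)) =
    e f1 + e f3 + e (d - f1).
  rewrite !xrD.
  rewrite (@xr_add _ f1) ?subrK //; last by ip_calc.
  rewrite (@xr_fix _ f3) //; last by ip_calc.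
  rewrite (@xr_fix _ (d - f1)) //; last by ip_calc.
  rewrite (@xr_fix _ (d - f4)) //; last by ip_calc.
  by ffun_ring2 (e (d - f4)).
have {}cP : f3 - (d - f1) \in Phi by apply: root_sub => //; ip_calc.
have {}cd : ip (f3 - (d - f1)) d = 0 by ip_calc.
have := equivalent_xr (e f1 + e f3 + e (d - f1)) cP cd; congr (_ ~~> _); rewrite !xrD.
rewrite (@xr_fix _ f1) //; last by ip_calc.
rewrite (@xr_fix _ f3) //; last by ip_calc.
rewrite (@xr_add _ (d - f1)) ?subrK //; last by ip_calc.
by ffun_ring2 (e f3).
Qed.

End Reductions.

Lemma frame_nil : frame [::].
Proof. by []. Qed.

Lemma frame_cons f (fs : seq 'rV[R]_n) : Phi1 f -> (forall f', f' \in fs -> ip f f' = 0) ->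
  frame fs -> frame (f :: fs).
Proof.
move=> F fo [h1 h2]; split=> [f'|f' f'']; first by rewrite inE => /orP[/eqP ->|/h1].
rewrite !inE => /orP[/eqP ->|h'] /orP[/eqP ->|h''] ne.
- by rewrite eqxx in ne.
- exact: fo.
- by rewrite ipC fo.
- exact: h2.
Qed.

Lemma frame_notin f (fs : seq 'rV[R]_n) : Phi1 f ->
  (forall f', f' \in fs -> ip f f' = 0) -> f \notin fs.
Proof. by move=> [fP _] fo; apply/negP => /fo; rewrite ip_root //; ip_lra. Qed.

Lemma next_pivot (fs : seq 'rV[R]_n) x :
  (exists f, [/\ Phi1 f, forall f', f' \in fs -> ip f f' = 0 & co x f = 1]) \/
  (forall a, Phi1 a -> (forall f, f \in fs -> ip a f = 0) -> co x a = 0).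
Proof.
case: (pickP (fun a : Phi => [&& ip (val a) d == 1, co x (val a) == 1
    & all (fun f => ip (val a) f == 0) fs])) => [a /and3P[/eqP ad /eqP xa /allP ao]|h].
  left; exists (val a); split=> // [|f' /ao/eqP //].
  by split=> //; apply: fsvalP.
right=> a [aP ad] ao; have := h [` aP]%fset; rewrite /= ad eqxx /=.
have -> /= : all (fun f => ip a f == 0) fs by apply/allP => f /ao ->.
by rewrite andbT; case: (K01 (co x a)) => ->; rewrite ?eqxx.
Qed.

Lemma frame_sum_equivalent a1 a2 a3 b1 b2 b3 :
  Phi1 a1 -> Phi1 a2 -> Phi1 a3 -> Phi1 b1 -> Phi1 b2 -> Phi1 b3 ->
  ip a1 a2 = 0 -> ip a1 a3 = 0 -> ip a2 a3 = 0 ->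
  ip b1 b2 = 0 -> ip b1 b3 = 0 -> ip b2 b3 = 0 ->
  [/\ e a1 ~~> e b1, e a1 + e a2 ~~> e b1 + e b2,
      e a1 + e a2 + e a3 ~~> e b1 + e b2 + e b3,
      e a1 + e (d - a1) ~~> e b1 + e (d - b1)
    & e a1 + e (d - a1) + e a2 + e a3 + e (d + d - a1 - a2 - a3) ~~>
      e b1 + e (d - b1) + e b2 + e b3 + e (d + d - b1 - b2 - b3)].
Proof.
move=> A1 A2 A3 B1 B2 B3 a12 a13 a23 b12 b13 b23.
have [g [w [gw w1 w2 w3]]] := frame_trans A1 A2 A3 B1 B2 B3 a12 a13 a23 b12 b13 b23.
have [gG wB wi wd wP] := gw.
have g1 : g (e a1) = e b1 by rewrite -w1; case: (wP _ A1).
have g2 : g (e a2) = e b2 by rewrite -w2; case: (wP _ A2).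
have g3 : g (e a3) = e b3 by rewrite -w3; case: (wP _ A3).
have gd : g (e (d - a1)) = e (d - b1).
  by rewrite -w1 -{2}wd -wB; case: (wP _ (Phi1_compl A1)).
have g4 : g (e (d + d - a1 - a2 - a3)) = e (d + d - b1 - b2 - b3).
  have -> : d + d - b1 - b2 - b3 = w (d + d - a1 - a2 - a3).
    have w0 : w 0 = 0 by have := wB 0 0; rewrite !subrr.
    have wD t v : w (t + v) = w t + w v.
      by rewrite -{1}[v]opprK wB -[- v]sub0r wB w0 sub0r opprK.
    by rewrite !wB w1 w2 w3 wD wd.
  by case: (wP _ (frame3_root A1 A2 A3 a12 a13 a23)).
split; exists g; rewrite // ?(elemD _ _ gG) ?g1 ?g2 ?g3 ?gd ?g4 //.
Qed.

(** * Reduction of all normal forms to the list *)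

Section Representatives.
Variables l m v : 'rV[R]_n.
Hypotheses (L : Phi1 l) (M : Phi1 m) (W : Phi1 v).
Hypotheses (lm : ip l m = 0) (lv : ip l v = 0) (mv : ip m v = 0).
Local Notation u := (d + d - l - m - v).

Variant in_list x : Prop :=
  | In_zero of x = 0
  | In_sing of x ~~> e l
  | In_bril of x ~~> e l + e m
  | In_lum1 of x ~~> e l + e m + e v
  | In_lum2 of x ~~> e l + e (d - l)
  | In_dark of x ~~> e l + e (d - l) + e m + e v + e u.

Lemma in_list_equivalent x y : x ~~> y -> y != 0 -> in_list y -> in_list x.
Proof.
move=> xy y0 [h|h|h|h|h|h]; first by rewrite h eqxx in y0.
- by apply: In_sing; apply: equivalent_trans xy h.
- by apply: In_bril; apply: equivalent_trans xy h.
- by apply: In_lum1; apply: equivalent_trans xy h.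
- by apply: In_lum2; apply: equivalent_trans xy h.
- by apply: In_dark; apply: equivalent_trans xy h.
Qed.

Lemma in_list_one a1 c : Phi1 a1 -> in_list (e a1 + cscale c (e (d - a1))).
Proof.
(* Transitivity is stated for orthogonal triples, so [a1] is completed to one. *)
move=> A1; have [[a2 A2 a21] /(_ a2 A2 a21)[[a3 A3 [a31 a32]] _]] := ex_frame A1.
have a12 : ip a1 a2 = 0 by rewrite ipC.
have a13 : ip a1 a3 = 0 by rewrite ipC.
have a23 : ip a2 a3 = 0 by rewrite ipC.
have [h1 _ _ h4 _] := frame_sum_equivalent A1 A2 A3 L M W a12 a13 a23 lm lv mv.
case: (K01 c) => ->; first by rewrite cscale0 addr0; apply: In_sing.
by rewrite cscale1; apply: In_lum2.
Qed.

Lemma in_list_two a1 a2 c : Phi1 a1 -> Phi1 a2 -> ip a2 a1 = 0 ->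
  in_list (e a2 + e a1 + cscale c (e (d - a1))).
Proof.
move=> A1 A2 a21; have [_ /(_ a2 A2 a21)[[a3 A3 [a31 a32]] _]] := ex_frame A1.
have a12 : ip a1 a2 = 0 by rewrite ipC.
have a13 : ip a1 a3 = 0 by rewrite ipC.
have a23 : ip a2 a3 = 0 by rewrite ipC.
have [_ h2 _ h4 _] := frame_sum_equivalent A1 A2 A3 L M W a12 a13 a23 lm lv mv.
rewrite [e a2 + _]addrC.
case: (K01 c) => ->; first by rewrite cscale0 addr0; apply: In_bril.
rewrite cscale1; apply: In_lum2; apply: equivalent_trans h4.
have A4 := frame3_root A1 A2 A3 a12 a13 a23.
exact: reduce_compl2 A1 A2 A3 A4 a12.
Qed.

Lemma in_list_three a1 a2 a3 c : Phi1 a1 -> Phi1 a2 -> Phi1 a3 ->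
  ip a2 a1 = 0 -> ip a3 a1 = 0 -> ip a3 a2 = 0 ->
  in_list (e a3 + e a2 + e a1 + cscale c (e (d - a1))).
Proof.
move=> A1 A2 A3 a21 a31 a32.
have a12 : ip a1 a2 = 0 by rewrite ipC.
have a13 : ip a1 a3 = 0 by rewrite ipC.
have a23 : ip a2 a3 = 0 by rewrite ipC.
have [_ _ h3 h4 _] := frame_sum_equivalent A1 A2 A3 L M W a12 a13 a23 lm lv mv.
have -> : e a3 + e a2 + e a1 = e a1 + e a2 + e a3.
  by ffun_ring.
case: (K01 c) => ->; first by rewrite cscale0 addr0; apply: In_lum1.
rewrite cscale1; apply: In_lum2; apply: equivalent_trans h4.
have A4 := frame3_root A1 A2 A3 a12 a13 a23.
have [a14 a24 a34] : [/\ ip a1 (d + d - a1 - a2 - a3) = 0,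
    ip a2 (d + d - a1 - a2 - a3) = 0 & ip a3 (d + d - a1 - a2 - a3) = 0].
  have [[p1 d1] [p2 d2] [p3 d3]] := And3 A1 A2 A3.
  by split; rewrite !ip_lin ?d1 ?d2 ?d3 ?ip_root // ?a12 ?a13 ?a23 ?a21 ?a31 ?a32; lra.
exact: reduce_compl3 A1 A2 A3 A4 a12 a13 a23 a14 a24 a34.
Qed.

Lemma in_list_four a1 a2 a3 a4 c : Phi1 a1 -> Phi1 a2 -> Phi1 a3 -> Phi1 a4 ->
  ip a2 a1 = 0 -> ip a3 a1 = 0 -> ip a3 a2 = 0 ->
  ip a4 a1 = 0 -> ip a4 a2 = 0 -> ip a4 a3 = 0 ->
  in_list (e a4 + e a3 + e a2 + e a1 + cscale c (e (d - a1))).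
Proof.
move=> A1 A2 A3 A4 a21 a31 a32 a41 a42 a43.
have a12 : ip a1 a2 = 0 by rewrite ipC.
have a13 : ip a1 a3 = 0 by rewrite ipC.
have a23 : ip a2 a3 = 0 by rewrite ipC.
have a14 : ip a1 a4 = 0 by rewrite ipC.
have a24 : ip a2 a4 = 0 by rewrite ipC.
have a34 : ip a3 a4 = 0 by rewrite ipC.
have fsum := frame4_sum A1 A2 A3 A4 a12 a13 a23 a14 a24 a34.
case: (K01 c) => ->.
  rewrite cscale0 addr0; apply: In_lum1.
  have [_ _ h3 _ _] := frame_sum_equivalent A1 A2 A4 L M W a12 a14 a24 lm lv mv.
  apply: equivalent_trans h3.
  have := reduce_frame4 A1 A2 A3 A4 a12 a13 a23 a14 a24 a34; congr (_ ~~> _).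
  by ffun_ring.
have [_ _ _ _ h5] := frame_sum_equivalent A1 A2 A3 L M W a12 a13 a23 lm lv mv.
rewrite cscale1; apply: In_dark; move: h5; rewrite fsum; congr (_ ~~> _).
by ffun_ring.
Qed.

Lemma classification x : x \in V1 -> in_list x.
Proof.
move=> xV; have [[f1 [F1 _ xf1]]|x0] := next_pivot [::] x; last first.
  apply: In_zero; have /V1P[xi xc] := xV; apply: vec_ext => [c cP|i]; last by rewrite xi ffunE.
  rewrite root_coord0; have [cd|cd] := eqVneq (ip c d) 1; last exact: xc.
  by apply: x0.
have [||y [xy yV yC]] := clear_step (f1 := f1) frame_nil isT F1 _ xf1 xV => //.
have fr1 : frame [:: f1] by apply: frame_cons => //; apply: frame_nil.
have step z : x ~~> z -> in_list z -> in_list x.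
  move=> xz; apply: in_list_equivalent (xz) _; apply/eqP => z0.
  have [g gG gx] := xz; have x0 : x = 0.
    by apply: (@perm_inj _ g); rewrite gx z0 (elem0 gG).
  by move: xf1; rewrite x0 root_coord0 => /esym/eqP; rewrite oner_eq0.
have [[f2 [F2 f2o yf2]]|yo] := next_pivot [:: f1] y; last first.
  apply: (step y xy); rewrite [y](cleared_normal fr1 _ _ yV yC yo) ?mem_head //.
  by rewrite big_seq1; apply: in_list_one.
have f21 : ip f2 f1 = 0 by apply: f2o; rewrite mem_head.
have [|z [yz zV zC]] := clear_step fr1 _ F2 f2o yf2 yV yC; rewrite ?mem_head ?orbT //.
have fr2 : frame [:: f2; f1] by apply: frame_cons.
have u2 : uniq [:: f2; f1] by rewrite /= andbT; apply: frame_notin.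
have {yz}xz := equivalent_trans xy yz.
have [[f3 [F3 f3o zf3]]|zo] := next_pivot [:: f2; f1] z; last first.
  apply: (step z xz); rewrite [z](cleared_normal fr2 u2 _ zV zC zo) ?inE ?eqxx ?orbT //.
  by rewrite big_cons big_seq1; apply: in_list_two.
have f32 : ip f3 f2 = 0 by apply: f3o; rewrite mem_head.
have f31 : ip f3 f1 = 0 by apply: f3o; rewrite !inE eqxx orbT.
have [|t [zt tV tC]] := clear_step fr2 _ F3 f3o zf3 zV zC; rewrite ?inE ?eqxx ?orbT //.
have fr3 : frame [:: f3; f2; f1] by apply: frame_cons.
have u3 : uniq [:: f3; f2; f1] by rewrite cons_uniq u2 andbT; apply: frame_notin.
have {zt}xt := equivalent_trans xz zt.
have [[f4 [F4 f4o tf4]]|t_o] := next_pivot [:: f3; f2; f1] t; last first.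
  apply: (step t xt); rewrite [t](cleared_normal fr3 u3 _ tV tC t_o) ?inE ?eqxx ?orbT //.
  by rewrite !big_cons big_nil addr0 addrA; apply: in_list_three.
have f43 : ip f4 f3 = 0 by apply: f4o; rewrite mem_head.
have f42 : ip f4 f2 = 0 by apply: f4o; rewrite !inE eqxx orbT.
have f41 : ip f4 f1 = 0 by apply: f4o; rewrite !inE eqxx !orbT.
have [|s [ts sV sC]] := clear_step fr3 _ F4 f4o tf4 tV tC; rewrite ?inE ?eqxx ?orbT //.
have fr4 : frame [:: f4; f3; f2; f1] by apply: frame_cons.
have u4 : uniq [:: f4; f3; f2; f1] by rewrite cons_uniq u3 andbT; apply: frame_notin.
have {ts}xs := equivalent_trans xt ts.
apply: (step s xs); rewrite [s](cleared_normal fr4 u4 _ sV sC) ?inE ?eqxx ?orbT //.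
  by rewrite !big_cons big_nil addr0 !addrA; apply: in_list_four.
(* Four pivots add up to [2d], so the products of [a] with them add up to 2 and cannot all
   vanish. *)
move=> a [aP ad] ao; exfalso.
have fsum : d + d - f3 - f2 - f1 = f4 by apply: frame4_sum => //; rewrite ipC.
have a1 : ip a f1 = 0 by apply: ao; rewrite !inE eqxx !orbT.
have a2 : ip a f2 = 0 by apply: ao; rewrite !inE eqxx !orbT.
have a3 : ip a f3 = 0 by apply: ao; rewrite !inE eqxx !orbT.
have : ip a f4 = 0 by apply: ao; rewrite mem_head.
by rewrite -fsum !ip_lin a1 a2 a3 ad; ip_lra.
Qed.

End Representatives.

(** * The sets Y(x) *)

Local Notation Y := (Y_set Pi N delta).

Lemma G0_sub g : g \in G0 -> g \in G.
Proof.
apply/subsetP/genS; apply/subsetP => h; rewrite !inE => /existsP[a /andP[_ ha]].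
by apply/existsP; exists a; rewrite inE.
Qed.

Lemma pX_G c : c \in Phi -> pX c \in G.
Proof. by move=> cP; rewrite -[c]/(val [` cP]%fset); apply: mem_pX; rewrite inE. Qed.

(** * Clearing degree 1 of a root element *)

Section Lowering.
Variable D : 'rV[R]_n.
Hypothesis DP : D \in Phi.

(** Since [a - D] has degree -1 with respect to [D], nothing arrives at [D], and in degree 1 only
    the component at [D] arrives, landing at [a]. The root [D] is general because both [d] and [-d]
    are needed. *)
Lemma lower_coord a z : a \in Phi -> ip a D = 1 ->
  [/\ co (xr (a - D) z) D = co z D,
      forall b, b \in Phi -> ip b D = 1 ->
        co (xr (a - D) z) b = co z b + (b == a)%:R * co z D
    & xr (a - D) (e (- D)) = e (- D)].
Proof.
move=> aP aD; have DD := ip_root DP; have aa := ip_root aP.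
have Da : ip D a = 1 by rewrite ipC.
have cP : a - D \in Phi by apply: root_sub.
have cD : ip (a - D) D = -1 by ip_lra.
split.
- rewrite co_xr //; last by apply: (neq_ip (c := D)); ip_lra.
  by rewrite [X in _ + X]root_coord_notin ?addr0 //; apply: notin_norm; ip_lra.
- move=> b bP bD; have bb := ip_root bP; have Db : ip D b = 1 by rewrite ipC.
  rewrite co_xr //; last by apply: (neq_ip (c := D)); ip_lra.
  congr (_ + _); have [->|ba] := eqVneq b a.
    by rewrite mul1r opprB addrC subrK.
  rewrite mul0r root_coord_notin //; apply/negP => h.
  have := root_sub_ip bP cP h; rewrite ipDr ipNr bD.
  by case E: (ip b a) / (ipP bP aP) => [bE|||| bE]; try (by ip_lra); rewrite bE eqxx in ba.
- by apply: xr_fix; rewrite ?opp_root //; ip_lra.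
Qed.

(** [x_(a-D)(1)] is an automorphism that fixes [e_(-D)] and the coordinate at [D], and [x_(-D)(1)]
    is built from these alone. *)
Lemma xr_lower_comm a z : a \in Phi -> ip a D = 1 ->
  xr (a - D) (xr (- D) z) = xr (- D) (xr (a - D) z).
Proof.
move=> aP aD; have [h1 _ h3] := lower_coord z aP aD.
have E w : xr (- D) w = w + br (e (- D)) w + cscale (co w D) (e (- D)).
  by rewrite /xr opprK.
rewrite (E z) (E (xr _ z)) h1 2!xrD xr_br h3; congr (_ + _).
by case: (K01 (co z D)) => ->; rewrite ?cscale0 ?cscale1 ?xr0.
Qed.

Lemma lower_all (s : seq 'rV[R]_n) : uniq s ->
  (forall a, a \in s -> a \in Phi /\ ip a D = 1) ->
  exists g, [/\ g \in G, g (e (- D)) = e (- D),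
    forall z, g (xr (- D) z) = xr (- D) (g z), forall z, co (g z) D = co z D
  & forall z b, b \in Phi -> ip b D = 1 ->
      co (g z) b = co z b + (b \in s)%:R * co z D].
Proof.
elim: s => [_ _|a s IHs /= /andP[as' us] sP].
  exists 1%g; split=> [||z|z|z b _ _]; rewrite ?group1 ?perm1 //.
  by rewrite mul0r addr0.
have [|g [gG ge gx gD gb]] := IHs us; first by move=> b bs; apply: sP; rewrite inE bs orbT.
have [aP aD] := sP a (mem_head _ _).
have cP : a - D \in Phi by apply: root_sub.
exists (g * pX (a - D))%g; split=> [||z|z|z b bP bD]; rewrite ?permM ?pXE.
- by rewrite groupM // pX_G.
- by rewrite ge; case: (lower_coord 0 aP aD).
- by rewrite gx xr_lower_comm.
- by case: (lower_coord (g z) aP aD) => ->.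
case: (lower_coord (g z) aP aD) => _ -> // _; rewrite gb // gD inE -addrA -mulrDl.
congr (_ + _ * _); have [->|ba] := eqVneq b a; first by rewrite (negPf as') add0r.
by rewrite addr0.
Qed.

(** The element [g] depends only on the degree 1 part of [y], so it serves all [z] with the same
    part; two members of one [Y(x)] are compared in this way. *)
Lemma root_element_clear y : extremal y -> co y D = 1 ->
  exists g, [/\ g \in G, g (e (- D)) = e (- D),
    forall z, g (xr (- D) z) = xr (- D) (g z)
  & forall z, extremal z -> co z D = 1 ->
    (forall a, a \in Phi -> ip a D = 1 -> co z a = co y a) ->
    g z = e D \/ g z = xr (- D) (e D)].
Proof.
move=> yE yD.
pose s := [seq a <- enum_fset Phi | (ip a D == 1) && (co y a == 1)].
have us : uniq s by apply: filter_uniq; apply: fset_uniq.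
have sP a : a \in s -> a \in Phi /\ ip a D = 1.
  by rewrite mem_filter => /andP[/andP[/eqP aD _] aP].
have [g [gG ge gx gD gb]] := lower_all us sP; exists g; split=> // z zE zD zy.
apply: extremal_top => //; first exact: extremal_group gG zE.
  by rewrite gD.
move=> a aP aD; rewrite gb // zD mulr1 zy // mem_filter aD eqxx /=.
have -> : (a \in enum_fset Phi) = true by exact: aP.
rewrite andbT; case: (K01 (co y a)) => ->; first by rewrite eq_sym oner_eq0 addr0.
by rewrite eqxx K_addrr.
Qed.

End Lowering.

Lemma root_elements_extremal y : y \in root_elements Pi N K delta -> extremal y.
Proof.
by case/orbitP => g gG <-; apply: extremal_group gG _; apply: extremal_root; apply: fsvalP.
Qed.

Lemma root_elements_act g y : g \in G -> y \in root_elements Pi N K delta ->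
  g y \in root_elements Pi N K delta.
Proof.
move=> gG /orbitP[h hG <-]; apply/orbitP; exists (h * g)%g; first exact: groupM.
by rewrite /= /aperm permM.
Qed.

Lemma root_elements_d : (e d : V) \in root_elements Pi N K delta.
Proof. exact: orbit_refl. Qed.

Lemma YP x y : reflect [/\ y \in root_elements Pi N K delta, co y d = 1
    & forall a, a \in Phi -> ip a d = 1 -> co y a = co x a] (y \in Y x).
Proof.
rewrite inE; apply: (iffP and3P) => [[h1 /eqP h2 /forallP h3]|[h1 h2 h3]]; split=> //.
- move=> a aP ad; have := h3 [` aP]%fset; rewrite mem_Phi_1 ad eqxx /=.
  by rewrite -!root_coordE => /eqP.
- exact/eqP.
- apply/forallP => a; rewrite mem_Phi_1; apply/implyP => /eqP ad.
  by rewrite -!root_coordE h3 // fsvalP.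
Qed.

Lemma Y_pair x y : y \in Y x -> Y x = [set y] :|: [set xr (- d) y].
Proof.
move=> yY; have [yR yd yx] := YP _ _ yY; have dP := fsvalP delta; have dd := ip_root dP.
have dN := opp_root dP.
have [g [gG ge gx gP]] := root_element_clear dP (root_elements_extremal yR) yd.
apply/setP => z; rewrite in_setU !in_set1.
apply/idP/idP => [zY|/orP[]/eqP -> //].
  have [zR zd zx] := YP _ _ zY.
  have gy := gP y (root_elements_extremal yR) yd (fun _ _ _ => erefl).
  have zy a : a \in Phi -> ip a d = 1 -> co z a = co y a by move=> aP ad; rewrite zx ?yx.
  have gz := gP z (root_elements_extremal zR) zd zy.
  have inj t : g t = g z -> t = z by apply: perm_inj.
  case: gy gz => gy [] gz.
  - by rewrite (inj y) ?eqxx // gy gz.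
  - by rewrite (inj (xr (- d) y)) ?eqxx ?orbT // gx gy gz.
  - by rewrite (inj (xr (- d) y)) ?eqxx ?orbT // gx gy gz xrK.
  - by rewrite (inj y) ?eqxx // gy gz.
apply/YP; split.
- by rewrite -pXE; apply: root_elements_act => //; apply: pX_G.
- rewrite co_xr //; last by apply: (neq_ip (c := d)); ip_lra.
  by rewrite opprK [X in _ + X]root_coord_notin ?addr0 //; apply: notin_norm; ip_lra.
- move=> a aP ad; have aa := ip_root aP; have da : ip d a = 1 by rewrite ipC.
  rewrite co_xr //; last by apply: (neq_ip (c := d)); ip_lra.
  rewrite opprK [X in _ + X]root_coord_notin ?addr0 ?yx //.
  by apply: notin_norm; ip_lra.
Qed.

(** Clearing with respect to [-d] fixes [e_d] and takes [y] to [e_(-d)] or [x_d(1) e_(-d)]; in the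
    second case [x_d(1)], which also fixes [e_d], finishes. *)
Lemma angle_pi y : y \in root_elements Pi N K delta -> co y (- d) = 1 ->
  forall phi, has_angle Pi N y (e d) phi <-> phi = acos ((-2 : R) / 2).
Proof.
move=> yR yd phi; have dP := fsvalP delta; have dN := opp_root dP; have dd := ip_root dP.
have [g [gG ge _ gP]] := root_element_clear dN (root_elements_extremal yR) yd.
rewrite opprK in ge.
have ipE : ip (- d) d = -2 by rewrite ipNl dd.
have [gy|gy] := gP y (root_elements_extremal yR) yd (fun _ _ _ => erefl).
  by rewrite -ipE; apply: has_angle_root gG dN dP gy ge.
rewrite opprK in gy; rewrite -ipE; apply: (@has_angle_root (g * pX d)%g) => //.
- by rewrite groupM // pX_G.
- by rewrite permM pXE gy xrK.
- by rewrite permM pXE ge xr_fix // dd.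
Qed.

(** * Computing theta from one member of [Y(x)] *)

Definition Y0 x := [set y in Y x | co y (- d) == 0].

Lemma mem_Y0 x y : (y \in Y0 x) = (y \in Y x) && (co y (- d) == 0).
Proof. by rewrite inE. Qed.

Local Notation has_theta := (has_theta Pi N delta).
(* [cos theta(x) = t / 2]; the flag [b], whether exactly one [y] in [Y x] has
   [y^(-d) = 0], is what separates the two luminous orbits. *)
Definition theta_data x (t : R) (b : bool) : Prop :=
  (forall phi, has_theta x phi <-> phi = acos (t / 2)) /\ (#|Y0 x| == 1%N) = b.

(** The evaluation at [-d] decides the shape of [Y(x)]: if it is 0, the two members differ at [-d]
    and exactly one vanishes there; if it is 1, they agree. *)
Lemma co_lower_N x y : y \in Y x ->
  co (xr (- d) y) (- d) = co y (- d) + cartan_eval (- d) y + 1.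
Proof.
move=> /YP[_ yd _]; rewrite co_xr_diag ?opp_root ?fsvalP //.
by rewrite opprK yd.
Qed.

(** The Cartan parts differ by [h_d], which is nonzero since some root has product 1 with [d]. *)
Lemma xr_lower_neq x y : y \in Y x -> xr (- d) y != y.
Proof.
move=> /YP[_ yd _]; have dP := fsvalP delta; have dN := opp_root dP.
have [g gP gd] := ex_ip1 dP; apply/eqP => h.
have := parity1 dP gP gd; rewrite -cartan_eval_hh /cartan_eval big1.
  by move/eqP; rewrite eq_sym oner_eq0.
move=> i _; have := congr1 (fun z : V => z (inr i)) h.
rewrite cart_xr // opprK yd mul1r -hhE hhN // => /eqP.
by rewrite -subr_eq0 addrAC subrr add0r => /eqP ->; rewrite mul0r.
Qed.

Lemma theta_data_split x y a g : y \in Y x -> co y (- d) = 0 ->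
  cartan_eval (- d) y = 0 -> a \in Phi -> g \in G -> g y = e a -> g (e d) = e d ->
  theta_data x (ip a d) true.
Proof.
move=> yY yN yc aP gG gy gd.
have Y0E : Y0 x = [set y].
  apply/setP => z; rewrite mem_Y0 (Y_pair yY) in_setU !in_set1; apply/andP/eqP => [[]|->].
    case/orP => /eqP -> //; rewrite (co_lower_N yY) yN yc !add0r.
    by rewrite oner_eq0.
  by rewrite eqxx yN eqxx.
split; last by rewrite Y0E cards1.
move=> phi; rewrite /has_theta -/(Y0 x) Y0E cards1 eqxx.
have h := has_angle_root phi gG aP (fsvalP delta) gy gd.
split=> [[z /set1P -> /h //]|ph]; exists y; rewrite ?in_set1 //.
by apply/h.
Qed.

Lemma theta_data_common x y t : y \in Y x -> cartan_eval (- d) y = 1 ->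
  (forall z, z \in Y x -> forall phi, has_angle Pi N z (e d) phi <-> phi = acos (t / 2)) ->
  theta_data x t false.
Proof.
move=> yY yc ang.
have N1 : (#|Y0 x| == 1%N) = false.
  have sN : co (xr (- d) y) (- d) = co y (- d).
    by rewrite (co_lower_N yY) yc -addrA K_addrr addr0.
  apply/negbTE/negP => /cards1P[z zE].
  have [h|h] := K01 (co y (- d)).
    have y0 : y \in Y0 x by rewrite mem_Y0 yY h eqxx.
    have y1 : xr (- d) y \in Y0 x.
      by rewrite mem_Y0 (Y_pair yY) in_setU !in_set1 eqxx orbT sN h eqxx.
    have := xr_lower_neq yY; move: y0 y1; rewrite zE => /set1P -> /set1P ->.
    by rewrite eqxx.
  have : z \in Y0 x by rewrite zE set11.
  rewrite mem_Y0 (Y_pair yY) in_setU !in_set1 => /andP[/orP[]/eqP ->]; rewrite ?sN h oner_eq0 //.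
split=> // phi; rewrite /has_theta -/(Y0 x) N1; split=> [[_ /(_ y yY)/(ang y yY) //]|ph].
split; first by apply/set0Pn; exists y.
by move=> z zY; apply/(ang z zY).
Qed.

(** Roots of [Phi_0] have degree 0, so [G_0] respects the grading; [d] and [-d] are alone in their
    degrees. *)
Lemma G0_compat g : g \in G0 -> [/\ g (e d) = e d,
   forall z, co (g z) d = co z d, forall z, co (g z) (- d) = co z (- d)
 & forall y z, (forall a, Phi1 a -> co y a = co z a) ->
   forall a, Phi1 a -> co (g y) a = co (g z) a].
Proof.
move=> gG; elim/elementary_ind: gG => [|c cS|h k [h1 h2 h3 h4] [k1 k2 k3 k4]].
- by split=> [|z|z|y z yz a aP]; rewrite !perm1 ?yz.
- have cP := fsvalP c; have cd : ip (val c) d = 0 by move: cS; rewrite mem_Phi_0 => /eqP.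
  have dP := fsvalP delta; have dd := ip_root dP; have cc := ip_root cP.
  have dc : ip d (val c) = 0 by rewrite ipC.
  have dN := opp_root dP.
  split=> [|z|z|y z yz a [aP ad]]; rewrite !pXE.
  + by apply: xr_fix; rewrite // cd.
  + rewrite co_xr //; last by apply: (neq_ip (c := d)); ip_lra.
    by rewrite [X in _ + X]root_coord_notin ?addr0 //; apply: notin_norm; ip_lra.
  + rewrite co_xr //; last by apply: (neq_ip (c := d)); ip_lra.
    by rewrite [X in _ + X]root_coord_notin ?addr0 //; apply: notin_norm; ip_lra.
  + have ac : a != val c by apply: (neq_ip (c := d)); ip_lra.
    rewrite !co_xr // yz //; congr (_ + _).
    have [h|h] := boolP (a - val c \in Phi); last by rewrite !root_coord_notin.
    by apply: yz; split=> //; ip_lra.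
- split=> [|z|z|y z yz a aP]; rewrite !permM.
  + by rewrite h1 k1.
  + by rewrite k2 h2.
  + by rewrite k3 h3.
  + by apply: k4 => // b bP; apply: h4.
Qed.

Lemma Y_act g x y : g \in G0 -> y \in Y x -> g y \in Y (g x).
Proof.
move=> gG /YP[yR yd yx]; have [_ h2 _ h4] := G0_compat gG; apply/YP; split.
- by apply: root_elements_act => //; apply: G0_sub.
- by rewrite h2.
- by move=> a aP ad; apply: h4 => // b [bP bd]; apply: yx.
Qed.

Lemma Y_actE g x y : g \in G0 -> (g y \in Y (g x)) = (y \in Y x).
Proof.
move=> gG; apply/idP/idP => [|/(Y_act gG) //].
by move=> /(Y_act (groupVr gG)); rewrite !permK.
Qed.

Lemma theta_data_equivalent x x' t b : x ~~> x' -> theta_data x t b -> theta_data x' t b.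
Proof.
move=> [g gG <-] [th cb]; have [h1 h2 h3 h4] := G0_compat gG; have giG := groupVr gG.
have Y0E : Y0 (g x) = g @: Y0 x.
  apply/setP => z; apply/idP/imsetP => [|[y yY ->]].
    rewrite mem_Y0 => /andP[zY zd]; exists (g^-1%g z); last by rewrite permKV.
    rewrite mem_Y0 -(Y_actE _ _ gG) permKV zY /=.
    by have [_ _ hi _] := G0_compat giG; rewrite hi.
  by move: yY; rewrite !mem_Y0 Y_actE // h3.
have cE : #|Y0 (g x)| = #|Y0 x| by rewrite Y0E card_imset //; apply: perm_inj.
have ang y phi : has_angle Pi N (g y) (e d) phi <-> has_angle Pi N y (e d) phi.
  by rewrite -{1}h1; apply: has_angle_conj; apply: G0_sub.
split; last by rewrite cE.
move=> phi; rewrite -th /has_theta -/(Y0 x) -/(Y0 (g x)) cE; case: ifP => _.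
  split=> [[z zY zp]|[y yY yp]].
    move: zY; rewrite Y0E => /imsetP[y yY zE]; exists y => //.
    by apply: (ang y phi).1; rewrite -zE.
  by exists (g y); rewrite ?Y0E ?imset_f //; apply: (ang y phi).2.
split=> [[/set0Pn[z zY] zp]|[/set0Pn[y yY] yp]]; split.
- by apply/set0Pn; exists (g^-1%g z); rewrite -(Y_actE _ _ gG) permKV.
- by move=> y yY; apply: (ang y phi).1; apply: zp; rewrite Y_actE.
- by apply/set0Pn; exists (g y); rewrite Y_actE.
- move=> z zY; rewrite -(permKV g z); apply: (ang _ phi).2; apply: yp.
  by rewrite -(Y_actE _ _ gG) permKV.
Qed.

(** Starting from [e_d] in [Y(0)], this builds a member of [Y(x)] one summand of [x] at a time. *)
Lemma Y_lower a x y : Phi1 a -> y \in Y x -> xr (a - d) y \in Y (x + e a).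
Proof.
move=> [aP ad] /YP[yR yd yx]; have dP := fsvalP delta.
have [h1 h2 _] := lower_coord dP y aP ad; apply/YP; split.
- rewrite -pXE; apply: root_elements_act => //; apply: pX_G; exact: root_sub.
- by rewrite h1.
- by move=> b bP bd; rewrite h2 // yd yx // root_coordD co_e // mulr1.
Qed.

Lemma Y_zero : e d \in Y 0.
Proof.
apply/YP; split; first exact: root_elements_d.
  by rewrite co_e ?fsvalP // eqxx.
move=> a aP ad; rewrite co_e ?fsvalP // root_coord0; case: eqP => // ae.
by exfalso; move: ad; rewrite ae ip_delta; ip_lra.
Qed.

Lemma theta_zero : theta_data (0 : V) 2 true.
Proof.
have dP := fsvalP delta; have dd := ip_root dP.
rewrite -dd; apply: (theta_data_split (y := e d) (g := 1%g)) => //.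
- exact: Y_zero.
- rewrite co_e // (negPf (_ : - d != d)) //.
  by apply: (neq_ip (c := d)); ip_lra.
- exact: cartan_eval_vec.
- by rewrite perm1.
- by rewrite perm1.
Qed.

(** * The invariant theta of the representatives *)

Variables l m v u : 'rV[R]_n.
Hypotheses (L : Phi1 l) (M : Phi1 m) (W : Phi1 v) (U : Phi1 u).
Hypotheses (lm : ip l m = 0) (lv : ip l v = 0) (mv : ip m v = 0).
Hypotheses (lu : ip l u = 0) (mu : ip m u = 0) (vu : ip v u = 0).

Let ips := (L.2, M.2, W.2, U.2, lm, lv, mv, lu, mu, vu,
  ip_root L.1, ip_root M.1, ip_root W.1, ip_root U.1, ip_delta).
Let ipCs := (ipC Pi d l, ipC Pi d m, ipC Pi d v, ipC Pi d u,
  ipC Pi m l, ipC Pi v l, ipC Pi v m, ipC Pi u l, ipC Pi u m, ipC Pi u v).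

Ltac ip_calc := rewrite ?ip_lin ?ip0l ?ipCs ?ips; ip_ring.
Ltac copy_roots :=
  have lP := L.1; have mP := M.1; have vP := W.1; have uP := U.1;
  have dP := fsvalP delta; have dN := opp_root dP.

Lemma co_e_neq a c : a \in Phi -> c != a -> co (e a) c = 0.
Proof. by move=> aP ca; rewrite co_e // (negPf ca). Qed.

(** The pattern for orthogonal roots: applying the [x_(f-d)(1)] to [e_d] gives a sum over subsets
    [S] of the chosen roots, with term at [d] plus the sum of [f - d] over [S]. Then [x_(d-f)(1)]
    fixes [e_d] and cancels the terms whose subset misses [f], so one root vector is left. *)
Lemma theta_sing : theta_data (e l : V) 1 true.
Proof.
copy_roots; have lP' : l - d \in Phi by apply: root_sub => //; ip_calc.
have lN : d - l \in Phi by apply: root_sub => //; ip_calc.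
have E : xr (l - d) (e d) = e d + e l by rewrite xr_add ?subrK //; ip_calc.
have yY : e d + e l \in Y (e l) by rewrite -E -[X in Y X]add0r; apply: Y_lower L Y_zero.
rewrite -L.2; apply: (theta_data_split (g := pX (d - l)) yY) => //.
- by rewrite root_coordD !co_e_neq ?addr0 //; apply: (neq_ip (c := d)); ip_calc.
- by rewrite cartan_evalD !cartan_eval_vec addr0.
- exact: pX_G.
- rewrite pXE xrD (@xr_fix _ d) //; last by ip_calc.
  rewrite xr_add ?subrK //; last by ip_calc.
  by ffun_ring2 (e d : V).
- by rewrite pXE (@xr_fix _ d) //; ip_calc.
Qed.

Lemma theta_bril : theta_data (e l + e m : V) 0 true.
Proof.
copy_roots; have lP' : l - d \in Phi by apply: root_sub => //; ip_calc.
have mP' : m - d \in Phi by apply: root_sub => //; ip_calc.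
have lN : d - l \in Phi by apply: root_sub => //; ip_calc.
have mN : d - m \in Phi by apply: root_sub => //; ip_calc.
have mlP : m - d + l \in Phi by apply: root_add => //; ip_calc.
have E1 : xr (l - d) (e d) = e d + e l by rewrite xr_add ?subrK //; ip_calc.
have E2 : xr (m - d) (e d + e l) = e d + e m + (e l + e (m - d + l)).
  rewrite xrD (@xr_add _ d) ?subrK //; last by ip_calc.
  by rewrite (@xr_add _ l) //; ip_calc.
have yY : e d + e m + (e l + e (m - d + l)) \in Y (e l + e m).
  rewrite -E2 -E1 -[e l]add0r.
  by apply: Y_lower M _; apply: Y_lower L Y_zero.
have <- : ip (m - d + l) d = 0 by ip_calc.
apply: (theta_data_split (g := (pX (d - m) * pX (d - l))%g) yY) => //.
- by rewrite !root_coordD !co_e_neq ?addr0 //; apply: (neq_ip (c := d)); ip_calc.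
- by rewrite !cartan_evalD !cartan_eval_vec !addr0.
- by rewrite groupM // pX_G.
- rewrite permM !pXE.
  have -> : xr (d - m) (e d + e m + (e l + e (m - d + l))) = e m + e (m - d + l).
    rewrite !xrD (@xr_fix _ d) //; last by ip_calc.
    rewrite (@xr_add _ m) ?subrK //; last by ip_calc.
    rewrite (@xr_fix _ l) //; last by ip_calc.
    rewrite (@xr_add _ (m - d + l)) //; last by ip_calc.
    have -> : d - m + (m - d + l) = l by apply/rowP => i; rewrite !mxE; ring.
    by ffun_ring2 (e d + e l : V).
  rewrite !xrD (@xr_fix _ m) //; last by ip_calc.
  rewrite (@xr_add _ (m - d + l)) //; last by ip_calc.
  have -> : d - l + (m - d + l) = m by apply/rowP => i; rewrite !mxE; ring.
  by ffun_ring2 (e m : V).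
- rewrite permM !pXE (@xr_fix _ d) //; last by ip_calc.
  by rewrite (@xr_fix _ d) //; ip_calc.
Qed.

Lemma theta_lum1 : theta_data (e l + e m + e v : V) (-1) true.
Proof.
copy_roots; have lP' : l - d \in Phi by apply: root_sub => //; ip_calc.
have mP' : m - d \in Phi by apply: root_sub => //; ip_calc.
have vP' : v - d \in Phi by apply: root_sub => //; ip_calc.
have lN : d - l \in Phi by apply: root_sub => //; ip_calc.
have mN : d - m \in Phi by apply: root_sub => //; ip_calc.
have vN : d - v \in Phi by apply: root_sub => //; ip_calc.
have mlP : m - d + l \in Phi by apply: root_add => //; ip_calc.
have vlP : v - d + l \in Phi by apply: root_add => //; ip_calc.
have vmP : v - d + m \in Phi by apply: root_add => //; ip_calc.
have wP : v - d + (m - d + l) \in Phi by apply: root_add => //; ip_calc.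
have E1 : xr (l - d) (e d) = e d + e l by rewrite xr_add ?subrK //; ip_calc.
have E2 : xr (m - d) (e d + e l) = e d + e m + (e l + e (m - d + l)).
  rewrite xrD (@xr_add _ d) ?subrK //; last by ip_calc.
  by rewrite (@xr_add _ l) //; ip_calc.
(* The eight terms correspond to the subsets of [l, m, v]; the full subset gives the root
   [l + m + v - 2d], of degree -1. *)
pose y := e d + e v + (e m + e (v - d + m)) + (e l + e (v - d + l)
    + (e (m - d + l) + e (v - d + (m - d + l)))) : V.
have E3 : xr (v - d) (e d + e m + (e l + e (m - d + l))) = y.
  rewrite !xrD (@xr_add _ d) ?subrK //; last by ip_calc.
  rewrite (@xr_add _ m) //; last by ip_calc.
  rewrite (@xr_add _ l) //; last by ip_calc.
  by rewrite (@xr_add _ (m - d + l)) //; ip_calc.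
have yY : y \in Y (e l + e m + e v).
  rewrite -E3 -E2 -E1 -[e l]add0r.
  by apply: Y_lower W _; apply: Y_lower M _; apply: Y_lower L Y_zero.
have <- : ip (v - d + (m - d + l)) d = -1 by ip_calc.
apply: (theta_data_split (g := (pX (d - v) * pX (d - m) * pX (d - l))%g) yY) => //.
- by rewrite !root_coordD !co_e_neq ?addr0 //; apply: (neq_ip (c := d)); ip_calc.
- by rewrite !cartan_evalD !cartan_eval_vec !addr0.
- by rewrite !groupM // pX_G.
- rewrite !permM !pXE.
  have -> : xr (d - v) y = e v + e (v - d + m) + (e (v - d + l) + e (v - d + (m - d + l))).
    rewrite !xrD (@xr_fix _ d) //; last by ip_calc.
    rewrite (@xr_add _ v) ?subrK //; last by ip_calc.
    rewrite (@xr_fix _ m) //; last by ip_calc.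
    rewrite (@xr_add _ (v - d + m)) //; last by ip_calc.
    rewrite (@xr_fix _ l) //; last by ip_calc.
    rewrite (@xr_add _ (v - d + l)) //; last by ip_calc.
    rewrite (@xr_fix _ (m - d + l)) //; last by ip_calc.
    rewrite (@xr_add _ (v - d + (m - d + l))) //; last by ip_calc.
    have -> : d - v + (v - d + m) = m by apply/rowP => i; rewrite !mxE; ring.
    have -> : d - v + (v - d + l) = l by apply/rowP => i; rewrite !mxE; ring.
    have -> : d - v + (v - d + (m - d + l)) = m - d + l.
      by apply/rowP => i; rewrite !mxE; ring.
    by ffun_ring2 (e d + e m + e l + e (m - d + l) : V).
  have -> : xr (d - m) (e v + e (v - d + m) + (e (v - d + l) + e (v - d + (m - d + l)))) =
      e (v - d + m) + e (v - d + (m - d + l)).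
    rewrite !xrD (@xr_fix _ v) //; last by ip_calc.
    rewrite (@xr_add _ (v - d + m)) //; last by ip_calc.
    rewrite (@xr_fix _ (v - d + l)) //; last by ip_calc.
    rewrite (@xr_add _ (v - d + (m - d + l))) //; last by ip_calc.
    have -> : d - m + (v - d + m) = v by apply/rowP => i; rewrite !mxE; ring.
    have -> : d - m + (v - d + (m - d + l)) = v - d + l.
      by apply/rowP => i; rewrite !mxE; ring.
    by ffun_ring2 (e v + e (v - d + l) : V).
  rewrite !xrD (@xr_fix _ (v - d + m)) //; last by ip_calc.
  rewrite (@xr_add _ (v - d + (m - d + l))) //; last by ip_calc.
  have -> : d - l + (v - d + (m - d + l)) = v - d + m.
    by apply/rowP => i; rewrite !mxE; ring.
  by ffun_ring2 (e (v - d + m) : V).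
- rewrite !permM !pXE (@xr_fix _ d) //; last by ip_calc.
  rewrite (@xr_fix _ d) //; last by ip_calc.
  by rewrite (@xr_fix _ d) //; ip_calc.
Qed.

(* An element over e_l + e_(d - l); the other one is obtained by exchanging l
   and d - l. *)
Definition lum2_elem a : V := e d + e a + (e (d - a) + hh (a - d) + e (a - d)).

Lemma lum2_elemE a : Phi1 a -> xr (a - d) (xr (- a) (e d)) = lum2_elem a.
Proof.
move=> [aP ad]; have dP := fsvalP delta; have dd := ip_root dP; have aa := ip_root aP.
have da : ip d a = 1 by rewrite ipC.
have aN := opp_root aP; have aP' : a - d \in Phi by apply: root_sub.
have daP : d - a \in Phi by rewrite -opprB opp_root.
rewrite (@xr_add _ d) ?[- a + d]addrC //; last by rewrite ipNl ad.
rewrite xrD (@xr_add _ d) ?subrK //; last by ip_lra.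
by rewrite -[d - a]opprB xr_eN // opprB.
Qed.

(** [x_(d-a)(1)] strips the element down to [e_a + e_(a-d)], and [x_d(1)] removes [e_a]; both fix
    [e_d]. *)
Lemma lum2_angle a phi : Phi1 a ->
  has_angle Pi N (lum2_elem a) (e d) phi <-> phi = acos ((-1 : R) / 2).
Proof.
move=> [aP ad]; have dP := fsvalP delta; have dd := ip_root dP; have aa := ip_root aP.
have da : ip d a = 1 by rewrite ipC.
have aP' : a - d \in Phi by apply: root_sub.
have daP : d - a \in Phi by rewrite -opprB opp_root.
have <- : ip (a - d) d = -1 by ip_lra.
apply: (@has_angle_root (pX (d - a) * pX d)%g) => //.
- by rewrite groupM // pX_G.
- rewrite permM !pXE.
  have -> : xr (d - a) (lum2_elem a) = e a + e (a - d).
    rewrite /lum2_elem !xrD (@xr_fix _ d) //; last by ip_lra.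
    rewrite (@xr_add _ a) ?subrK //; last by ip_lra.
    rewrite (@xr_fix _ (d - a)) //; last by ip_lra.
    rewrite -(opprB d a) hhN // xr_hh // parity2 // cscale0 addr0 xr_eN //.
    by ffun_ring2 (e d + hh (d - a) + e (d - a) : V).
  rewrite xrD (@xr_fix _ a) //; last by ip_lra.
  rewrite (@xr_add _ (a - d)) //; last by ip_lra.
  by rewrite [d + _]addrC subrK; ffun_ring2 (e a : V).
- rewrite permM !pXE (@xr_fix _ d) //; last by ip_lra.
  by rewrite (@xr_fix _ d) //; ip_lra.
Qed.

Lemma lum2_Y a : Phi1 a -> lum2_elem a \in Y (e a + e (d - a)).
Proof.
move=> A; rewrite -lum2_elemE //.
have E : (e a + e (d - a) : V) = 0 + e (d - a) + e a by rewrite add0r addrC.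
rewrite E; apply: Y_lower (A) _.
have := Y_lower (Phi1_compl A) Y_zero.
by rewrite [d - a - d]addrAC subrr add0r.
Qed.

Lemma lum2_cartan a i : lum2_elem a (inr i) = hh (a - d) (inr i).
Proof. by rewrite /lum2_elem !ffun_addE !vec_cart !addr0 !add0r. Qed.

Lemma cartan_eval_lum2 a b : cartan_eval b (lum2_elem a) = parity (a - d) b.
Proof.
rewrite -cartan_eval_hh /cartan_eval; apply: eq_bigr => i _.
by rewrite lum2_cartan.
Qed.

Lemma lum2_eval_d a : Phi1 a -> cartan_eval (- d) (lum2_elem a) = 1.
Proof.
move=> [aP ad]; have dP := fsvalP delta; have dd := ip_root dP.
have da : ip d a = 1 by rewrite ipC.
rewrite cartan_eval_lum2 parity1 ?opp_root ?root_sub //; ip_lra.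
Qed.

Lemma theta_lum2 a : Phi1 a -> theta_data (e a + e (d - a) : V) (-1) false.
Proof.
move=> A; have B := Phi1_compl A; have yY := lum2_Y A.
have [aP ad] := A; have dP := fsvalP delta; have dd := ip_root dP; have aa := ip_root aP.
have da : ip d a = 1 by rewrite ipC.
apply: theta_data_common (yY) (lum2_eval_d A) _ => z zY phi.
have y'Y : lum2_elem (d - a) \in Y (e a + e (d - a)).
  have := lum2_Y B; have -> : d - (d - a) = a by rewrite opprB addrC subrK.
  by rewrite [e _ + e a]addrC.
move: zY y'Y; rewrite (Y_pair yY) !in_setU !in_set1 => /orP[/eqP -> _|/eqP ->].
  exact: lum2_angle phi A.
case/orP => /eqP E; last by rewrite -E; apply: lum2_angle phi B.
(* The elements for [a] and [d - a] are distinct: their Cartan parts [h_(a-d)] and [h_(-a)] take the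
   values 1 and 0 at [a]. *)
have : cartan_eval a (lum2_elem (d - a)) = cartan_eval a (lum2_elem a) by rewrite E.
rewrite !cartan_eval_lum2; have -> : d - a - d = - a by rewrite addrAC subrr add0r.
have aN := opp_root aP.
have -> : parity (- a) a = 0.
  by rewrite (parityE (k := -2)) ?mulrNz // ?ipNr ?aa // -[2%:~R]/(1 + 1 : K) K_addrr oppr0.
rewrite parity1 ?root_sub //; first by move/eqP; rewrite eq_sym oner_eq0.
by ip_lra.
Qed.

Definition dark_vec : V := e l + e (d - l) + e m + e v + e u.

Definition dark_elem : V := xr (m - d) (xr (v - d) (xr (u - d) (lum2_elem l))).

Lemma dark_Y : dark_elem \in Y dark_vec.
Proof.
have -> : dark_vec = e l + e (d - l) + e u + e v + e m.
  by rewrite /dark_vec; ffun_ring.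
by apply: Y_lower M _; apply: Y_lower W _; apply: Y_lower U (lum2_Y L).
Qed.

(** Expanding the three outer factors turns the coordinate at [-d] into eight coordinates of
    [lum2_elem l]. All vanish except the one reached by all three shifts, at
    [2d - m - v - u = l]. *)
Lemma dark_coord_N : co dark_elem (- d) = 1.
Proof.
copy_roots.
have lP' : l - d \in Phi by apply: root_sub => //; ip_calc.
have lN' : d - l \in Phi by apply: root_sub => //; ip_calc.
have mP' : m - d \in Phi by apply: root_sub => //; ip_calc.
have vP' : v - d \in Phi by apply: root_sub => //; ip_calc.
have uP' : u - d \in Phi by apply: root_sub => //; ip_calc.
have mN := opp_root mP; have vN := opp_root vP; have uN := opp_root uP.
have mN' : d - m \in Phi by apply: root_sub => //; ip_calc.
have vN' : d - v \in Phi by apply: root_sub => //; ip_calc.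
have mvP : d - m - v \in Phi by apply: root_sub => //; ip_calc.
have muP : d - m - u \in Phi by apply: root_sub => //; ip_calc.
have vuP : d - v - u \in Phi by apply: root_sub => //; ip_calc.
have lsum : d + d - m - v - u = l by apply: frame4_sum => //; rewrite ipC.
have step a c : a \in Phi -> c \in Phi -> ip c d = -1 -> (a = c -> False) ->
    forall z, co (xr c z) a = co z a + co z (a - c).
  by move=> aP cP _ ac z; apply: co_xr => //; apply/eqP.
have nip a c b : (ip a b = ip c b -> False) -> a = c -> False.
  by move=> h ac; apply: h; rewrite ac.
have zE w : w \in Phi -> w != d -> w != l -> w != d - l -> w != l - d ->
    co (lum2_elem l) w = 0.
  move=> wP w1 w2 w3 w4; rewrite /lum2_elem !root_coordD co_hh !co_e //.
  by rewrite (negPf w1) (negPf w2) (negPf w3) (negPf w4) !addr0.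
have zl : co (lum2_elem l) l = 1.
  have n1 : l != d by apply: (neq_ip (c := d)); ip_calc.
  have n2 : l != d - l by apply: (neq_ip (c := l)); ip_calc.
  have n3 : l != l - d by apply: (neq_ip (c := d)); ip_calc.
  rewrite /lum2_elem !root_coordD co_hh !co_e // eqxx (negPf n1) (negPf n2) (negPf n3).
  by rewrite !addr0 add0r.
have z0 w : w \in Phi -> ip w d = 0 -> co (lum2_elem l) w = 0.
  by move=> wP wd; apply: zE => //; apply: (neq_ip (c := d)); rewrite wd; ip_calc.
have z1 w : w \in Phi -> ip w d = -1 -> ip w l = 0 -> co (lum2_elem l) w = 0.
  move=> wP wd wl; apply: zE => //.
  - by apply: (neq_ip (c := d)); rewrite wd; ip_calc.
  - by apply: (neq_ip (c := d)); rewrite wd; ip_calc.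
  - by apply: (neq_ip (c := d)); rewrite wd; ip_calc.
  - by apply: (neq_ip (c := l)); rewrite wl; ip_calc.
rewrite /dark_elem.
have s1 z : co (xr (m - d) z) (- d) = co z (- d) + co z (- m).
  rewrite step //; [|by ip_calc|by apply: (nip _ _ d); ip_calc].
  by rewrite opprB addKr.
have s2 z : co (xr (v - d) z) (- d) = co z (- d) + co z (- v).
  rewrite step //; [|by ip_calc|by apply: (nip _ _ d); ip_calc].
  by rewrite opprB addKr.
have s3 z : co (xr (v - d) z) (- m) = co z (- m) + co z (d - m - v).
  rewrite step //; [|by ip_calc|by apply: (nip _ _ m); ip_calc].
  by rewrite opprB [- m + _]addrC addrAC.
have s4 z : co (xr (u - d) z) (- d) = co z (- d) + co z (- u).
  rewrite step //; [|by ip_calc|by apply: (nip _ _ d); ip_calc].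
  by rewrite opprB addKr.
have s5 z : co (xr (u - d) z) (- v) = co z (- v) + co z (d - v - u).
  rewrite step //; [|by ip_calc|by apply: (nip _ _ v); ip_calc].
  by rewrite opprB [- v + _]addrC addrAC.
have s6 z : co (xr (u - d) z) (- m) = co z (- m) + co z (d - m - u).
  rewrite step //; [|by ip_calc|by apply: (nip _ _ m); ip_calc].
  by rewrite opprB [- m + _]addrC addrAC.
have s7 z : co (xr (u - d) z) (d - m - v) = co z (d - m - v) + co z l.
  rewrite step //; [|by ip_calc|by apply: (nip _ _ d); ip_calc].
  congr (_ + co z _); rewrite -lsum; apply/rowP => i; rewrite !mxE; ring.
rewrite s1 s2 s3 s4 s5 s6 s7 zl.
rewrite (zE (- d)) //; last 4 first.
- by apply: (neq_ip (c := d)); ip_calc.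
- by apply: (neq_ip (c := d)); ip_calc.
- by apply: (neq_ip (c := d)); ip_calc.
- by apply: (neq_ip (c := d)); ip_calc.
rewrite (z1 (- u)) //; [|by ip_calc|by ip_calc].
rewrite (z1 (- v)) //; [|by ip_calc|by ip_calc].
rewrite (z1 (- m)) //; [|by ip_calc|by ip_calc].
rewrite (z0 (d - v - u)) //; last by ip_calc.
rewrite (z0 (d - m - u)) //; last by ip_calc.
rewrite (z0 (d - m - v)) //; last by ip_calc.
by rewrite !add0r.
Qed.

(** A factor [x_(w-d)(1)] alters the Cartan part only through the coordinate at [d - w], which is 0
    when [w = u, v, m] is added; so the value is that of [lum2_elem l]. *)
Lemma dark_eval_d : cartan_eval (- d) dark_elem = 1.
Proof.
copy_roots; have lN' : d - l \in Phi by apply: root_sub => //; ip_calc.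
have coN x y w : y \in Y x -> Phi1 w -> co x (d - w) = 0 -> forall i,
    xr (w - d) y (inr i) = y (inr i).
  move=> /YP[_ _ yx] [wP wd] x0 i.
  have wP' : w - d \in Phi by apply: root_sub.
  have dw : d - w \in Phi by rewrite -opprB opp_root.
  rewrite cart_xr // opprB yx ?x0 ?mul0r ?addr0 //.
  by have dd := ip_root dP; ip_lra.
have Y1 := lum2_Y L; have Y2 := Y_lower U Y1; have Y3 := Y_lower W Y2.
rewrite -(lum2_eval_d L) /cartan_eval; apply: eq_bigr => i _; congr (_ * _).
have vN' : d - v \in Phi by apply: root_sub => //; ip_calc.
rewrite /dark_elem (coN _ _ _ Y3 M); last first.
  rewrite !root_coordD !co_e_neq ?addr0 //.
  - by apply: (neq_ip (c := m)); ip_calc.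
  - by apply: (neq_ip (c := m)); ip_calc.
  - by apply: (neq_ip (c := m)); ip_calc.
  - by apply: (neq_ip (c := m)); ip_calc.
rewrite (coN _ _ _ Y2 W); last first.
  rewrite !root_coordD !co_e_neq ?addr0 //.
  - by apply: (neq_ip (c := v)); ip_calc.
  - by apply: (neq_ip (c := v)); ip_calc.
  - by apply: (neq_ip (c := v)); ip_calc.
rewrite (coN _ _ _ Y1 U) //.
rewrite !root_coordD !co_e_neq ?addr0 //.
- by apply: (neq_ip (c := u)); ip_calc.
- by apply: (neq_ip (c := u)); ip_calc.
Qed.

Lemma theta_dark : theta_data dark_vec (-2) false.
Proof.
apply: theta_data_common dark_Y dark_eval_d _ => z zY phi.
have [zR _ _] := YP _ _ zY; apply: angle_pi => //.
have := zY; rewrite (Y_pair dark_Y) in_setU !in_set1 => /orP[]/eqP ->.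
  exact: dark_coord_N.
rewrite co_xr_diag ?opp_root ?fsvalP // dark_coord_N dark_eval_d opprK.
by case/YP: dark_Y => _ -> _; rewrite K_addrr add0r.
Qed.

(** * The orbits *)

Local Notation O x := (orbit 'P (G_0 Pi N K delta) (x : V) : {set V}).

Lemma mem_orbit_equivalent x y : (y \in O x) <-> x ~~> y.
Proof.
split=> [/orbitP[g gG <-]|[g gG <-]]; first by exists g.
by apply/orbitP; exists g.
Qed.

Lemma equivalent_orbit x y : x ~~> y -> O x = O y.
Proof. by move=> /mem_orbit_equivalent /orbit_eqP. Qed.

Definition rep (i : nat) : V :=
  nth 0 [:: 0; e l; e l + e m; e l + e m + e v; e l + e (d - l);
            e l + e (d - l) + e m + e v + e u] i.

(** The first entry is twice the cosine of theta (2 for the zero vector, where [y = e_d]), the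
    second the flag of [theta_data]. Entries 3 and 4 differ only in the flag. *)
Definition rep_data (i : nat) : int * bool :=
  nth (0, true) [:: (2, true); (1, true); (0, true); (-1, true); (-1, false);
                    (-2, false)] i.

Lemma V1_add x y : x \in V1 -> y \in V1 -> x + y \in V1.
Proof.
move=> /V1P[xi xc] /V1P[yi yc]; apply/V1P; split=> [i|c cP cd].
  by rewrite ffun_addE xi yi addr0.
by rewrite root_coordD xc ?yc ?addr0.
Qed.

Lemma V1_root a : Phi1 a -> e a \in V1.
Proof.
move=> [aP ad]; apply/V1P; split=> [i|c cP cd]; first exact: vec_cart.
by rewrite co_e_neq //; apply: contraNneq cd => ->; apply/eqP.
Qed.

Lemma V1_rep i : rep i \in V1.
Proof.
have V0 : (0 : V) \in V1.
  by apply/V1P; split=> [j|c _ _]; rewrite ?ffunE ?root_coord0.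
have L' := Phi1_compl L.
by do 6?[case: i => [|i]]; rewrite /rep /= ?nth_nil //; do ?apply: V1_add; try exact: V1_root.
Qed.

Lemma theta_rep i : (i < 6)%N -> theta_data (rep i) (rep_data i).1%:~R (rep_data i).2.
Proof.
do 6?[case: i => [_|i]] => //.
- exact: theta_zero.
- exact: theta_sing.
- exact: theta_bril.
- rewrite mulrNz; exact: theta_lum1.
- rewrite mulrNz; exact: theta_lum2 L.
- rewrite mulrNz; exact: theta_dark.
Qed.

Lemma classify_rep x : x \in V1 -> exists2 i, (i < 6)%N & x \in O (rep i).
Proof.
have uE : d + d - l - m - v = u by apply: frame4_sum.
move=> xV; have sym y z : y ~~> z -> y \in O z.
  by move=> h; apply/mem_orbit_equivalent; apply: equivalent_sym.
case: (classification L M W lm lv mv xV) => [->|h|h|h|h|h].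
- by exists 0%N => //; apply/mem_orbit_equivalent/equivalent_refl.
- by exists 1%N => //; apply: sym.
- by exists 2%N => //; apply: sym.
- by exists 3%N => //; apply: sym.
- by exists 4%N => //; apply: sym.
- by exists 5%N => //; apply: sym; rewrite /rep /= -uE.
Qed.

Lemma rep_data_bound i : ((rep_data i).1%:~R / 2 : R) \in `[-1, 1].
Proof.
rewrite in_itv /=; do 6?[case: i => [|i]]; rewrite /rep_data /= ?nth_nil ?mulrNz /=;
  apply/andP; split; lra.
Qed.

Lemma acos_rep_inj i j :
  acos ((rep_data i).1%:~R / 2 : R) = acos ((rep_data j).1%:~R / 2) ->
  (rep_data i).1 = (rep_data j).1.
Proof.
move=> /(congr1 cos); rewrite !acosK ?rep_data_bound // => h.
by apply: (@intr_inj R); lra.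
Qed.

Lemma has_theta_rep x i j : (i < 6)%N -> x \in O (rep i) ->
  has_theta x (acos ((rep_data j).1%:~R / 2)) <->
  (rep_data i).1 = (rep_data j).1.
Proof.
move=> i6 /mem_orbit_equivalent xi.
have [h _] := theta_data_equivalent xi (theta_rep i6).
by rewrite h; split=> [/esym/acos_rep_inj //|->].
Qed.

Lemma rep_data_inj i j : (i < 6)%N -> (j < 6)%N -> rep_data i = rep_data j -> i = j.
Proof. by move=> i6 j6; do 6?[case: i i6 => [|i] i6]; do 6?[case: j j6 => [|j] j6]. Qed.

(** Angle and flag are both constant on orbits, and together they take six different values on the
    representatives. *)
Lemma O_rep_inj i j : (i < 6)%N -> (j < 6)%N -> O (rep i) = O (rep j) -> i = j.
Proof.
move=> i6 j6 Oij; apply: rep_data_inj => //.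
have ij : rep i \in O (rep j) by rewrite -Oij orbit_refl.
have /esym dij : (rep_data j).1 = (rep_data i).1.
  apply/(has_theta_rep (x := rep i) _ j6 ij); have [h _] := theta_rep i6.
  by apply/h.
have [_ bi] := theta_rep i6.
have [_ bj] := theta_data_equivalent ((mem_orbit_equivalent _ _).1 ij) (theta_rep j6).
by rewrite [LHS]surjective_pairing [RHS]surjective_pairing dij -bi -bj.
Qed.

Lemma orbits_V1 : [set O x | x in V1] = [set:: [seq O (rep i) | i <- iota 0 6]].
Proof.
apply/setP => A; rewrite inE; apply/imsetP/mapP => [[x xV ->]|[i _ ->]].
  have [i i6 /mem_orbit_equivalent xi] := classify_rep xV.
  by exists i; rewrite ?mem_iota // (equivalent_orbit xi).
by exists (rep i) => //; apply: V1_rep.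
Qed.

Lemma uniq_orbits : uniq [seq O (rep i) | i <- iota 0 6].
Proof.
rewrite map_inj_in_uniq ?iota_uniq // => i j; rewrite !mem_iota /= => i6 j6.
exact: O_rep_inj.
Qed.

Lemma O_zero : O 0 = [set (0 : V)].
Proof.
apply/setP => x; rewrite in_set1; apply/idP/eqP => [/orbitP[g gG <-]|->].
  exact: elem0 gG.
exact: orbit_refl.
Qed.

Lemma theta_orbits x j : (x \in V1 /\ has_theta x (acos ((rep_data j).1%:~R / 2)))
  <-> exists i, [/\ (i < 6)%N, (rep_data i).1 = (rep_data j).1 & x \in O (rep i)].
Proof.
split=> [[xV]|[i [i6 ij xi]]].
  have [i i6 xi] := classify_rep xV.
  by move/(has_theta_rep j i6 xi) => ij; exists i.
split; last by apply/(has_theta_rep j i6 xi).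
by apply: equivalent_V1 (V1_rep i); apply/mem_orbit_equivalent.
Qed.

End ChevalleyAlgebra.

Theorem mainTheorem2 (R : realType) (n : nat)
    (Phi : {fset 'rV[R]_n}) (Pi : n.-tuple 'rV[R]_n)
    (N : 'rV[R]_n -> 'rV[R]_n -> int)
    (K : finFieldType) (delta lambda mu nu xi : Phi) :
  root_system Phi -> simple_system Phi Pi -> type_E Pi ->
  chevalley_constants Phi Pi N ->
  #|K| = 2%N ->
  maximal_root Pi delta ->
  lambda \in Phi_1 delta -> mu \in Phi_1 delta ->
  nu \in Phi_1 delta -> xi \in Phi_1 delta ->
  dot (val lambda) (val mu) = 0 -> dot (val lambda) (val nu) = 0 ->
  dot (val lambda) (val xi) = 0 -> dot (val mu) (val nu) = 0 ->
  dot (val mu) (val xi) = 0 -> dot (val nu) (val xi) = 0 ->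
  val lambda + val mu + val nu + val xi = 2 *: val delta ->
  let e (v : 'rV[R]_n) : chev_alg Phi K := root_vec Phi K v in
  let O (v : chev_alg Phi K) : {set chev_alg Phi K} :=
    orbit 'P (G_0 Pi N K delta) v in
  let O_zero := O 0 in
  let O_sing := O (e (val lambda)) in
  let O_bril := O (e (val lambda) + e (val mu)) in
  let O_lum1 := O (e (val lambda) + e (val mu) + e (val nu)) in
  let O_lum2 := O (e (val lambda) + e (val delta - val lambda)) in
  let O_dark := O (e (val lambda) + e (val delta - val lambda)
                   + e (val mu) + e (val nu) + e (val xi)) in
  let orbits := [:: O_zero; O_sing; O_bril; O_lum1; O_lum2; O_dark] in
  [/\ [set O x | x in V_1 K delta] = [set:: orbits] /\ uniq orbits,
      O_zero = [set (0 : chev_alg Phi K)],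
      forall x, singular Pi N delta x <-> x \in O_sing,
      forall x, brilliant Pi N delta x <-> x \in O_bril
    & (forall x, luminous Pi N delta x <-> x \in O_lum1 :|: O_lum2) /\
      (forall x, dark Pi N delta x <-> x \in O_dark)].
Proof.
move=> rootsP simpleP typeP chevP cardK dmax lP mP nP xP lm ln lx mn mx nx sum e O.
have mem1 := mem_Phi_1 rootsP simpleP typeP.
have ipE a b : dot a b = 0 -> ip Pi a b = 0 by move=> h; rewrite /ip h mul0r.
have Phi1 (a : Phi) : a \in Phi_1 delta -> val a \in Phi /\ ip Pi (val a) (val delta) = 1.
  by rewrite mem1 => /eqP; split; first exact: fsvalP.
(* The relation between the four given roots identifies [xi] with the completion of the frame
   [lambda, mu, nu]. *)
have uE : val delta + val delta - val lambda - val mu - val nu = val xi.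
  by apply/eqP; rewrite !subr_eq -!addrA -mulr2n -scaler_nat -sum !addrA; apply/eqP;
     apply/rowP => i; rewrite !mxE; ring.
have L := Phi1 _ lP; have M := Phi1 _ mP; have W := Phi1 _ nP; have U := Phi1 _ xP.
have [] := (ipE _ _ lm, ipE _ _ ln, ipE _ _ lx, ipE _ _ mn, ipE _ _ mx, ipE _ _ nx).
move=> [[[[h1 h2] h3] h4] h5] h6.
have orbE := orbits_V1 rootsP simpleP typeP chevP cardK dmax L M W U h1 h2 h4 h3 h5 h6.
have orbU := uniq_orbits rootsP simpleP typeP chevP cardK L M W U h1 h2 h4 h3 h5 h6.
have th := theta_orbits rootsP simpleP typeP chevP cardK dmax L M W U h1 h2 h4 h3 h5 h6.
have a1 : acos ((rep_data 1).1%:~R / 2) = pi / 3 :> R by exact: acos_half.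
have a2 : acos ((rep_data 2).1%:~R / 2) = pi / 2 :> R by rewrite mul0r acos0.
have a3 : acos ((rep_data 3).1%:~R / 2) = 2 * pi / 3 :> R by rewrite mulrNz mulNr acos_halfN.
have a5 : acos ((rep_data 5).1%:~R / 2) = pi :> R.
  by rewrite mulrNz mulNr divff ?acosN1 // pnatr_eq0.
(* Theta sees only the first entry of [rep_data]. Among 2, 1, 0, -1, -1, -2 the value -1 occurs
   twice, whence the union of two luminous orbits. *)
split=> [||x|x|].
- by split; [exact: orbE | exact: orbU].
- exact: (O_zero rootsP simpleP typeP chevP cardK delta).
- rewrite /singular -a1 th; split=> [[i [i6]]|h]; last by exists 1%N.
  by do 6?[case: i i6 => [|i] i6].
- rewrite /brilliant -a2 th; split=> [[i [i6]]|h]; last by exists 2%N.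
  by do 6?[case: i i6 => [|i] i6].
split=> x.
- rewrite /luminous -a3 th in_setU; split=> [[i [i6]]|/orP[] h].
  + by do 6?[case: i i6 => [|i] i6] => // _ h; apply/orP; [left|right].
  + by exists 3%N.
  + by exists 4%N.
- rewrite /dark -a5 th; split=> [[i [i6]]|h]; last by exists 5%N.
  by do 6?[case: i i6 => [|i] i6].
Qed.
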